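(* Let $G$ be a simple algebraic group, $H\subset G$ a connected reductive subgroup, $\mathfrak g=\mathfrak h\oplus\mathfrak m$ with $\mathfrak m=\mathfrak h^\perp$, and let $\mathcal O\subset\mathfrak g$ be a nilpotent $G$-orbit in which $H$ has a dense orbit $\Omega_{\mathcal O}$. Let $e=a+b\in\Omega_{\mathcal O}$ with $a\in\mathfrak h$, $b\in\mathfrak m$, and let $\mathcal P=\langle a,b\rangle$ be the linear span of $a$ and $b$. Then $b\in\overline{G\cdot a}$ and $(G\cdot a)\cap\mathcal P$ is dense in $\mathcal P$.
   Context: The ground field is algebraically closed of characteristic $0$. $\mathfrak g=\mathrm{Lie}\,G$, $\mathfrak h=\mathrm{Lie}\,H$, and $\mathfrak m=\mathfrak h^\perp$ is the orthogonal complement of $\mathfrak h$ with respect to the Killing form of $\mathfrak g$. In this situation $a,b$ are nilpotent and $[a,b]=0$; $\mathcal P$ is called a commutative plane related to $(H,\mathcal O)$. *)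

(* Defs.v *)
From mathcomp Require Import all_boot all_algebra.
From mathcomp Require Import mpoly.
From mathcomp Require Import boolp classical_sets functions cardinality.

Set Implicit Arguments.
Unset Strict Implicit.
Unset Printing Implicit Defensive.

Import GRing.Theory.

Local Open Scope classical_set_scope.
Local Open Scope ring_scope.

(* The vector subspace whose set of elements is S; junk value 0 when S is not
   a linear subspace (see [mem_vspace_of]). *)
Definition vspace_of (K : fieldType) (V : vectType K) (S : set V) :
    {vspace V} :=
  xget 0%VS [set U : {vspace V} | [set` U] = S].

Lemma mem_vspace_of (K : fieldType) (V : vectType K) (S : set V) :
  S 0 -> (forall (c : K) (u v : V), S u -> S v -> S (c *: u + v)) ->
  forall v, (v \in vspace_of S) <-> S v.
Proof.
move=> S0 SL.
suff [U US] : exists U : {vspace V}, [set` U] = S.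
  have E : [set` vspace_of S] = S.
    exact: (@xgetPex _ 0%VS [set U0 : {vspace V} | [set` U0] = S] (ex_intro _ U US)).
  by move=> v; rewrite -[in X in _ <-> X]E.
pose P d := `[< exists U : {vspace V}, \dim U = d /\ [set` U] `<=` S >].
have exP : exists d, P d.
  exists 0%N; apply/asboolP; exists 0%VS; split; first exact: dimv0.
  by move=> v /=; rewrite memv0 => /eqP ->.
have bP d : P d -> (d <= \dim {:V})%N.
  by move=> /asboolP[U [<- _]]; exact: dimvS (subvf U).
case: (ex_maxnP exP bP) => d /asboolP[U [dU US]] maxd.
exists U; apply/seteqP; split=> // v Sv /=.
have USv : [set` (U + <[v]>)%VS] `<=` S.
  move=> w /= /memv_addP[u uU [x /vlineP[c ->] ->]].
  by rewrite addrC; apply: SL => //; exact: US.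
have le : (\dim (U + <[v]>) <= \dim U)%N.
  by rewrite dU; apply: maxd; apply/asboolP; exists (U + <[v]>)%VS.
have /eqP -> : U == (U + <[v]>)%VS by rewrite eqEdim addvSl le.
exact: subvP (addvSr _ _) _ (memv_line v).
Qed.

Section Matrices.
Variables (K : closedFieldType) (n : nat).
Implicit Types (S T G H U N O : set 'M[K]_n) (A X Y g : 'M[K]_n).

(* Polynomial functions on the affine space of n x n matrices, in the n * n
   matrix entries. *)
Definition mx_eval (p : {mpoly K[n * n]}) A : K := p.@[fun i => mxvec A 0 i].

Definition zariski_closed S :=
  exists I : set {mpoly K[n * n]},
    S = [set A | forall p, I p -> mx_eval p A = 0].

Definition zariski_closure S : set 'M[K]_n :=
  [set A | forall T, zariski_closed T -> S `<=` T -> T A].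

Definition dense_in S T := S `<=` T /\ T `<=` zariski_closure S.

(* Connectedness in the topology induced by the Zariski topology. *)
Definition zariski_connected S :=
  forall T1 T2, zariski_closed T1 -> zariski_closed T2 ->
    S `<=` T1 `|` T2 -> S `&` T1 `&` T2 = set0 ->
    S `<=` T1 \/ S `<=` T2.

(* Linear algebraic groups, realised as Zariski closed subgroups of GL_n. *)
Definition algebraic_group G :=
  [/\ G 1%:M,
      forall g1 g2, G g1 -> G g2 -> G (g1 *m g2),
      forall g, G g -> G (invmx g)
    & exists2 Z, zariski_closed Z & G = Z `&` [set g | g \in unitmx]].

Definition normal_in N G :=
  N `<=` G /\ forall g x, G g -> N x -> N (g *m x *m invmx g).

Definition unipotent A := exists k : nat, (A - 1%:M) ^+ k = 0.

Definition nilpotent_mx X := exists k : nat, X ^+ k = 0.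

(* Simple in the sense of algebraic groups: a finite centre is allowed. *)
Definition simple_group G :=
  [/\ algebraic_group G,
      zariski_connected G,
      exists g1 g2, [/\ G g1, G g2 & g1 *m g2 <> g2 *m g1]
    & forall N, algebraic_group N -> normal_in N G -> N <> G -> finite_set N].

(* The unipotent radical is trivial. *)
Definition reductive_group G :=
  algebraic_group G /\
  forall U, algebraic_group U -> zariski_connected U -> normal_in U G ->
    (forall u, U u -> unipotent u) -> U = [set 1%:M].

(* Zariski tangent space at A, cut out by the differentials at A of all the
   polynomials vanishing on S. *)
Definition tangent_space S A : {vspace 'M[K]_n} :=
  vspace_of [set X | forall p : {mpoly K[n * n]},
    (forall B, S B -> mx_eval p B = 0) ->
    \sum_(i < n * n) mx_eval (p^`M(i)) A * mxvec X 0 i = 0].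

Definition Lie G : {vspace 'M[K]_n} := tangent_space G 1%:M.

Definition lie_bracket X Y : 'M[K]_n := X *m Y - Y *m X.

(* Trace of (ad X \o ad Y) acting on the Lie algebra L, for X and Y in L. *)
Definition killing_form (L : {vspace 'M[K]_n}) X Y : K :=
  \sum_(i < \dim L)
    coord (vbasis L) i (lie_bracket X (lie_bracket Y (vbasis L)`_i)).

Definition killing_orth (L L1 : {vspace 'M[K]_n}) : {vspace 'M[K]_n} :=
  vspace_of [set X | X \in L /\ forall Y, Y \in L1 -> killing_form L X Y = 0].

Definition Ad_orbit G X : set 'M[K]_n :=
  [set g *m X *m invmx g | g in G].

Definition nilpotent_orbit G O :=
  exists X, [/\ X \in Lie G, nilpotent_mx X & O = Ad_orbit G X].

Lemma mem_tangent_space S A X :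
  (X \in tangent_space S A) <->
  forall p : {mpoly K[n * n]}, (forall B, S B -> mx_eval p B = 0) ->
    \sum_(i < n * n) mx_eval (p^`M(i)) A * mxvec X 0 i = 0.
Proof.
apply: mem_vspace_of => [p _|c u v Su Sv p pS] /=.
  by apply: big1 => i _; rewrite linear0 mxE mulr0.
under eq_bigr => i _ do rewrite linearP !mxE mulrDr mulrCA.
by rewrite big_split -mulr_sumr /= Su // Sv // mulr0 addr0.
Qed.

Lemma mem_killing_orth (L L1 : {vspace 'M[K]_n}) X :
  (X \in killing_orth L L1) <->
  X \in L /\ forall Y, Y \in L1 -> killing_form L X Y = 0.
Proof.
apply: mem_vspace_of => [|c u v [uL uP] [vL vP]] /=.
  split=> [|Y _]; first exact: mem0v.
  by apply: big1 => i _; rewrite /lie_bracket mul0mx mulmx0 subr0 linear0.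
split=> [|Y YL]; first by rewrite memvD ?memvZ.
have <- : c * killing_form L u Y + killing_form L v Y = 0.
  by rewrite uP // vP // mulr0 addr0.
rewrite /killing_form mulr_sumr -big_split; apply: eq_bigr => i _ /=.
move: (lie_bracket Y _) => Z; rewrite -linearP /lie_bracket.
congr (coord _ _ _).
by rewrite mulmxDl mulmxDr -scalemxAl -scalemxAr scalerBr opprD addrACA.
Qed.

End Matrices.

(* Main.v *)
(* Write g = Lie G, h = Lie H.  Since H e is dense in G e, [h, e] = [g, e]
   (characteristic 0), so for every x in g with [x, e] in m the element [x, e]
   is Killing orthogonal to g, hence 0.  Therefore [a, b] = 0, the centralizer of
   a in h centralizes b, and some h0 in h satisfies [h0, a] = a, [h0, b] = b.
   As in the Jacobson-Morozov theorem there are w = [a, f] in h with [w, a] = 2a;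
   w - 2 h0 centralizes a, hence b, so that [w, b] = 2b.  Let g_c be the
   generalized eigenspaces of ad w.  The eigenvalues of ad w on the kernel of
   ad a are nonnegative integers, so by duality [g_0, a] = g_2, and the orbit of
   a is dense in g_2, which contains a and b.  The same holds for all x in an open
   subset of the plane, and since an orbit contains a nonempty open subset of its
   closure, these x lie in the orbit of a.

   Smoothness and Chevalley's theorem enter in an elementary form: for a prime
   ideal of polynomials, derivations and K-points extend when a variable is
   adjoined, off the zero set of a polynomial outside the ideal.  The
   nondegeneracy of the Killing form follows from the arguments of Cartan and
   Engel, once a G-stable abelian ideal of g is shown to vanish. *)
Require Import Defs.
From HB Require Import structures.
From mathcomp Require Import all_boot all_algebra.
From mathcomp Require Import fingroup perm ring.
From mathcomp Require Import mpoly.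
From mathcomp Require Import boolp classical_sets functions cardinality.

Set Implicit Arguments.
Unset Strict Implicit.
Unset Printing Implicit Defensive.

Import GRing.Theory.

Local Open Scope classical_set_scope.
Local Open Scope ring_scope.

(** * Polynomials in several variables *)

(** The argument needs conjugation to be a polynomial map, yet matrix inversion is not polynomial.
    Simplicity removes this obstacle: a simple group has no nontrivial polynomial character, so its
    determinant is 1 and the inverse is the adjugate. Write k for the Killing form. As [h, e] =
    [g, e], invariance gives k([x, e], y) = k(x, [e, y]) = k(x, [e, z]) = k([x, e], z) with z in h,
    and this is zero when [x, e] lies in m. The element h0 comes from e = [z, e] with z in g, which
    holds because e is orthogonal to the kernel of ad e; z is then replaced by an element of h, and
    the components in h and m are compared. Duality means that the image of (ad x)^k is the Killing
    orthogonal of its kernel. Density in the plane is tested on lines through a: the map X ->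
    [X, a + t(y - a)] from g_0 to g_2 stays onto for all but finitely many t. *)

Lemma mderivXU (R : nzRingType) n (i j : 'I_n) : ('X_i : {mpoly R[n]})^`M(j) = (i == j)%:R.
Proof.
rewrite mderivX mnm1E; have [->|_] := eqVneq i j; last by rewrite scale0r.
by rewrite -[X in (X - _)%MM]add0m addmK mpolyX0 scale1r.
Qed.

Lemma lift_max_widen n (j : 'I_n) : lift ord_max j = widen_ord (leqnSn n) j.
Proof. by apply/ord_inj; rewrite lift_max. Qed.

Section MpolyMorphisms.
Variables (K : comNzRingType) (n : nat) (T : comNzRingType).

Lemma mpoly_rmorph_ext (f g : {rmorphism {mpoly K[n]} -> T}) :
  (forall c, f c%:MP = g c%:MP) -> (forall i, f 'X_i = g 'X_i) -> f =1 g.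
Proof.
move=> fgC fgX; elim/mpolyind=> [|c m p _ _ IH]; first by rewrite !rmorph0.
rewrite !rmorphD IH; congr (_ + _).
rewrite -mul_mpolyC !rmorphM fgC mpolyXE_id !rmorph_prod; congr (_ * _).
by apply: eq_bigr => i _; rewrite !rmorphXn /= fgX.
Qed.

Variable f : {rmorphism {mpoly K[n]} -> T}.

Lemma mpoly_derivation_ext (d1 d2 : {mpoly K[n]} -> T) :
  {morph d1 : p q / p + q} -> {morph d2 : p q / p + q} ->
  (forall p q, d1 (p * q) = f p * d1 q + d1 p * f q) ->
  (forall p q, d2 (p * q) = f p * d2 q + d2 p * f q) ->
  (forall c, d1 c%:MP = d2 c%:MP) -> (forall i, d1 'X_i = d2 'X_i) ->
  d1 =1 d2.
Proof.
move=> d1D d2D d1M d2M dC dX.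
have dE p q : d1 p = d2 p -> d1 q = d2 q -> d1 (p * q) = d2 (p * q).
  by rewrite d1M d2M => -> ->.
have d1E : d1 1 = d2 1 by rewrite -mpolyC1 dC.
elim/mpolyind=> [|c m p _ _ IH]; first by rewrite -mpolyC0.
rewrite d1D d2D IH -mul_mpolyC; congr (_ + _); apply: (dE) => //.
rewrite mpolyXE_id; apply: (big_ind (fun x => d1 x = d2 x)) => [//||i _]; first exact: (dE).
by elim: (m i) => [|k IHk]; rewrite ?expr0 // exprS; apply: (dE).
Qed.

(* Every derivation along [f] that kills the constants is given by the partial
   derivatives; this is the only chain rule needed below. *)
Lemma mpoly_derivationE (d : {mpoly K[n]} -> T) :
  {morph d : p q / p + q} ->
  (forall p q, d (p * q) = f p * d q + d p * f q) ->
  (forall c, d c%:MP = 0) ->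
  forall p, d p = \sum_i f p^`M(i) * d 'X_i.
Proof.
move=> dD dM dC.
apply: mpoly_derivation_ext => // [p q|p q|c|i].
- by rewrite -big_split; apply: eq_bigr => i _; rewrite mderivD rmorphD mulrDl.
- rewrite mulr_sumr mulr_suml -big_split; apply: eq_bigr => i _ /=.
  by rewrite mderivM rmorphD !rmorphM mulrDl addrC mulrA mulrAC.
- by rewrite dC big1 // => i _; rewrite mderivC rmorph0 mul0r.
- rewrite (bigD1 i) //= big1 => [|j ji].
    by rewrite mderivXU eqxx rmorph1 mul1r addr0.
  by rewrite mderivXU eq_sym (negbTE ji) rmorph0 mul0r.
Qed.

End MpolyMorphisms.

Section SplitLast.
Variables (K : comNzRingType) (n : nat).

Definition msplit_var (i : 'I_n.+1) : {poly {mpoly K[n]}} :=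
  if unlift ord_max i is Some j then ('X_j)%:P else 'X.

Definition msplit : {mpoly K[n.+1]} -> {poly {mpoly K[n]}} :=
  mmap (polyC \o @mpolyC n K) msplit_var.

HB.instance Definition _ := GRing.RMorphism.on msplit.

Lemma msplitC c : msplit c%:MP = c%:MP%:P.
Proof. exact: mmapC. Qed.

Lemma msplitX i : msplit 'X_i = msplit_var i.
Proof. by rewrite /msplit mmapX mmap1U. Qed.

Lemma msplit_varw (i : 'I_n) : msplit_var (widen_ord (leqnSn n) i) = ('X_i)%:P.
Proof.
by rewrite -lift_max_widen /msplit_var liftK.
Qed.

Lemma msplit_var_max : msplit_var ord_max = 'X.
Proof. by rewrite /msplit_var unlift_none. Qed.

Definition mjoin (P : {poly {mpoly K[n]}}) : {mpoly K[n.+1]} :=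
  (map_poly (@mwiden n K) P).['X_ord_max].

HB.instance Definition _ :=
  GRing.RMorphism.copy mjoin (horner_eval ('X_ord_max) \o map_poly (@mwiden n K)).

(** This retraction carries the Noetherian property from [{poly {mpoly K[n]}}] back to [{mpoly
    K[n.+1]}]. *)
Lemma msplitK : cancel msplit mjoin.
Proof.
move=> p; rewrite -[RHS]/(idfun p) -[LHS]/((mjoin \o msplit) p).
apply: mpoly_rmorph_ext => [c|i] /=.
  by rewrite msplitC /mjoin map_polyC hornerC /= mwidenC.
rewrite msplitX; case: (unliftP ord_max i) => [j ->|->].
  by rewrite lift_max_widen msplit_varw /mjoin map_polyC hornerC /= mwidenX mnmwiden1.
by rewrite msplit_var_max /mjoin map_polyX hornerX.
Qed.

End SplitLast.

(** * Hilbert's basis theorem *)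

Section Noetherian.
Implicit Types R S : comNzRingType.

Record is_ideal R (J : set R) : Prop := IsIdeal {
  ideal0 : J 0;
  idealD : forall x y, J x -> J y -> J (x + y);
  idealM : forall a x, J x -> J (a * x) }.

Lemma idealN R (J : set R) x : is_ideal J -> J x -> J (- x).
Proof. by move=> iJ Jx; rewrite -mulN1r; apply: idealM. Qed.

Lemma idealB R (J : set R) x y : is_ideal J -> J x -> J y -> J (x - y).
Proof. by move=> iJ Jx Jy; apply: idealD => //; apply: idealN. Qed.

Lemma ideal_sum R (J : set R) (I : Type) (r : seq I) (P : pred I) (F : I -> R) :
  is_ideal J -> (forall i, P i -> J (F i)) -> J (\sum_(i <- r | P i) F i).
Proof. by move=> iJ JF; elim/big_ind: _ => //; [apply: ideal0 | apply: idealD]. Qed.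

(** An intersection of ideals: membership is used by choosing [J], so no linear combination is ever
    written down. *)
Definition gen R (f : nat -> R) n : set R :=
  [set x | forall J, is_ideal J -> (forall i, (i < n)%N -> J (f i)) -> J x].

Lemma gen_ideal R (f : nat -> R) n : is_ideal (gen f n).
Proof.
split=> [J iJ _|x y gx gy J iJ fJ|a x gx J iJ fJ]; first exact: ideal0.
  by apply: idealD; [|apply: gx|apply: gy].
by apply: idealM => //; apply: gx.
Qed.

Lemma genW R (f : nat -> R) m n : (m <= n)%N -> gen f m `<=` gen f n.
Proof. by move=> mn x gx J iJ fJ; apply: gx => // i im; apply: fJ; apply: leq_trans mn. Qed.

(** The ascending chain condition, tested on one new generator per step. *)
Definition noetherian R := forall f : nat -> R, exists n, gen f n (f n).

Lemma noetherian_field (F : fieldType) : noetherian F.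
Proof.
move=> f; have [f0|f0] := eqVneq (f 0%N) 0; first by exists 0%N => J iJ _; rewrite f0; apply: ideal0.
by exists 1%N => J iJ fJ; rewrite -[f 1%N](divfK f0); apply: idealM => //; apply: fJ.
Qed.

(** The preimage under [v] of an ideal of [S] is an ideal of [R], and it contains [u x] exactly when
    the given ideal contains [x]. *)
Lemma noetherian_image R S (u : {rmorphism S -> R}) (v : {rmorphism R -> S}) :
  cancel u v -> noetherian R -> noetherian S.
Proof.
move=> uK nR f; have [n fn] := nR (u \o f); exists n => J iJ fJ.
rewrite -[f n]uK; apply: (fn (fun x => J (v x))) => [|i /fJ] /=; last by rewrite uK.
split=> [|x y Jx Jy|a x Jx]; rewrite ?rmorph0 ?rmorphD ?rmorphM; first exact: ideal0.
  exact: idealD.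
exact: idealM.
Qed.

(** Hilbert's argument: a bad sequence yields [g], each [g n] being of least size in [I] outside the
    ideal of its predecessors. A relation between leading coefficients cancels the top term of [g n]
    and contradicts minimality. *)
Theorem noetherian_poly R : noetherian R -> noetherian {poly R}.
Proof.
move=> nR f; apply: contrapT => /forallNP fbad.
pose I x := exists n, gen f n x.
pose next (s : seq {poly R}) x := (forall i, (i < size s)%N -> I s`_i) ->
  [/\ I x, ~ gen (nth 0 s) (size s) x &
      forall y, I y -> ~ gen (nth 0 s) (size s) y -> (size x <= size y)%N].
have [nxt nxtP] : {nxt & forall s, next s (nxt s)}.
  (* The default 0 is harmless: [next] constrains only lists contained in [I]. *)
  apply: choice => s; have [sI|nsI] := pselect (forall i, (i < size s)%N -> I s`_i); last first.
    by exists 0.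
  have [m sm] : exists m, forall i, (i < size s)%N -> gen f m s`_i.
    move: sI; elim: (size s) => [|k IHk] sI; first by exists 0%N.
    have [i ik|m mP] := IHk; first by apply: sI; apply: ltnW.
    have [m' m'P] := sI k (ltnSn k).
    exists (maxn m m') => i; rewrite ltnS leq_eqVlt => /orP[/eqP ->|ik].
      exact: genW (leq_maxr _ _) _ m'P.
    exact: genW (leq_maxl _ _) _ (mP _ ik).
  have fm : ~ gen (nth 0 s) (size s) (f m).
    by move=> /(_ _ (gen_ideal f m) sm); apply: fbad.
  have exP : exists d, `[< exists x, [/\ I x, ~ gen (nth 0 s) (size s) x & size x = d] >].
    exists (size (f m)); apply/asboolP; exists (f m); split=> //.
    by exists m.+1 => J iJ; apply.
  have := ex_minnP exP => -[d /asboolP[x [Ix xs <-]] xmin].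
  exists x => _; split=> // y Iy ys; apply: xmin; apply/asboolP.
  by exists y.
pose s n := iter n (fun s => rcons s (nxt s)) [::].
pose g n := nxt (s n).
have size_s n : size (s n) = n by elim: n => //= n IHn; rewrite size_rcons IHn.
have sE n i : (i < n)%N -> (s n)`_i = g i.
  elim: n => // n IHn; rewrite ltnS /= nth_rcons size_s => le_in.
  by case: ltngtP le_in => [/IHn//|//|->].
have sI n i : (i < size (s n))%N -> I (s n)`_i.
  rewrite size_s; elim/ltn_ind: n i => n IHn i lt_in; rewrite sE //.
  by have [|//] := nxtP (s i); rewrite size_s => j; apply: IHn.
have gen_s n x : gen (nth 0 (s n)) (size (s n)) x <-> gen g n x.
  rewrite size_s; split=> gx J iJ gJ; apply: gx => // i lt_in.
    by rewrite sE //; apply: gJ.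
  by rewrite -(sE n) //; apply: gJ.
have gI n : I (g n) by have [] := nxtP (s n) (sI n).
have gbad n : ~ gen g n (g n) by move=> /gen_s; have [] := nxtP (s n) (sI n).
have gmin n y : I y -> ~ gen g n y -> (size (g n) <= size y)%N.
  by move=> Iy ny; have [_ _] := nxtP (s n) (sI n); apply=> // /gen_s.
have [n lcn] := nR (fun i => lead_coef (g i)).
have gn0 : g n != 0 by apply/eqP => gn0; apply: (gbad n); rewrite gn0; apply: ideal0 (gen_ideal _ _).
have sz i : (i < n)%N -> (size (g i) <= size (g n))%N.
  by move=> lt_in; apply: gmin => // /(genW (ltnW lt_in)); apply: gbad.
(* Coefficients at the top index of [g n] are used instead of leading coefficients, so that the set
   is closed under sums; a power of the variable moves the leading coefficient of [g i] to that
   index. *)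
pose J : set R := [set a | exists2 h, gen g n h &
  (size h <= size (g n))%N /\ h`_(size (g n)).-1 = a].
have [h hg [hsz hlc]] : J (lead_coef (g n)).
  apply: (lcn J) => [|i lt_in]; last first.
    exists (g i * 'X^(size (g n) - size (g i))).
      by rewrite mulrC; apply: (idealM (gen_ideal g n)) => J' _; apply.
    split.
      apply: (leq_trans (size_polyMleq _ _)); rewrite size_polyXn addnS /=.
      by rewrite subnKC // sz.
    rewrite coefMXn lead_coefE.
    have [-> |gi0] := eqVneq (g i) 0; first by rewrite !coef0 if_same.
    have : (0 < size (g i))%N by rewrite size_poly_gt0.
    move=> si0; rewrite ltnNge.
    have -> : (size (g n) - size (g i) <= (size (g n)).-1)%N.
      by rewrite -subn1 leq_sub2l.
    by rewrite /= -subn1 -subnDA [(1 + _)%N]addnC subnDA subKn ?sz // subn1.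
  split=> [|_ _ [h1 g1 [s1 <-]] [h2 g2 [s2 <-]]|a _ [h1 g1 [s1 <-]]].
  - exists 0; first exact: ideal0 (gen_ideal _ _).
    by rewrite size_poly0 coef0.
  - exists (h1 + h2); first exact: idealD (gen_ideal _ _) _ _ g1 g2.
    by rewrite coefD (leq_trans (size_polyD _ _)) // geq_max s1.
  - exists (a%:P * h1); first exact: idealM (gen_ideal _ _) _ _ g1.
    by rewrite coefCM mul_polyC (leq_trans (size_scale_leq _ _)).
have Ih : I (g n - h).
  have [m gm] := gI n.
  have [m' gm'] : exists m', forall i, (i < n)%N -> gen f m' (g i).
    elim: (n) => [|k [m1 m1P]]; first by exists 0%N.
    have [m2 m2P] := gI k; exists (maxn m1 m2) => i.
    rewrite ltnS leq_eqVlt => /orP[/eqP ->|ik]; first exact: genW (leq_maxr _ _) _ m2P.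
    exact: genW (leq_maxl _ _) _ (m1P _ ik).
  exists (maxn m m'); apply: idealB (gen_ideal _ _) _ _.
    exact: genW (leq_maxl _ _) _ gm.
  exact: genW (leq_maxr _ _) _ (hg _ (gen_ideal _ _) gm').
have := gmin n _ Ih; apply/not_implyP; split.
  move=> ghn; apply: (gbad n); rewrite -[g n](subrK h).
  exact: idealD (gen_ideal _ _) _ _ ghn hg.
apply/negP; rewrite -ltnNge.
have gs0 : (0 < size (g n))%N by rewrite size_poly_gt0.
rewrite -(prednK gs0) ltnS; apply/leq_sizeP => j; rewrite leq_eqVlt coefB.
case/orP=> [/eqP <-|]; first by rewrite hlc lead_coefE subrr.
rewrite prednK // => le_gj.
by rewrite !nth_default ?subrr // (leq_trans hsz).
Qed.

Theorem noetherian_mpoly (F : fieldType) n : noetherian {mpoly F[n]}.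
Proof.
elim: n => [|n IHn]; last first.
  exact: noetherian_image (@msplitK F n) (noetherian_poly IHn).
(* Base case: without variables every polynomial is a constant. *)
move=> f; have fE i : f i = ((f i)@_0%MM)%:MP.
  apply/mpolyP => m; rewrite mcoeffC.
  have -> : m = 0%MM by apply/mnmP => -[].
  by rewrite eqxx mulr1.
have [n gn] := @noetherian_field F (fun i => (f i)@_0%MM).
exists n => J iJ fJ; rewrite fE.
apply: (gn (fun c => J c%:MP)) => [|i /fJ]; last by rewrite {1}fE.
split=> [|x y Jx Jy|a x Jx]; rewrite ?mpolyC0 ?mpolyCD ?mpolyCM; first exact: ideal0.
  exact: idealD.
exact: idealM.
Qed.

End Noetherian.

(** * Irreducibility of connected algebraic groups *)

Section MatrixEvaluation.
Variables (K : comNzRingType) (n : nat).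
Local Notation N := (n * n)%N.

(** The target ring varies: [K] gives values at a matrix, [{poly K}] restriction to a curve, [{mpoly
    K[N]}] substitution of a matrix of polynomials. *)
Definition mxe (T : comNzRingType) (f : {rmorphism K -> T}) (M : 'M[T]_n) :
  {mpoly K[N]} -> T := mmap f (fun i => mxvec M 0 i).

HB.instance Definition _ T f M := GRing.RMorphism.on (@mxe T f M).

Lemma mxeC T f M c : @mxe T f M c%:MP = f c.
Proof. exact: mmapC. Qed.

Lemma mxeX T f M i : @mxe T f M 'X_i = mxvec M 0 i.
Proof. by rewrite /mxe mmapX mmap1U. Qed.

Lemma mxe_comp (T U : comNzRingType) (f : {rmorphism K -> T})
    (u : {rmorphism T -> U}) M p :
  u (mxe f M p) = mxe (u \o f : {rmorphism K -> U}) (map_mx u M) p.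
Proof.
rewrite -[LHS]/((u \o mxe f M) p); apply: mpoly_rmorph_ext p => [c|i] /=.
  by rewrite !mxeC.
by rewrite !mxeX -map_mxvec mxE.
Qed.

Lemma eq_mxe (T : comNzRingType) (f g : {rmorphism K -> T}) M p :
  f =1 g -> mxe f M p = mxe g M p.
Proof. by move=> fg; apply: mpoly_rmorph_ext p => [c|i] /=; rewrite ?mxeC ?mxeX ?fg. Qed.

(** The generic matrix, whose entries are the coordinate functions. *)
Definition gmx : 'M[{mpoly K[N]}]_n := vec_mx (\row_i 'X_i).

Lemma mxe_gmx T f M : map_mx (@mxe T f M) gmx = M.
Proof.
apply: (can_inj mxvecK); apply/rowP => i.
by rewrite -map_mxvec mxE vec_mxK mxE mxeX.
Qed.

Lemma mxe_const (T : comNzRingType) (f : {rmorphism K -> T}) M m1 m2 (A : 'M[K]_(m1, m2)) :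
  map_mx (mxe f M) (map_mx (@mpolyC N K) A) = map_mx f A.
Proof. by apply/matrixP => i j; rewrite !mxE mxeC. Qed.

Definition msubst (B : 'M[{mpoly K[N]}]_n) : {mpoly K[N]} -> {mpoly K[N]} :=
  mxe (@mpolyC N K) B.

HB.instance Definition _ B := GRing.RMorphism.on (msubst B).

Lemma mxe_subst (T : comNzRingType) (f : {rmorphism K -> T}) M B p :
  mxe f M (msubst B p) = mxe f (map_mx (mxe f M) B) p.
Proof. by rewrite mxe_comp; apply: eq_mxe => c /=; rewrite mxeC. Qed.

End MatrixEvaluation.
Arguments gmx {K n}.

Section Zariski.
Variables (K : closedFieldType) (n : nat).
Implicit Types (S G : set 'M[K]_n) (A g : 'M[K]_n).
Local Notation N := (n * n)%N.

Lemma mx_evalE (p : {mpoly K[N]}) A : mx_eval p A = mxe idfun A p.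
Proof. by []. Qed.

Lemma mx_eval0 A : mx_eval (0 : {mpoly K[N]}) A = 0.
Proof. by rewrite mx_evalE rmorph0. Qed.

Lemma mx_eval1 A : mx_eval (1 : {mpoly K[N]}) A = 1.
Proof. by rewrite mx_evalE rmorph1. Qed.

Lemma mx_evalD (p q : {mpoly K[N]}) A : mx_eval (p + q) A = mx_eval p A + mx_eval q A.
Proof. by rewrite mx_evalE rmorphD. Qed.

Lemma mx_evalM (p q : {mpoly K[N]}) A : mx_eval (p * q) A = mx_eval p A * mx_eval q A.
Proof. by rewrite mx_evalE rmorphM. Qed.

Lemma mx_evalB (p q : {mpoly K[N]}) A : mx_eval (p - q) A = mx_eval p A - mx_eval q A.
Proof. by rewrite mx_evalE rmorphB. Qed.

Lemma mx_evalC c A : mx_eval (c%:MP : {mpoly K[N]}) A = c.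
Proof. by rewrite mx_evalE mxeC. Qed.

Definition vanish S : set {mpoly K[N]} := [set p | forall A, S A -> mx_eval p A = 0].

Lemma vanish_ideal S : is_ideal (vanish S).
Proof.
split=> [A _|p q pS qS A SA|p q qS A SA]; first exact: mx_eval0.
  by rewrite mx_evalD pS ?qS ?addr0.
by rewrite mx_evalM qS ?mulr0.
Qed.

Lemma vanishS S1 S2 : S1 `<=` S2 -> vanish S2 `<=` vanish S1.
Proof. by move=> S12 p pS2 A /S12; apply: pS2. Qed.

Lemma zariski_closureP S A :
  zariski_closure S A <-> forall p, vanish S p -> mx_eval p A = 0.
Proof.
split=> [clA p pS|pA T [I ->] ST /= p Ip].
  apply: (clA [set A | forall q, [set p] q -> mx_eval q A = 0]).
    by exists [set p].
  by move=> B SB q ->; apply: pS.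
  by [].
by apply: pA => B /ST; apply.
Qed.

Lemma zariski_closure_closed S : zariski_closed (zariski_closure S).
Proof.
by exists (vanish S); apply/seteqP; split=> A /zariski_closureP.
Qed.

Lemma vanish_closure S : vanish (zariski_closure S) = vanish S.
Proof.
apply/seteqP; split=> p pS A SA; last by move/zariski_closureP: SA; apply.
by apply: pS; apply/zariski_closureP => q; apply.
Qed.

Definition lmul g : {mpoly K[N]} -> {mpoly K[N]} := msubst (map_mx (@mpolyC N K) g *m gmx).
Definition rmul g : {mpoly K[N]} -> {mpoly K[N]} := msubst (gmx *m map_mx (@mpolyC N K) g).

Lemma mx_eval_lmul g p A : mx_eval (lmul g p) A = mx_eval p (g *m A).
Proof. by rewrite !mx_evalE mxe_subst map_mxM mxe_gmx mxe_const map_mx_id. Qed.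

Lemma mx_eval_rmul g p A : mx_eval (rmul g p) A = mx_eval p (A *m g).
Proof. by rewrite !mx_evalE mxe_subst map_mxM mxe_gmx mxe_const map_mx_id. Qed.

End Zariski.

Record is_prime (R : comNzRingType) (J : set R) : Prop := IsPrime {
  prime_ideal : is_ideal J;
  prime_1 : ~ J 1;
  primeM : forall x y, J (x * y) -> J x \/ J y }.

Lemma prime_prod (R : comNzRingType) (J : set R) (T : eqType) (s : seq T) (F : T -> R) :
  is_prime J -> J (\prod_(i <- s) F i) -> exists2 i, i \in s & J (F i).
Proof.
move=> pJ; elim: s => [|a s IHs]; first by rewrite big_nil => /(prime_1 pJ).
rewrite big_cons => /(primeM pJ)[Ja|/IHs[i si Ji]]; first by exists a; rewrite ?mem_head.
by exists i; rewrite // in_cons si orbT.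
Qed.

Section AlgebraicGroups.
Variables (K : closedFieldType) (n : nat).
Implicit Types (S G : set 'M[K]_n) (A g : 'M[K]_n).
Local Notation N := (n * n)%N.

Lemma alg_group_unit G g : algebraic_group G -> G g -> g \in unitmx.
Proof. by move=> [_ _ _ [Z _ ->]] []. Qed.

(** Without a maximal annihilator there is a strictly ascending chain of them; choosing in each an
    element [q i] missing from the one before gives a sequence that contradicts [noetherian]. *)
Lemma maximal_annihilator (R : comNzRingType) (I : set R) :
  noetherian R -> is_ideal I -> ~ I 1 ->
  exists2 p, ~ I p & forall p', ~ I p' ->
    (forall q, I (p * q) -> I (p' * q)) -> forall q, I (p' * q) -> I (p * q).
Proof.
move=> nR iI I1; apply: contrapT => nomax.
have step p : exists p', ~ I p -> [/\ ~ I p', (forall q, I (p * q) -> I (p' * q)) &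
    exists2 q, I (p' * q) & ~ I (p * q)].
  have [Ip|nIp] := pselect (I p); first by exists p.
  apply: contrapT => nop'; apply: nomax; exists p => // p' nIp' sub q Iq.
  by apply: contrapT => nIq; apply: nop'; exists p' => _; split=> //; exists q.
have [nxt nxtP] := choice step.
pose p i := iter i nxt 1.
have pI i : ~ I (p i) by elim: i => // i /nxtP[].
have pS i q : I (p i * q) -> I (p i.+1 * q) by have [_ + _] := nxtP _ (pI i); apply.
have pq i : exists q, I (p i.+1 * q) /\ ~ I (p i * q).
  by have [_ _ [q]] := nxtP _ (pI i); exists q.
have [q qP] := choice pq.
have [k gk] := nR q.
have [_] := qP k; apply; apply: (gk (fun x => I (p k * x))) => [|i].
  split=> [|x y Ix Iy|a x Ix]; first by rewrite mulr0; apply: ideal0.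
    by rewrite mulrDr; apply: idealD.
  by rewrite mulrCA; apply: idealM.
elim: (k) => // j IHj; rewrite ltnS leq_eqVlt => /orP[/eqP ->|/IHj /pS //].
by have [] := qP j.
Qed.

(* A nonempty principal open subset [U] whose annihilator is maximal is
   irreducible; every translate of [U] that contains a point of the closure of
   [U] then meets [U] and lies in that closure, which is therefore open. *)
Theorem vanish_prime G :
  algebraic_group G -> zariski_connected G -> is_prime (vanish G).
Proof.
move=> aG cG; have [G1 GM GV [Z0 _ GE]] := aG.
have uG g : G g -> g \in unitmx by apply: alg_group_unit.
have I1 : ~ vanish G 1.
  by move=> /(_ _ G1)/eqP; rewrite mx_eval1 oner_eq0.
have iI := vanish_ideal G.
have [p pI pmax] := maximal_annihilator (@noetherian_mpoly K N) iI I1.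
pose U := [set A | G A /\ mx_eval p A != 0].
have vU q : vanish U q <-> vanish G (p * q).
  split=> [qU A GA|qp A [GA pA]].
    rewrite mx_evalM; have [->|pA] := eqVneq (mx_eval p A) 0.
      by rewrite mul0r.
    by rewrite qU ?mulr0.
  have /eqP := qp A GA; rewrite mx_evalM mulf_eq0 (negbTE pA).
  by move/eqP.
have pU : is_prime (vanish U).
  split; first exact: vanish_ideal.
    by move=> /vU; rewrite mulr1.
  (* If [p * x] is not in the ideal, its annihilator contains that of [p], hence equals it by
     maximality, and [y] belongs to it. *)
  move=> x y /vU pxy; have [/vU|nx] := pselect (vanish G (p * x)); first by left.
  right; apply/vU; apply: (pmax (p * x)) => // [q pq|]; last by rewrite -mulrA.
  by rewrite mulrAC mulrC; apply: (idealM iI).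
have [u Uu] : exists u, U u.
  apply: contrapT => noU; apply: pI => A GA; apply: contrapT => /eqP pA.
  by apply: noU; exists A.
pose Z := zariski_closure U.
have UG : U `<=` G by move=> A [].
(* For [q] vanishing on [U], the translate of [p * q] vanishes on [U]; its factor from [p] does not
   vanish at [y], so by primality the factor from [q] vanishes on [U]. *)
have claim1 g y w : G g -> U y -> U (g *m y) -> U w -> Z (g *m w).
  move=> Gg Uy Ugy Uw; apply/zariski_closureP => q qU; rewrite -mx_eval_lmul.
  suff : vanish U (lmul g q) by apply.
  have [||//] := primeM pU (x := lmul g p) (y := lmul g q).
    move=> A UA; rewrite mx_evalM !mx_eval_lmul.
    have [->|pgA] := eqVneq (mx_eval p (g *m A)) 0; first by rewrite mul0r.
    by rewrite qU ?mulr0 //; split=> //; apply: (GM) => //; apply: (UG).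
  by move=> /(_ _ Uy); rewrite mx_eval_lmul; case: Ugy => _ /eqP.
have uu : u \in unitmx by apply/uG/UG.
have claim2 x w : G x -> Z x -> U w -> Z (x *m invmx u *m w).
  move=> Gx Zx Uw.
  have Gg : G (x *m invmx u) by apply: (GM) => //; apply/GV/UG.
  suff [y Uy Ugy] : exists2 y, U y & U (x *m invmx u *m y) by apply: claim1 Ugy Uw.
  (* Were [U] disjoint from its translate, a translate of [p] would vanish on [U], hence at [x] in
     the closure, where its value is that of [p] at [u]. *)
  apply: contrapT => noy.
  have : vanish U (lmul (u *m invmx x) p).
    move=> A UA; rewrite mx_eval_lmul; apply: contrapT => /eqP pA; apply: noy.
    exists (u *m invmx x *m A).
      by split=> //; apply: (GM); [apply: (GM); [apply: (UG)|apply: GV]|apply: (UG)].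
    by rewrite !mulmxA mulmxKV // mulmxV ?uG // mul1mx.
  move/zariski_closureP: Zx => /[apply]; rewrite mx_eval_lmul mulmxKV ?uG //.
  by case: Uu => _ /eqP.
(* Inside [G], [T2] is the complement of the union of the translates of [U] by [x *m invmx u] with
   [x] in [Z]. By [claim2] these lie in [Z], so [Z] and [T2] cover [G]; they do not meet in [G], and
   [u] is not in [T2]. *)
pose T2 := [set A | forall x, G x -> Z x -> mx_eval p (u *m invmx x *m A) = 0].
have cT2 : zariski_closed T2.
  exists [set q | exists x, [/\ G x, Z x & q = lmul (u *m invmx x) p]].
  apply/seteqP; split=> [A TA _ [x [Gx Zx ->]]|A TA x Gx Zx].
    by rewrite mx_eval_lmul TA.
  by rewrite -mx_eval_lmul; apply: TA; exists x.
have uuV : u *m invmx u = 1%:M by rewrite mulmxV // uG //; apply: (UG).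
have Zu : Z u by move=> T _; apply.
have [||GZ|GT2] := cG Z T2 (zariski_closure_closed U) cT2.
- move=> A GA; have [|nT] := pselect (T2 A); [by right|left].
  have [x [Gx Zx pA]] : exists x, [/\ G x, Z x & mx_eval p (u *m invmx x *m A) != 0].
    apply: contrapT => nox; apply: nT => x Gx Zx; apply: contrapT => /eqP pA.
    by apply: nox; exists x.
  have -> : A = x *m invmx u *m (u *m invmx x *m A).
    by rewrite !mulmxA mulmxKV // mulmxV ?uG // mul1mx.
  apply: claim2 => //; split=> //.
  by apply: (GM) => //; apply: (GM); [apply: (UG)|apply: GV].
- apply/seteqP; split=> // A [[GA ZA]] /(_ A GA ZA) /eqP.
  by rewrite mulmxKV ?uG // => pA; case: Uu => _ /negP.
- have -> // : vanish G = vanish U.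
  apply/seteqP; split; first exact: vanishS.
  by rewrite -(vanish_closure U); apply: vanishS.
- by have /eqP := GT2 u (UG _ Uu) u (UG _ Uu) Zu; rewrite mulmxKV //; case: Uu => _ /negP.
Qed.

End AlgebraicGroups.

(** * Tangent vectors of algebraic groups *)

Section Differentials.
Variables (K : closedFieldType) (n : nat).
Implicit Types (A X Y g : 'M[K]_n) (p q : {mpoly K[n * n]}).
Local Notation N := (n * n)%N.
Local Notation mpolymx := 'M[{mpoly K[N]}]_n.

Definition mdiff p A X : K := \sum_i mx_eval p^`M(i) A * mxvec X 0 i.

Lemma mdiffD p q A X : mdiff (p + q) A X = mdiff p A X + mdiff q A X.
Proof.
by rewrite -big_split; apply: eq_bigr => i _; rewrite mderivD mx_evalD mulrDl.
Qed.

Lemma mdiff0 A X : mdiff 0 A X = 0.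
Proof. by apply: big1 => i _; rewrite mderiv0 mx_eval0 mul0r. Qed.

Lemma mdiff_sum (I : Type) (r : seq I) (P : pred I) F A X :
  mdiff (\sum_(i <- r | P i) F i) A X = \sum_(i <- r | P i) mdiff (F i) A X.
Proof. by apply: (big_morph (fun p => mdiff p A X)) => [p q|]; rewrite ?mdiffD ?mdiff0. Qed.

Lemma mdiffC c A X : mdiff c%:MP A X = 0.
Proof. by apply: big1 => i _; rewrite mderivC mx_eval0 mul0r. Qed.

Lemma mdiffM p q A X : mdiff (p * q) A X = mx_eval p A * mdiff q A X + mdiff p A X * mx_eval q A.
Proof.
rewrite mulr_sumr mulr_suml -big_split; apply: eq_bigr => i _ /=.
by rewrite mderivM mx_evalD !mx_evalM mulrDl addrC mulrA mulrAC.
Qed.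

Lemma mdiffX i A X : mdiff 'X_i A X = mxvec X 0 i.
Proof.
rewrite /mdiff (bigD1 i) //= big1 => [|j ji].
  by rewrite mderivXU eqxx mx_eval1 mul1r addr0.
by rewrite mderivXU eq_sym (negbTE ji) mx_eval0 mul0r.
Qed.

Definition evmx A m1 m2 (B : 'M[{mpoly K[N]}]_(m1, m2)) := map_mx (fun p => mx_eval p A) B.
Definition dmx A X m1 m2 (B : 'M[{mpoly K[N]}]_(m1, m2)) := map_mx (fun p => mdiff p A X) B.

Lemma dmxM A X m1 m2 m3 (B : 'M_(m1, m2)) (C : 'M_(m2, m3)) :
  dmx A X (B *m C) = evmx A B *m dmx A X C + dmx A X B *m evmx A C.
Proof.
apply/matrixP => i j; rewrite !mxE mdiff_sum -big_split; apply: eq_bigr => k _ /=.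
by rewrite mdiffM !mxE.
Qed.

Lemma dmxD A X m1 m2 (B C : 'M_(m1, m2)) : dmx A X (B + C) = dmx A X B + dmx A X C.
Proof. by apply/matrixP => i j; rewrite !mxE mdiffD. Qed.

Lemma dmx_const A X m1 m2 (C : 'M_(m1, m2)) : dmx A X (map_mx (@mpolyC N K) C) = 0.
Proof. by apply/matrixP => i j; rewrite !mxE mdiffC. Qed.

Lemma dmx_gmx A X : dmx A X gmx = X.
Proof.
apply: (can_inj mxvecK); apply/rowP => i.
by rewrite /dmx -map_mxvec mxE vec_mxK mxE mdiffX.
Qed.

Lemma evmxE A m1 m2 (B : 'M_(m1, m2)) : evmx A B = map_mx (mxe idfun A) B.
Proof. by []. Qed.

Lemma evmxM A m1 m2 m3 (B : 'M_(m1, m2)) (C : 'M_(m2, m3)) :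
  evmx A (B *m C) = evmx A B *m evmx A C.
Proof. exact: map_mxM. Qed.

Lemma evmx_const A m1 m2 (C : 'M_(m1, m2)) : evmx A (map_mx (@mpolyC N K) C) = C.
Proof. by rewrite evmxE mxe_const map_mx_id. Qed.

Lemma evmx_gmx A : evmx A gmx = A.
Proof. exact: mxe_gmx. Qed.

Lemma evmx_adj A (B : mpolymx) : evmx A (\adj B) = \adj (evmx A B).
Proof. by rewrite evmxE map_mx_adj. Qed.

Lemma mx_eval_det A (B : mpolymx) : mx_eval (\det B) A = \det (evmx A B).
Proof. by rewrite evmxE det_map_mx. Qed.

Lemma mx_eval_subst (B : mpolymx) p A : mx_eval (msubst B p) A = mx_eval p (evmx A B).
Proof. by rewrite !mx_evalE mxe_subst. Qed.

Lemma mdiff_subst (B : mpolymx) p A X :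
  mdiff (msubst B p) A X = mdiff p (evmx A B) (dmx A X B).
Proof.
pose f : {rmorphism {mpoly K[N]} -> K} := mxe idfun A \o msubst B.
rewrite (@mpoly_derivationE K N K f (fun p => mdiff (msubst B p) A X)).
- apply: eq_bigr => i _; rewrite -[f _]/(mx_eval (msubst B p^`M(i)) A) mx_eval_subst.
  by congr (_ * _); rewrite /msubst mxeX /dmx -map_mxvec mxE.
- by move=> x y; rewrite rmorphD mdiffD.
- by move=> x y; rewrite rmorphM mdiffM.
- by move=> c; rewrite /msubst mxeC mdiffC.
Qed.

Lemma mdiff_lmul g p A X : mdiff (lmul g p) A X = mdiff p (g *m A) (g *m X).
Proof.
by rewrite mdiff_subst evmxM dmxM dmx_const mul0mx addr0 evmx_const evmx_gmx dmx_gmx.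
Qed.

Lemma mdiff_rmul g p A X : mdiff (rmul g p) A X = mdiff p (A *m g) (X *m g).
Proof.
by rewrite mdiff_subst evmxM dmxM dmx_const mulmx0 add0r evmx_const evmx_gmx dmx_gmx.
Qed.

Definition lform (phi : 'M[K]_n -> K) : {mpoly K[N]} :=
  \sum_i phi (vec_mx (delta_mx 0 i)) *: 'X_i.

Lemma lformE (phi : {linear 'M[K]_n -> K^o}) A : mx_eval (lform phi) A = phi A.
Proof.
rewrite mx_evalE rmorph_sum -[in RHS](mxvecK A) [mxvec A]row_sum_delta.
rewrite !linear_sum; apply: eq_bigr => i _.
by rewrite -mul_mpolyC rmorphM /= mxeC mxeX !linearZ /= mulrC.
Qed.

Lemma mdiff_lform (phi : {linear 'M[K]_n -> K^o}) A X : mdiff (lform phi) A X = phi X.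
Proof.
rewrite mdiff_sum -[in RHS](mxvecK X) [mxvec X]row_sum_delta.
rewrite !linear_sum; apply: eq_bigr => i _.
by rewrite -mul_mpolyC mdiffM mdiffC mul0r addr0 mdiffX mx_evalE mxeC !linearZ /= mulrC.
Qed.

Lemma mem_Lie G X : X \in Lie G <-> forall p, vanish G p -> mdiff p 1%:M X = 0.
Proof. exact: mem_tangent_space. Qed.

Lemma mxe_curve (c : 'M[{poly K}]_n) p :
  (mxe polyC c p)^`() = \sum_i mxe polyC c p^`M(i) * (mxvec c 0 i)^`().
Proof.
rewrite (@mpoly_derivationE K N _ (mxe polyC c) (fun p => (mxe polyC c p)^`())).
- by apply: eq_bigr => i _; rewrite mxeX.
- by move=> x y; rewrite rmorphD derivD.
- by move=> x y; rewrite rmorphM derivM addrC.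
- by move=> a; rewrite mxeC derivC.
Qed.

Lemma horner_curve (c : 'M[{poly K}]_n) p t :
  (mxe polyC c p).[t] = mx_eval p (map_mx (fun f => f.[t]) c).
Proof.
rewrite -[LHS]/(horner_eval t (mxe polyC c p)) mxe_comp mx_evalE.
by apply: eq_mxe => a /=; rewrite /horner_eval hornerC.
Qed.

End Differentials.

Lemma vspace_separation (K : fieldType) (V : vectType K) (U : {vspace V}) v : v \notin U ->
  exists2 f : 'End(V), (forall u, u \in U -> f u = 0) & f v != 0.
Proof.
move=> vU; exists (\1 - projv U)%VF => [u uU|].
  by rewrite add_lfunE opp_lfunE id_lfunE projv_id // subrr.
rewrite add_lfunE opp_lfunE id_lfunE subr_eq0.
by apply: contraNneq vU => {1}->; apply: memv_proj.
Qed.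

Section LieFacts.
Variables (K : closedFieldType) (n : nat).
Implicit Types (G : set 'M[K]_n) (A X Y g : 'M[K]_n) (p q : {mpoly K[n * n]}).
Local Notation N := (n * n)%N.

Lemma zariski_closedI S1 S2 : zariski_closed S1 -> zariski_closed S2 ->
  zariski_closed (S1 `&` S2 : set 'M[K]_n).
Proof.
move=> [I1 ->] [I2 ->]; exists (I1 `|` I2).
apply/seteqP; split=> [A [A1 A2] p [/A1|/A2]//|A AI].
by split=> p Ip; apply: AI; [left|right].
Qed.

Lemma alg_groupI G S : algebraic_group G -> zariski_closed S ->
  S 1%:M -> (forall g1 g2, G g1 -> G g2 -> S g1 -> S g2 -> S (g1 *m g2)) ->
  (forall g, G g -> S g -> S (invmx g)) -> algebraic_group (G `&` S).
Proof.
move=> [G1 GM GV [Z cZ GE]] cS S1 SM SV; split.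
- by [].
- by move=> g1 g2 [G1' S1'] [G2 S2]; split; [apply: GM|apply: SM].
- by move=> g [Gg Sg]; split; [apply: GV|apply: SV].
- by exists (Z `&` S); [apply: zariski_closedI | rewrite GE setIAC].
Qed.

(** Left translation by [g] carries the tangent space at 1 to that at [g]; on functions it is
    [lmul g], which preserves the ideal of [G]. *)
Lemma alg_group_tangent G g X p : algebraic_group G ->
  G g -> X \in Lie G -> vanish G p -> mdiff p g (g *m X) = 0.
Proof.
move=> [_ GM _ _] Gg /mem_Lie LX Ip.
rewrite -[in mdiff _ g](mulmx1 g) -mdiff_lmul; apply: LX => A GA.
by rewrite mx_eval_lmul Ip //; apply: GM.
Qed.

Lemma tangent_Lie G g Y : algebraic_group G -> G g ->
  (forall p, vanish G p -> mdiff p g Y = 0) -> Y *m invmx g \in Lie G.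
Proof.
move=> aG Gg tY; have [_ GM GV _] := aG; apply/mem_Lie => p Ip.
rewrite -(mulmxV (alg_group_unit aG Gg)) -mdiff_rmul; apply: tY => A GA.
by rewrite mx_eval_rmul Ip //; apply: GM => //; apply: GV.
Qed.

Lemma Lie_conj G g X : algebraic_group G -> G g -> X \in Lie G ->
  g *m X *m invmx g \in Lie G.
Proof.
move=> aG Gg LX; apply: tangent_Lie => // p Ip.
exact: alg_group_tangent LX Ip.
Qed.

Section UnitDeterminant.
Variable G : set 'M[K]_n.
Hypotheses (aG : algebraic_group G) (det1 : forall g, G g -> \det g = 1).

Lemma invmx_adj g : G g -> invmx g = \adj g.
Proof. by move=> Gg; rewrite /invmx (alg_group_unit aG Gg) det1 // invr1 scale1r. Qed.

(** Agrees with conjugation of [Y] where the determinant is 1, which is why the section assumes this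
    of [G]. *)
Definition conj_poly Y : 'M[{mpoly K[N]}]_n :=
  gmx *m map_mx (@mpolyC N K) Y *m \adj gmx.

Lemma evmx_conj g Y : G g -> evmx g (conj_poly Y) = g *m Y *m invmx g.
Proof.
by move=> Gg; rewrite !evmxM evmx_gmx evmx_const evmx_adj evmx_gmx invmx_adj.
Qed.

(** Differentiate the identity [gmx *m \adj gmx = (\det gmx)%:M], whose right side is constant on
    [G]. *)
Lemma dmx_adj g X : G g -> X \in Lie G ->
  dmx g (g *m X) (\adj gmx) = - (X *m invmx g).
Proof.
move=> Gg LX; have ug := alg_group_unit aG Gg.
have : dmx g (g *m X) (gmx *m \adj gmx) = 0.
  rewrite mul_mx_adj; apply/matrixP => i j; rewrite !mxE.
  have := alg_group_tangent (p := (\det gmx - 1%:MP)) aG Gg LX.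
  have -> : mdiff (\det gmx - 1%:MP : {mpoly K[N]}) g (g *m X) = mdiff (\det gmx) g (g *m X).
    by rewrite -mpolyCN mdiffD mdiffC addr0.
  move=> d0; case: eqP => _; rewrite ?mulr0n ?mdiff0 // mulr1n d0 // => A GA.
  by rewrite mx_evalB mx_eval_det evmx_gmx det1 // mx_evalC subrr.
rewrite dmxM dmx_gmx evmx_gmx evmx_adj evmx_gmx -invmx_adj // => /eqP.
rewrite addr_eq0 => /eqP /(congr1 (mulmx (invmx g))).
by rewrite mulKmx // mulmxN -!mulmxA mulKmx.
Qed.

Lemma dmx_conj g X Y : G g -> X \in Lie G ->
  dmx g (g *m X) (conj_poly Y) = g *m lie_bracket X Y *m invmx g.
Proof.
move=> Gg LX; rewrite dmxM dmx_adj // dmxM dmx_const mulmx0 add0r dmx_gmx.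
rewrite evmxM evmx_gmx evmx_const evmx_adj evmx_gmx -invmx_adj //.
by rewrite mulmxN mulmxBr mulmxBl !mulmxA addrC.
Qed.

(** A polynomial vanishing on the orbit pulls back along the orbit map of [y] to one vanishing on
    [G]; its differential at 1 is evaluated on [X]. *)
Lemma orbit_tangent x y X q : Ad_orbit G x y -> X \in Lie G ->
  vanish (Ad_orbit G x) q -> mdiff q y (lie_bracket X y) = 0.
Proof.
move=> [g Gg <-] LX Iq; set y' := _ *m invmx g.
have [G1 GM GV _] := aG.
have I : vanish G (msubst (conj_poly y') q).
  move=> k Gk; rewrite mx_eval_subst evmx_conj //; apply: Iq.
  exists (k *m g); first exact: GM.
  have uk := alg_group_unit aG Gk; have ug := alg_group_unit aG Gg.
  have -> : invmx (k *m g) = invmx g *m invmx k.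
    apply: (can_inj (mulKmx (_ : k *m g \in unitmx))); first by rewrite unitmx_mul uk.
    by rewrite mulmxV ?unitmx_mul ?uk // !mulmxA mulmxK // mulmxV.
  by rewrite !mulmxA.
have := alg_group_tangent aG G1 LX I; rewrite mdiff_subst evmx_conj // dmx_conj //.
by rewrite invmx1 !mul1mx !mulmx1.
Qed.

(** A linear form vanishing on [U] vanishes along the orbit map of [Y]; differentiating at 1 shows
    that it vanishes on the bracket. *)
Lemma stable_bracket (U : {vspace 'M[K]_n}) X Y :
  (forall g u, G g -> u \in U -> g *m u *m invmx g \in U) ->
  X \in Lie G -> Y \in U -> lie_bracket X Y \in U.
Proof.
move=> stU LX UY; apply/negPn/negP => /vspace_separation[f fU /negP].
apply; apply/eqP/matrixP => i j; rewrite [RHS]mxE.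
pose phi (Z : 'M[K]_n) : K^o := f Z i j.
have phiL : linear phi by move=> c u v; rewrite /phi linearP !mxE.
pose phi' : {linear 'M[K]_n -> K^o} :=
  HB.pack phi (GRing.isLinear.Build K 'M[K]_n K^o _ phi phiL).
have [G1 _ _ _] := aG.
have I : vanish G (msubst (conj_poly Y) (lform phi')).
  move=> k Gk; rewrite mx_eval_subst evmx_conj // lformE /= /phi fU ?mxE //.
  exact: stU.
have := alg_group_tangent aG G1 LX I; rewrite mdiff_subst evmx_conj // dmx_conj //.
by rewrite mdiff_lform invmx1 mul1mx mulmx1.
Qed.

Lemma Lie_bracket X Y : X \in Lie G -> Y \in Lie G -> lie_bracket X Y \in Lie G.
Proof. by move=> LX LY; apply: stable_bracket => // g u Gg; apply: Lie_conj. Qed.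

(** [G] is closed among invertible matrices, and the closed condition of determinant 1 keeps points
    of the closure invertible. *)
Lemma closure_alg_group : zariski_closure G `<=` G.
Proof.
have [_ _ _ [Z cZ GE]] := aG; move=> A clA; rewrite GE; split.
  by apply: clA => // B; rewrite GE => -[].
suff dA : \det A = 1 by rewrite /= unitmxE dA unitr1.
move/zariski_closureP: clA => /(_ (\det gmx - 1%:MP)).
rewrite mx_evalB mx_eval_det evmx_gmx mx_evalC => /(_ _)/eqP.
rewrite subr_eq0 => dA; apply/eqP/dA => B GB.
by rewrite mx_evalB mx_eval_det evmx_gmx mx_evalC det1 // subrr.
Qed.

End UnitDeterminant.
End LieFacts.

(** * Characters of simple groups *)

Section SimpleGroups.
Variables (K : closedFieldType) (n : nat) (G : set 'M[K]_n).
Hypothesis sG : simple_group G.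
Local Notation N := (n * n)%N.

Lemma simple_alg : algebraic_group G. Proof. by case: sG. Qed.

Lemma simple_prime : is_prime (vanish G).
Proof. by case: sG => aG cG _ _; apply: vanish_prime. Qed.

(* A finite kernel would make all commutators [g x g^-1 x^-1] range over a
   finite set, hence constant in [g] by irreducibility. *)
Lemma simple_character (chi : {mpoly K[N]}) :
  mx_eval chi 1%:M = 1 ->
  (forall g h, G g -> G h -> mx_eval chi (g *m h) = mx_eval chi g * mx_eval chi h) ->
  forall g, G g -> mx_eval chi g = 1.
Proof.
move=> chi1 chiM; have aG := simple_alg; have pG := simple_prime.
have [G1 GM GV _] := aG.
have chiV g : G g -> mx_eval chi g * mx_eval chi (invmx g) = 1.
  by move=> Gg; rewrite -chiM ?mulmxV ?(alg_group_unit aG) //; apply: GV.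
pose S := [set g | mx_eval chi g = 1].
have SE : S = [set A | forall p, [set chi - 1] p -> mx_eval p A = 0].
  apply/seteqP; split=> g /=.
    by move=> Sg p ->; rewrite mx_evalB mx_eval1 Sg subrr.
  move=> /(_ _ erefl)/eqP; rewrite mx_evalB mx_eval1 subr_eq0.
  by move/eqP.
have aN : algebraic_group (G `&` S).
  apply: alg_groupI => //.
  - by exists [set chi - 1].
  - by move=> g h Gg Gh Sg Sh; rewrite /S /= chiM // Sg Sh mulr1.
  - by move=> g Gg Sg; have := chiV g Gg; rewrite Sg mul1r.
have nN : normal_in (G `&` S) G.
  split=> [g []//|g x Gg [Gx Sx]].
  have Gx' : G (g *m x *m invmx g) by apply: (GM) (GV _ Gg); apply: (GM).
  have GVg := GV _ Gg; have Ggx := GM _ _ Gg Gx.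
  split=> //; rewrite /S /= !chiM //.
  by rewrite Sx mulr1 chiV.
have [NG g Gg|NG] := pselect (G `&` S = G); first by move: Gg; rewrite -NG => -[].
have [_ _ [g1 [g2 [Gg1 Gg2 nc]]] /(_ _ aN nN NG) fN] := sG.
have [s Ns] : exists s : seq 'M[K]_n, forall x, (G `&` S) x -> x \in s.
  by move/finite_seqP: fN => [s Es]; exists s => x; rewrite Es.
exfalso; apply: nc.
(* On [G], the vanishing of [cpoly c] at [g] says that the commutator of [g] and [g2] is [c],
   without writing an inverse. *)
pose cpoly c : 'M[{mpoly K[N]}]_n := gmx *m map_mx (@mpolyC N K) g2 -
  map_mx (@mpolyC N K) (c *m g2) *m gmx.
have cpolyE c g : evmx g (cpoly c) = g *m g2 - c *m g2 *m g.
  by rewrite /cpoly evmxE map_mxB -!evmxE !evmxM evmx_gmx !evmx_const.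
have [c cs /= cE] : exists2 c, c \in s & forall g, G g -> g *m g2 = c *m g2 *m g.
  apply: contrapT => noc.
  have noc' c : exists q : {mpoly K[N]}, c \in s -> ~ vanish G q /\
      forall g, G g -> g *m g2 = c *m g2 *m g -> mx_eval q g = 0.
    have [cs|_] := boolP (c \in s); last by exists 0.
    apply: contrapT => noq; apply: noc; exists c => // g Gg.
    apply/eqP; rewrite -subr_eq0; apply/eqP/matrixP => i j.
    rewrite -cpolyE [RHS]mxE [LHS]mxE; apply: contrapT => nz.
    apply: noq; exists (cpoly c i j) => _; split=> [|h Gh hE]; first by move=> /(_ g Gg).
    by have := cpolyE c h; rewrite hE subrr => /matrixP/(_ i j); rewrite !mxE.
  have [q qP] := choice noc'.
  (* Each [q c] vanishes where the commutator is [c], so the product over [s] vanishes on [G]; by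
     primality one factor does, against its choice. *)
  have [|c cs] := prime_prod (s := s) (F := q) pG.
    move=> g Gg; set c := g *m g2 *m invmx g *m invmx g2.
    have cs : c \in s.
      have Gg2' := GV _ Gg2; have Gg' := GV _ Gg; have Ggg := GM _ _ Gg Gg2.
      have Gc := GM _ _ Ggg Gg'.
      apply: Ns; split; rewrite /S /=; first by apply: (GM).
      rewrite !chiM //.
      by rewrite mulrAC -[_ * _ * mx_eval chi (invmx g2)]mulrA chiV // mulr1 chiV.
    rewrite mx_evalE rmorph_prod; apply/eqP; rewrite prodf_seq_eq0; apply/hasP; exists c => //=.
    apply/eqP; have [_] := qP c cs; apply=> //.
    by rewrite /c mulmxKV ?mulmxKV ?(alg_group_unit aG).
  by have [] := qP c cs.
have := cE 1%:M G1; rewrite mul1mx mulmx1 => g2E.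
by rewrite cE // -g2E.
Qed.

Lemma simple_det g : G g -> \det g = 1.
Proof.
move=> Gg; rewrite -(evmx_gmx g) -mx_eval_det; apply: simple_character => //.
  by rewrite mx_eval_det evmx_gmx det1.
by move=> x y _ _; rewrite !mx_eval_det !evmx_gmx det_mulmx.
Qed.

End SimpleGroups.

Section CharacteristicZero.
Variable K : fieldType.
Hypothesis char0 : [pchar K] =i pred0.

Lemma natr_char0 k : ((k%:R : K) == 0) = (k == 0%N).
Proof. by have /pcharf0P -> := char0. Qed.

Lemma poly_char0_infinite (f : {poly K}) : (forall t, f.[t] = 0) -> f = 0.
Proof.
move=> f0; apply: (@roots_geq_poly_eq0 _ f [seq k%:R | k <- iota 0 (size f)]).
- by apply/allP => t _; rewrite /root f0.
- rewrite map_inj_uniq ?iota_uniq // => i j /eqP.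
  wlog ij : i j / (i <= j)%N.
    by move=> W; case: (leqP i j) => [/W//|/ltnW ji]; rewrite eq_sym => /W ->.
  rewrite eq_sym -subr_eq0 -natrB // natr_char0 subn_eq0 => ji.
  by apply/eqP; rewrite eqn_leq ij.
- by rewrite size_map size_iota.
Qed.

Lemma taylor_char0 (f : {poly K}) : (forall k, f^`(k).[0] = 0) -> f = 0.
Proof.
move=> f0; apply/polyP => k; have /eqP := f0 k.
rewrite horner_coef0 coef_derivn addn0 ffactnn coef0 -mulr_natl mulf_eq0.
by rewrite natr_char0 -leqn0 leqNgt fact_gt0 /= => /eqP.
Qed.

End CharacteristicZero.

(** * The curve exp(tX) of a nilpotent element *)

Section NilpotentExponential.
Variables (K : closedFieldType) (n : nat).
Hypothesis char0 : [pchar K] =i pred0.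
Local Notation N := (n * n)%N.
Implicit Types (X : 'M[K]_n).

(** The matrix exp(tX) with t as polynomial variable; the truncation is exact once [X ^+ k = 0]. *)
Definition expmx k X : 'M[{poly K}]_n :=
  \matrix_(i, j) \poly_(l < k) (l`!%:R^-1 * (X ^+ l) i j).

Variables (k : nat) (X : 'M[K]_n).
Hypothesis Xk : X ^+ k = 0.

Lemma coef_expmx i j l : (expmx k X i j)`_l = l`!%:R^-1 * (X ^+ l) i j.
Proof.
rewrite mxE coef_poly; case: ltnP => // kl.
by rewrite -(subnK kl) exprD Xk mulr0 mxE mulr0.
Qed.

Lemma deriv_expmx : map_mx (@deriv K) (expmx k X) = expmx k X *m map_mx polyC X.
Proof.
apply/matrixP => i j; apply/polyP => l.
rewrite [map_mx _ _ i j]mxE coef_deriv coef_expmx [in RHS]mxE coef_sum exprSr [(_ *m X) i j]mxE mulr_sumr -sumrMnl.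
apply: eq_bigr => m _; rewrite [map_mx _ _ m j]mxE coefMC coef_expmx mulrA -!mulrnAl; congr (_ * _ * _).
rewrite factS natrM invfM -mulr_natr mulrAC mulVf ?mul1r //.
by rewrite natr_char0.
Qed.

Lemma expmx0 : map_mx (fun f => f.[0]) (expmx k X) = 1%:M.
Proof.
apply/matrixP => i j; rewrite mxE horner_coef0 coef_expmx expr0 fact0 invr1 mul1r.
by rewrite !mxE.
Qed.

Lemma expmx_commute Y t : X *m Y = Y *m X ->
  map_mx (fun f => f.[t]) (expmx k X) *m Y = Y *m map_mx (fun f => f.[t]) (expmx k X).
Proof.
move=> XY; have XlY l : X ^+ l *m Y = Y *m X ^+ l.
  elim: l => [|l IHl]; first by rewrite expr0 mul1mx mulmx1.
  by rewrite exprSr -!mulmxA XY mulmxA IHl mulmxA.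
have -> : map_mx (fun f => f.[t]) (expmx k X) =
    \sum_(l < k) (t ^+ l * l`!%:R^-1) *: X ^+ l.
  apply/matrixP => i j; rewrite mxE mxE horner_poly summxE.
  by apply: eq_bigr => l _; rewrite mxE mulrC mulrA.
rewrite mulmx_suml mulmx_sumr; apply: eq_bigr => l _.
by rewrite -scalemxAl XlY scalemxAr.
Qed.

Lemma expmx_group G t : algebraic_group G -> (forall g, G g -> \det g = 1) ->
  X \in Lie G -> G (map_mx (fun f => f.[t]) (expmx k X)).
Proof.
move=> aG det1 LX; apply: closure_alg_group => //; apply/zariski_closureP => p Ip.
rewrite -horner_curve; suff -> : mxe polyC (expmx k X) p = 0 by rewrite horner0.
(* The left-invariant vector field of [X]: it preserves the ideal of [G] and computes derivatives
   along the curve, so all derivatives at 0 vanish. *)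
pose D (q : {mpoly K[N]}) := \sum_i q^`M(i) * mxvec (gmx *m map_mx (@mpolyC N K) X) 0 i.
have DE q : (mxe polyC (expmx k X) q)^`() = mxe polyC (expmx k X) (D q).
  rewrite mxe_curve rmorph_sum; apply: eq_bigr => i _; rewrite rmorphM /=; congr (_ * _).
  have := congr1 (fun M => mxvec M 0 i) deriv_expmx; rewrite -map_mxvec mxE => ->.
  have <- : map_mx (mxe polyC (expmx k X)) (gmx *m map_mx (@mpolyC N K) X) =
      expmx k X *m map_mx polyC X by rewrite map_mxM mxe_gmx mxe_const.
  by rewrite -map_mxvec mxE.
have DI q : vanish G q -> vanish G (D q).
  move=> Iq g Gg; rewrite -[RHS](alg_group_tangent aG Gg LX Iq).
  rewrite mx_evalE rmorph_sum; apply: eq_bigr => i _; rewrite rmorphM /=; congr (_ * _).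
  have <- : evmx g (gmx *m map_mx (@mpolyC N K) X) = g *m X.
    by rewrite evmxM evmx_gmx evmx_const.
  by rewrite /evmx -map_mxvec mxE.
apply: taylor_char0 => // l.
have [q Iq ->] : exists2 q, vanish G q &
    (mxe polyC (expmx k X) p)^`(l) = mxe polyC (expmx k X) q.
  elim: l => [|l [q Iq IHl]]; first by exists p.
  by exists (D q); [exact: DI | rewrite derivnS IHl DE].
by rewrite horner_curve expmx0 Iq //; case: aG.
Qed.

(** If the curve stays in a finite set, each of its entries is a constant polynomial, while the
    linear coefficient is the entry of [X]. *)
Lemma expmx_infinite (S : set 'M[K]_n) :
  (forall t, S (map_mx (fun f => f.[t]) (expmx k X))) -> finite_set S -> X = 0.
Proof.
move=> SX /finite_seqP[s Es]; apply/matrixP => i j; rewrite [RHS]mxE.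
have : \prod_(A <- s) (expmx k X i j - (A i j)%:P) = 0.
  apply: poly_char0_infinite => // t; have := SX t; rewrite Es => /= sE.
  rewrite horner_prod; apply/eqP; rewrite prodf_seq_eq0; apply/hasP.
  by eexists; first exact: sE; rewrite /= hornerD hornerN hornerC [map_mx _ _ i j]mxE subrr.
move/eqP; rewrite prodf_seq_eq0 => /hasP[A _ /= /eqP E].
have := coef_expmx i j 1; move/eqP: E; rewrite subr_eq0 => /eqP ->.
by rewrite coefC /= invr1 mul1r expr1.
Qed.

End NilpotentExponential.

(** * Extension of derivations and of points *)

Section PrimeOverPolynomials.
Variables (R : idomainType) (T : comNzRingType) (I : set T).
Variables (e : {rmorphism R -> T}) (x : T).
Hypothesis pI : is_prime I.
Let iI := prime_ideal pI.

(** Modulo the preimage of [I], [R] becomes a domain inside [T] modulo [I]; [evx] adjoins the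
    element [x] to it. *)
Definition evx (Q : {poly R}) : T := (map_poly e Q).[x].
HB.instance Definition _ := GRing.RMorphism.copy evx (horner_eval x \o map_poly e).

Definition coefs_in (Q : {poly R}) := forall i, I (e Q`_i).

Lemma evx_coefs_in Q : coefs_in Q -> I (evx Q).
Proof.
move=> QI; rewrite /evx horner_coef; apply: ideal_sum => // i _.
by rewrite coef_map mulrC; apply/(idealM iI)/QI.
Qed.

Lemma evxC r : evx r%:P = e r.
Proof. by rewrite /evx map_polyC hornerC. Qed.

Lemma evxZ r Q : evx (r *: Q) = e r * evx Q.
Proof. by rewrite -mul_polyC rmorphM /= evxC. Qed.

Lemma primeX r m : ~ I (e r) -> ~ I (e (r ^+ m)).
Proof.
move=> nr; elim: m => [|m IHm]; first by rewrite expr0 rmorph1; apply: prime_1.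
by rewrite exprS rmorphM => /(primeM pI)[].
Qed.

(* A set of polynomials that is stable under removal of the leading term when
   the latter is in [I]: members of least size outside [coefs_in]. *)
Lemma min_size_lead (J : set {poly R}) Q0 :
  (forall Q r i, J Q -> I (e r) -> J (Q - r *: 'X^i)) -> J Q0 -> ~ coefs_in Q0 ->
  exists P, [/\ J P, ~ I (e (lead_coef P)), (size P <= size Q0)%N &
    forall Q, J Q -> (size Q < size P)%N -> coefs_in Q].
Proof.
move=> JX JQ0 Q0I.
have exP : exists d, `[< exists Q, [/\ J Q, ~ coefs_in Q & size Q = d] >].
  by exists (size Q0); apply/asboolP; exists Q0.
case: (ex_minnP exP) => d /asboolP[P [JP PI <-]] dmin.
exists P; split=> //.
- move=> lI; apply: PI.
  pose Q := P - lead_coef P *: 'X^((size P).-1).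
  have [P0|P0] := eqVneq P 0.
    by move=> i; rewrite P0 coef0 rmorph0; apply: ideal0.
  have szQ : (size Q < size P)%N.
    have sP : (0 < size P)%N by rewrite size_poly_gt0.
    rewrite -(prednK sP) ltnS; apply/leq_sizeP => j; rewrite leq_eqVlt.
    rewrite coefB coefZ coefXn => /orP[/eqP <-|lj].
      by rewrite eqxx mulr1 lead_coefE subrr.
    rewrite gtn_eqF // mulr0 subr0 nth_default //.
    by rewrite -(prednK sP).
  have QI : coefs_in Q.
    apply: contrapT => nQ; suff : (size P <= size Q)%N by rewrite leqNgt szQ.
    by apply: dmin; apply/asboolP; exists Q; split=> //; apply: JX.
  move=> i; have -> : P = Q + lead_coef P *: 'X^((size P).-1) by rewrite subrK.
  rewrite coefD rmorphD; apply: (idealD iI) => //.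
  by rewrite coefZ rmorphM mulrC; apply: (idealM iI).
- by apply: dmin; apply/asboolP; exists Q0.
- move=> Q JQ szQ; apply: contrapT => nQ.
  suff : (size P <= size Q)%N by rewrite leqNgt szQ.
  by apply: dmin; apply/asboolP; exists Q.
Qed.

(** Modulo [I], either [x] is transcendental over [R], or [P] is a relation of least degree: a
    minimal polynomial whose leading coefficient is not inverted. *)
Lemma relation_dichotomy :
  (forall Q, I (evx Q) -> coefs_in Q) \/
  exists P, [/\ I (evx P), ~ I (e (lead_coef P)), (1 < size P)%N &
    forall Q, I (evx Q) -> (size Q < size P)%N -> coefs_in Q].
Proof.
have [|/existsNP[Q0 /not_implyP[JQ0 nQ0]]] :=
  pselect (forall Q, I (evx Q) -> coefs_in Q); [by left|right].
have [|P [JP lP _ minP]] := @min_size_lead [set Q | I (evx Q)] Q0 _ JQ0 nQ0.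
  move=> Q r i JQ Ir /=; rewrite rmorphB; apply: (idealB iI) => //=.
  by rewrite evxZ mulrC; apply: (idealM iI).
exists P; split=> //; rewrite ltnNge; apply/negP => szP.
have PE : P = (lead_coef P)%:P by rewrite {1}(size1_polyC szP) lead_coefE -subn1; case: (size P) szP => [|[]].
by apply: lP; rewrite -evxC -PE.
Qed.

Lemma relation_pseudo_div (P Q : {poly R}) :
  (forall Q, I (evx Q) -> (size Q < size P)%N -> coefs_in Q) ->
  P != 0 -> I (evx P) -> I (evx Q) ->
  exists m A S, lead_coef P ^+ m *: Q = A * P + S /\ coefs_in S.
Proof.
move=> minP P0 JP JQ.
exists (scalp Q P), (Q %/ P), (Q %% P); split; first exact: Pdiv.WeakIdomain.divp_eq.
apply: minP; last by rewrite ltn_modp.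
have -> : Q %% P = lead_coef P ^+ scalp Q P *: Q - Q %/ P * P.
  by rewrite Pdiv.WeakIdomain.divp_eq addrAC subrr add0r.
rewrite rmorphB rmorphM /=; apply: (idealB iI); last exact: (idealM iI).
by rewrite evxZ; apply: (idealM iI).
Qed.

Section Derivations.
Variable D : {additive R -> T}.
Hypothesis DM : forall a b, D (a * b) = e a * D b + D a * e b.
Hypothesis DI : forall a, I (e a) -> I (D a).
Hypothesis nat_inv : forall m y, I (y *+ m.+1) -> I y.

Definition Dx (Q : {poly R}) : T := (map_poly D Q).[x].

Lemma DxD : {morph Dx : P Q / P + Q}.
Proof. by move=> P Q; rewrite /Dx raddfD hornerD. Qed.

Lemma DxC a : Dx a%:P = D a.
Proof. by rewrite /Dx map_polyC hornerC. Qed.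

Lemma DxMX Q : Dx (Q * 'X) = Dx Q * x.
Proof.
rewrite /Dx; have -> : map_poly D (Q * 'X) = map_poly D Q * 'X; last by rewrite hornerMX.
apply/polyP => i; rewrite coef_map !coefMX; case: eqP => _; first by rewrite raddf0.
by rewrite coef_map.
Qed.

Lemma DxM P Q : Dx (P * Q) = evx P * Dx Q + Dx P * evx Q.
Proof.
have evxMX R0 : evx (R0 * 'X) = evx R0 * x by rewrite /evx rmorphM /= map_polyX hornerMX.
have DxCM a : Dx (a%:P * Q) = e a * Dx Q + D a * evx Q.
  elim/poly_ind: Q => [|Q c IHQ].
    have Dx0 : Dx 0 = 0 by rewrite /Dx raddf0 horner0.
    by rewrite mulr0 Dx0 rmorph0 !mulr0 addr0.
  rewrite mulrDr mulrA !DxD !DxMX IHQ -polyCM !DxC rmorphD /= evxMX evxC DM.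
  by rewrite mulrDl !mulrDr !mulrA addrACA.
elim/poly_ind: P Q DxCM => [|P c IHP] Q DxCM.
  have Dx0 : Dx 0 = 0 by rewrite /Dx raddf0 horner0.
  by rewrite mul0r Dx0 rmorph0 !mul0r addr0.
have DxCM' : forall a, Dx (a%:P * (Q * 'X)) = e a * Dx (Q * 'X) + D a * evx (Q * 'X).
  by move=> a; rewrite mulrA !DxMX DxCM evxMX mulrDl !mulrA.
rewrite mulrDl -mulrA ['X * Q]mulrC !DxD IHP // DxCM rmorphD /= evxC !evxMX !DxMX DxC.
ring.
Qed.

(** The derivation [c * D] extended to polynomials in [x], with value [w] on [x]; the factor [c]
    clears the denominator that an algebraic [x] introduces. *)
Definition dext c w (Q : {poly R}) : T := c * Dx Q + evx Q^`() * w.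

Lemma dextD c w : {morph dext c w : P Q / P + Q}.
Proof. by move=> P Q; rewrite /dext DxD derivD rmorphD mulrDr mulrDl addrACA. Qed.

Lemma dextM c w P Q : dext c w (P * Q) = evx P * dext c w Q + dext c w P * evx Q.
Proof. by rewrite /dext DxM derivM rmorphD !rmorphM /=; ring. Qed.

Lemma dextC c w a : dext c w a%:P = c * D a.
Proof. by rewrite /dext DxC derivC rmorph0 mul0r addr0. Qed.

Lemma dextX c w : D 1 = 0 -> dext c w 'X = w.
Proof.
move=> D1; rewrite /dext derivX rmorph1 mul1r.
by rewrite -['X]mul1r -polyC1 DxMX DxC D1 mul0r mulr0 add0r.
Qed.

Lemma derivation_extension : exists c w, ~ I c /\
  forall Q, I (evx Q) -> I (dext c w Q).
Proof.
have [allI|[P [JP lP szP minP]]] := relation_dichotomy.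
  exists 1, 0; split=> [|Q /allI QI]; first exact: prime_1.
  rewrite /dext mul1r mulr0 addr0 /Dx horner_coef; apply: ideal_sum => // i _.
  by rewrite coef_map mulrC; apply/(idealM iI)/DI.
have P0 : P != 0 by rewrite -size_poly_gt0 (leq_trans _ szP).
(* The relation P(x) = 0 forces the value -D(P)(x)/P'(x) on [x]; everything is multiplied by P'(x),
   which is nonzero modulo [I] by [minP] and [nat_inv]. *)
exists (evx P^`()), (- Dx P); split.
  move=> /minP/(_ _)/(_ (size P).-2).
  rewrite lt_size_deriv // => /(_ isT); rewrite coef_deriv.
  have sE : (size P).-2.+1 = (size P).-1 by case: (size P) szP => [|[]].
  rewrite sE raddfMn -lead_coefE => h; apply: lP; apply: (nat_inv (m := (size P).-2)).
  by rewrite sE.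
pose d := dext (evx P^`()) (- Dx P).
have dP : d P = 0 by rewrite /d /dext mulrN subrr.
have dS S : coefs_in S -> I (d S).
  move=> SI; apply: (idealD iI).
    apply: (idealM iI); rewrite /Dx horner_coef; apply: ideal_sum => // i _.
    by rewrite coef_map mulrC; apply/(idealM iI)/DI/SI.
  rewrite mulrC; apply/(idealM iI)/evx_coefs_in => i.
  rewrite coef_deriv raddfMn -mulr_natl; apply/(idealM iI)/SI.
move=> Q JQ; rewrite -/d; have [m [A [S [QE SI]]]] := relation_pseudo_div minP P0 JP JQ.
have := primeX (m := m) lP; suff : I (e (lead_coef P ^+ m) * d Q) by case/(primeM pI).
have -> : e (lead_coef P ^+ m) * d Q = d A * evx P + d S - d (lead_coef P ^+ m)%:P * evx Q.
  have := congr1 d QE; rewrite -mul_polyC [d _]dextM evxC [d _]dextD [dext _ _ (A * P)]dextM -/d dP mulr0 add0r => <-.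
  by rewrite addrK.
apply: (idealB iI); last exact: (idealM iI).
by apply: (idealD iI); [apply: (idealM iI)|apply: dS].
Qed.
End Derivations.

(** If [x] is transcendental, it may be sent to any value off the zeros of [q]; if algebraic, to a
    root of [P]. In the second case [r] contains a nonzero constant combination of [q] and [P], as a
    resultant would be. *)
Lemma point_extension (K : closedFieldType) (char0 : [pchar K] =i pred0) q :
  ~ I (evx q) -> exists2 r, ~ I (e r) &
  forall h : {rmorphism R -> K}, (forall a, I (e a) -> h a = 0) -> h r != 0 ->
  exists2 z, forall Q, I (evx Q) -> (map_poly h Q).[z] = 0 & (map_poly h q).[z] != 0.
Proof.
move=> Jq.
have hS (h : {rmorphism R -> K}) z S : (forall a, I (e a) -> h a = 0) ->
    coefs_in S -> (map_poly h S).[z] = 0.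
  by move=> hI SI; rewrite horner_coef big1 // => i _; rewrite coef_map /= hI ?mul0r //; apply: SI.
have [allI|[P [JP lP szP minP]]] := relation_dichotomy.
  have /existsNP[i qi] : ~ coefs_in q by move=> /evx_coefs_in.
  exists q`_i => // h hI hqi.
  have hq0 : map_poly h q != 0.
    by apply: contraNneq hqi => hq0; rewrite -coef_map hq0 coef0.
  have [z hz] : exists z, (map_poly h q).[z] != 0.
    apply: contrapT => noz; move/eqP: hq0; apply; apply: poly_char0_infinite => // t.
    by apply: contrapT => /eqP tz; apply: noz; exists t.
  by exists z => // Q /allI; apply: hS.
have P0 : P != 0 by rewrite -size_poly_gt0 (leq_trans _ szP).
(* The ideal of [q] and [P] modulo [I]. Its member [B] of least size is constant, since otherwise it
   would divide [P] up to a factor and contradict [minP]. *)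
pose J : set {poly R} := [set X | exists u v S, X = u * q + v * P + S /\ coefs_in S].
have coefsD A B : coefs_in A -> coefs_in B -> coefs_in (A + B).
  by move=> AI BI i; rewrite coefD rmorphD; apply: (idealD iI).
have coefsN A : coefs_in A -> coefs_in (- A).
  by move=> AI i; rewrite coefN rmorphN; apply: (idealN iI).
have JX Q r i : J Q -> I (e r) -> J (Q - r *: 'X^i).
  move=> [u [v [S [-> SI]]]] Ir; exists u, v, (S - r *: 'X^i); split; first by rewrite !addrA.
  apply: coefsD => //; apply: coefsN => j.
  by rewrite coefZ rmorphM mulrC; apply: (idealM iI).
pose S0 := q %% P; pose m0 := scalp q P.
have qE : lead_coef P ^+ m0 *: q = q %/ P * P + S0 by apply: Pdiv.WeakIdomain.divp_eq.
have JS0 : J S0.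
  exists (lead_coef P ^+ m0)%:P, (- (q %/ P)), 0; split=> [|i]; last first.
    by rewrite coef0 rmorph0; apply: ideal0.
  by rewrite mul_polyC qE mulNr addr0 addrAC subrr add0r.
have nS0 : ~ coefs_in S0.
  move=> /evx_coefs_in JS; have := primeX (m := m0) lP.
  suff : I (e (lead_coef P ^+ m0) * evx q) by case/(primeM pI).
  by rewrite -evxZ qE rmorphD rmorphM; apply: (idealD iI) => //; apply: (idealM iI).
have [B [JB lB szB minB]] := min_size_lead JX JS0 nS0.
have szBP : (size B < size P)%N by rewrite (leq_ltn_trans szB) ?ltn_modp.
have B0 : B != 0 by apply: contra_not_neq lB => ->; rewrite lead_coef0 rmorph0; apply: ideal0.
have szB1 : (size B <= 1)%N.
  rewrite leqNgt; apply/negP => szB1.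
  pose A := P %/ B; pose S := P %% B.
  have PE : lead_coef B ^+ scalp P B *: P = A * B + S by apply: Pdiv.WeakIdomain.divp_eq.
  have SI : coefs_in S.
    apply: minB; last by rewrite ltn_modp.
    have [u [v [S1 [BE S1I]]]] := JB.
    exists (- A * u), ((lead_coef B ^+ scalp P B)%:P - A * v), (- A * S1); split; last first.
      move=> i; rewrite coefM rmorph_sum; apply: ideal_sum => // j _.
      by rewrite rmorphM; apply: (idealM iI).
    have -> : S = (lead_coef B ^+ scalp P B)%:P * P - A * B.
      by rewrite mul_polyC PE addrAC subrr add0r.
    by rewrite BE; ring.
  have : I (evx A * evx B).
    rewrite -rmorphM; have -> : A * B = lead_coef B ^+ scalp P B *: P - S by rewrite PE addrK.
    rewrite rmorphB; apply: (idealB iI); last exact: evx_coefs_in.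
    by rewrite /= evxZ; apply: (idealM iI).
  case/(primeM pI) => [JA|/minP/(_ szBP)/(_ (size B).-1)]; last by rewrite -lead_coefE.
  have szA : (size A < size P)%N.
    have lB0 : lead_coef B ^+ scalp P B != 0 by rewrite expf_neq0 // lead_coef_eq0.
    rewrite size_divp // ltn_subrL.
    by case: (size B) szB1 szBP => [|[|k]] //= _; case: (size P).
  have AI := minP A JA szA.
  have /(_ (size P).-1) : coefs_in (lead_coef B ^+ scalp P B *: P).
    rewrite PE; apply: coefsD => // i; rewrite coefM rmorph_sum; apply: ideal_sum => // j _.
    by rewrite rmorphM mulrC; apply: (idealM iI).
  rewrite coefZ -lead_coefE rmorphM => /(primeM pI)[]//.
  exact: primeX.
have BC : B = (lead_coef B)%:P.
  rewrite {1}(size1_polyC szB1) lead_coefE -subn1.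
  by case: (size B) szB1 => [|[]].
have [u [v [S [BE SI]]]] := JB.
exists (lead_coef P * lead_coef B); first by rewrite rmorphM => /(primeM pI)[].
move=> h hI; rewrite rmorphM mulf_eq0 negb_or => /andP[hP hB].
have szhP : size (map_poly h P) = size P by rewrite size_map_poly_id0.
have [z /rootP Pz] : exists z, root (map_poly h P) z.
  by apply/closed_rootP; rewrite szhP; case: (size P) szP => [|[]].
exists z => [Q JQ|].
  have [m [A [S1 [QE S1I]]]] := relation_pseudo_div minP P0 JP JQ.
  have := congr1 (fun X => (map_poly h X).[z]) QE.
  rewrite map_polyZ hornerZ rmorphD rmorphM /= hornerD hornerM Pz mulr0 add0r.
  rewrite (hS h z S1) //= rmorphXn => /eqP; rewrite mulf_eq0 expf_eq0 (negbTE hP) andbF /=.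
  by move/eqP.
apply: contraNneq hB => qz.
have := congr1 (fun X => (map_poly h X).[z]) BE.
rewrite {1}BC map_polyC hornerC /= => ->.
by rewrite !rmorphD !rmorphM /= !hornerD !hornerM Pz qz !mulr0 (hS h z S) // !addr0.
Qed.

End PrimeOverPolynomials.

(** * Adjoining several variables *)

Section PointEvaluation.
Variables (K : comNzRingType) (T : comNzRingType) (f : {rmorphism K -> T}).

(** A point is an infinite sequence of which the first [k] terms are read, so adding a variable does
    not change its type. *)
Definition pev (xi : nat -> T) k : {mpoly K[k]} -> T := mmap f (fun i : 'I_k => xi i).
HB.instance Definition _ xi k := GRing.RMorphism.on (@pev xi k).

Lemma pevC xi k c : @pev xi k c%:MP = f c.
Proof. exact: mmapC. Qed.

Lemma pevX xi k (i : 'I_k) : pev xi 'X_i = xi i.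
Proof. by rewrite /pev mmapX mmap1U. Qed.

Lemma eq_pev xi1 xi2 k (p : {mpoly K[k]}) :
  (forall i, (i < k)%N -> xi1 i = xi2 i) -> pev xi1 p = pev xi2 p.
Proof.
move=> E; apply: mpoly_rmorph_ext p => [c|i] /=; first by rewrite !pevC.
by rewrite !pevX E.
Qed.

End PointEvaluation.

Lemma pevS (K : idomainType) (T : comNzRingType) (f : {rmorphism K -> T}) xi k (p : {mpoly K[k.+1]}) :
  pev f xi p = evx (pev f xi (k := k)) (xi k) (msplit p).
Proof.
rewrite -[RHS]/((evx (pev f xi (k := k)) (xi k) \o @msplit K k) p).
apply: mpoly_rmorph_ext p => [c|i] /=; first by rewrite msplitC evxC /= !pevC.
rewrite pevX msplitX; case: (unliftP ord_max i) => [j ->|->].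
  by rewrite lift_max_widen msplit_varw evxC /= pevX.
by rewrite msplit_var_max /evx map_polyX hornerX.
Qed.

Section Lifting.
Variables (K : closedFieldType) (T : comNzRingType) (f : {rmorphism K -> T}).
Variables (I : set T) (xi : nat -> T).
Hypothesis char0 : [pchar K] =i pred0.
Hypothesis pI : is_prime I.
Let iI := prime_ideal pI.
Local Notation ev k := (pev f xi (k := k)).

Definition pdiff (v : nat -> T) k (p : {mpoly K[k]}) : T := \sum_(i < k) ev k p^`M(i) * v i.

Lemma pdiff_is_additive v k : zmod_morphism (@pdiff v k).
Proof.
move=> p q; rewrite /pdiff -sumrB; apply: eq_bigr => i _.
by rewrite mderivB rmorphB mulrBl.
Qed.
HB.instance Definition _ v k :=
  GRing.isZmodMorphism.Build {mpoly K[k]} T (@pdiff v k) (@pdiff_is_additive v k).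

Lemma pdiffM v k (p q : {mpoly K[k]}) :
  pdiff v (p * q) = ev k p * pdiff v q + pdiff v p * ev k q.
Proof.
rewrite /pdiff mulr_sumr mulr_suml -big_split; apply: eq_bigr => i _ /=.
by rewrite mderivM rmorphD !rmorphM /=; ring.
Qed.

Lemma pdiffC v k c : pdiff v (c%:MP : {mpoly K[k]}) = 0.
Proof. by rewrite /pdiff big1 // => i _; rewrite mderivC rmorph0 mul0r. Qed.

Lemma pdiffX v k (i : 'I_k) : pdiff v 'X_i = v i.
Proof.
rewrite /pdiff (bigD1 i) //= big1 => [|j ji].
  by rewrite mderivXU eqxx rmorph1 mul1r addr0.
by rewrite mderivXU eq_sym (negbTE ji) rmorph0 mul0r.
Qed.

Definition tangent_to k (v : nat -> T) := forall p : {mpoly K[k]}, I (ev k p) -> I (pdiff v p).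

Lemma tangent_step k v : tangent_to k v ->
  exists c v', [/\ ~ I c, tangent_to k.+1 v' & forall i, (i < k)%N -> v' i = c * v i].
Proof.
move=> tv.
have nat_inv m (y : T) : I (y *+ m.+1) -> I y.
  move=> Iy; have -> : y = f (m.+1%:R^-1) * (y *+ m.+1).
    rewrite -[y *+ _]mulr_natr mulrCA -(rmorph_nat f) -rmorphM mulVf ?rmorph1 ?mulr1 //.
    by rewrite natr_char0.
  exact: (idealM iI).
have [c [w [Ic cw]]] := derivation_extension (xi k) pI (@pdiffM v k) tv nat_inv.
exists c, (fun i => if (i < k)%N then c * v i else w); split=> // [p|i ->//].
rewrite pevS => /cw; congr I; set v' := fun i => _.
pose d (p : {mpoly K[k.+1]}) := dext (ev k) (xi k) (pdiff v (k := k)) c w (msplit p).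
have dM a b : d (a * b) = pev f xi a * d b + d a * pev f xi b.
  by rewrite /d (rmorphM (@msplit K k)) dextM ?pevS //; apply: pdiffM.
rewrite -[LHS]/(d p).
apply: (@mpoly_derivation_ext K k.+1 T (pev f xi (k := k.+1)) d (pdiff v' (k := k.+1))).
- by move=> a b; rewrite /d (rmorphD (@msplit K k)) dextD.
- exact: raddfD.
- exact: dM.
- exact: pdiffM.
- by move=> a; rewrite pdiffC /d msplitC dextC -[RHS](mulr0 c); congr (_ * _); apply: pdiffC.
- move=> i; rewrite pdiffX /d msplitX; case: (unliftP ord_max i) => [j ->|->].
    rewrite lift_max_widen msplit_varw dextC /v' /= ltn_ord; congr (_ * _); exact: pdiffX.
  rewrite msplit_var_max dextX ?/v' /= ?ltnn //.
  by have := pdiffC v k 1; rewrite mpolyC1.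
Qed.

Lemma tangent_extension k v j : tangent_to k v ->
  exists c v', [/\ ~ I c, tangent_to (k + j) v' & forall i, (i < k)%N -> v' i = c * v i].
Proof.
move=> tv; elim: j => [|j [c [v1 [Ic tv1 v1E]]]].
  exists 1, v; split; rewrite ?addn0 //; first exact: (prime_1 pI).
  by move=> i _; rewrite mul1r.
have [c2 [v2 [Ic2 tv2 v2E]]] := tangent_step tv1.
exists (c2 * c), v2; split; rewrite ?addnS //; first by case/(primeM pI).
by move=> i ik; rewrite v2E ?v1E ?mulrA // (leq_trans ik) // leq_addr.
Qed.

Definition point_of k (eta : nat -> K) :=
  forall p : {mpoly K[k]}, I (ev k p) -> pev idfun eta p = 0.

Lemma point_step k (q : {mpoly K[k.+1]}) : ~ I (ev k.+1 q) ->
  exists2 r : {mpoly K[k]}, ~ I (ev k r) & forall eta, point_of k eta ->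
    pev idfun eta r != 0 -> exists eta', [/\ point_of k.+1 eta', pev idfun eta' q != 0 &
      forall i, (i < k)%N -> eta' i = eta i].
Proof.
rewrite pevS => /(point_extension pI char0)[r Ir rP]; exists r => // eta eI er.
have [z zI zq] := rP (pev idfun eta (k := k)) eI er.
pose eta' i := if (i < k)%N then eta i else z.
have etak : eta' k = z by rewrite /eta' ltnn.
have E (p : {mpoly K[k.+1]}) : pev idfun eta' p = (map_poly (pev idfun eta (k := k)) (msplit p)).[z].
  rewrite pevS /evx etak; congr (_.[z]); apply: eq_map_poly => a.
  by apply: eq_pev => i ik; rewrite /eta' ik.
exists eta'; split=> [p|//|i ik]; rewrite ?E ?/eta' ?ik //.
by rewrite pevS => /zI.
Qed.

(** The number of variables is a separate [l], because [k + j.+1] is a successor only after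
    rewriting. *)
Lemma point_extension_n k j l (q : {mpoly K[l]}) : l = (k + j)%N -> ~ I (ev l q) ->
  exists2 r : {mpoly K[k]}, ~ I (ev k r) & forall eta, point_of k eta ->
    pev idfun eta r != 0 -> exists eta', [/\ point_of l eta', pev idfun eta' q != 0 &
      forall i, (i < k)%N -> eta' i = eta i].
Proof.
elim: j l q => [|j IHj] l q lE.
  rewrite addn0 in lE; rewrite {l}lE in q *; move=> Iq.
  by exists q => // eta eI eq; exists eta.
rewrite addnS in lE; rewrite {l}lE in q *; move=> /point_step[r Ir rP].
have [r' Ir' r'P] := IHj _ r erefl Ir.
exists r' => // eta eI er'; have [eta1 [e1I e1r e1E]] := r'P eta eI er'.
have [eta2 [e2I e2q e2E]] := rP _ e1I e1r.
exists eta2; split=> // i ik; rewrite e2E ?e1E //.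
by rewrite (leq_trans ik) // leq_addr.
Qed.

End Lifting.

(** * Lifting along a polynomial map on the group *)

Section GroupLifting.
Variables (K : closedFieldType) (n : nat) (G : set 'M[K]_n).
Hypothesis char0 : [pchar K] =i pred0.
Hypothesis pG : is_prime (vanish G).
Local Notation N := (n * n)%N.
Local Notation T := {mpoly K[N]}.
Variables (m : nat) (F : 'rV[T]_m).

(** The components of [F] come first, then all coordinates: extending from the first [m] terms to
    all of them passes from the image of [F] to [G]. *)
Let xi (i : nat) : T :=
  if insub i is Some a then row_mx F (\row_j 'X_j) 0 (a : 'I_(m + N)) else 0.

Let xi_l (i : 'I_m) : xi i = F 0 i.
Proof.
rewrite /xi; case: insubP => [a _ ai|]; last by rewrite ltn_addr.
by have -> : a = lshift N i; [apply: ord_inj | rewrite row_mxEl].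
Qed.

Let xi_r (i : 'I_N) : xi (m + i) = 'X_i.
Proof.
rewrite /xi; case: insubP => [a _ ai|]; last by rewrite ltn_add2l ltn_ord.
by have -> : a = rshift m i; [apply: ord_inj | rewrite row_mxEr mxE].
Qed.

Let phi : {rmorphism K -> T} := @mpolyC N K.
Let shift (p : T) : {mpoly K[m + N]} := mmap (@mpolyC (m + N) K) (fun i => 'X_(rshift m i)) p.

Let shiftD a b : shift (a + b) = shift a + shift b. Proof. exact: rmorphD. Qed.
Let shiftM a b : shift (a * b) = shift a * shift b. Proof. exact: rmorphM. Qed.

Let pev_shift p : pev phi xi (shift p) = p.
Proof.
rewrite -[RHS]/(idfun p) -[LHS]/((pev phi xi (k := m + N) \o shift) p).
apply: mpoly_rmorph_ext p => [c|i] /=; rewrite /shift ?mmapC ?pevC //.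
by rewrite mmapX mmap1U pevX /= xi_r.
Qed.

Definition rev (w : 'rV[K]_m) (p : {mpoly K[m]}) : K := p.@[fun i => w 0 i].

Definition evrow (g : 'M[K]_n) (V : 'rV[T]_m) : 'rV[K]_m := map_mx (fun p => mx_eval p g) V.

Let ev_xi p g : mx_eval (pev phi xi (p : {mpoly K[m]})) g = rev (evrow g F) p.
Proof.
rewrite mx_evalE -[LHS]/((mxe idfun g \o pev phi xi (k := m)) p).
apply: mpoly_rmorph_ext p => [c|i] /=; first by rewrite pevC mxeC mevalC.
by rewrite pevX xi_l mevalXU mxE.
Qed.

(* A polynomial family [V] of vectors tangent to the image of [F] lifts, up to a
   nonzero factor and at a suitable point, to a tangent vector of [G]. *)
Theorem lift_tangent (V : 'rV[T]_m) :
  (forall p : {mpoly K[m]}, (forall g, G g -> rev (evrow g F) p = 0) ->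
    forall g, G g -> \sum_i rev (evrow g F) p^`M(i) * mx_eval (V 0 i) g = 0) ->
  exists g c w, [/\ G g, c != 0, forall p, vanish G p -> mdiff p g w = 0 &
    forall i, c * mx_eval (V 0 i) g = mdiff (F 0 i) g w].
Proof.
move=> VF; pose v0 (i : nat) : T := if insub i is Some a then V 0 (a : 'I_m) else 0.
have v0E (i : 'I_m) : v0 i = V 0 i.
  rewrite /v0; case: insubP => [a _ ai|]; last by rewrite ltn_ord.
  by have -> : a = i by apply: ord_inj.
have tv : @tangent_to K T phi (vanish G) xi m v0.
  move=> p Ip g Gg; rewrite mx_evalE rmorph_sum -[RHS](VF p _ g Gg) => [|h Gh].
    by apply: eq_bigr => i _; rewrite rmorphM /= -!mx_evalE ev_xi v0E.
  by rewrite -ev_xi; apply: Ip.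
have [c [v [Ic tv' vE]]] := tangent_extension char0 pG N tv.
have [g Gg cg] : exists2 g, G g & mx_eval c g != 0.
  apply: contrapT => nog; apply: Ic => g Gg; apply: contrapT => /eqP cg.
  by apply: nog; exists g.
pose w : 'M[K]_n := vec_mx (\row_i mx_eval (v (m + i)%N) g).
have pdiff_shift p : mx_eval (pdiff phi xi v (shift p)) g = mdiff p g w.
  pose f0 : {rmorphism T -> K} := mxe idfun g \o (pev phi xi (k := m + N) \o shift).
  rewrite (@mpoly_derivationE K N K f0 (fun p => mx_eval (pdiff phi xi v (shift p)) g)).
  - apply: eq_bigr => i _; rewrite /f0 /= pev_shift; congr (_ * _).
    by rewrite /shift mmapX mmap1U pdiffX /= vec_mxK mxE.
  - by move=> a b; rewrite shiftD raddfD mx_evalD.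
  - by move=> a b; rewrite shiftM pdiffM mx_evalD !mx_evalM.
  - by move=> a; rewrite /shift mmapC pdiffC mx_eval0.
exists g, (mx_eval c g), w; split=> // [p Ip|i].
  by rewrite -pdiff_shift; apply: tv'; rewrite ?pev_shift.
(* This relation ties the [i]-th component of [F] to the coordinates; it evaluates to 0, so the
   extended tangent vector respects it. *)
pose p := 'X_(lshift N i) - shift (F 0 i).
have p0 : pev phi xi p = 0.
  by rewrite [LHS](rmorphB (pev phi xi (k := (m + N)%N))) /= pevX xi_l pev_shift subrr.
have := tv' p; rewrite p0 => /(_ (ideal0 (vanish_ideal G)) g Gg).
have -> : pdiff phi xi v p = v i - pdiff phi xi v (shift (F 0 i)).
  by rewrite [LHS]raddfB; congr (_ - _); apply: pdiffX.
by rewrite mx_evalB pdiff_shift vE ?ltn_ord // v0E mx_evalM => /eqP; rewrite subr_eq0 => /eqP.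
Qed.

(** Chevalley's theorem: off the zeros of [r], points of the closure of the image of [F] lift to the
    closure of [G]. The extension starts from the polynomial 1. *)
Theorem lift_point : exists r : {mpoly K[m]},
  (exists2 g, G g & rev (evrow g F) r != 0) /\
  forall eta : 'rV[K]_m, (forall p, (forall g, G g -> rev (evrow g F) p = 0) -> rev eta p = 0) ->
    rev eta r != 0 -> exists2 g, zariski_closure G g & evrow g F = eta.
Proof.
have [|r Ir rP] := @point_extension_n K T phi (vanish G) xi char0 pG m N (m + N) 1 erefl.
  by rewrite rmorph1; apply: prime_1.
exists r; split.
  apply: contrapT => nog; apply: Ir => g Gg; rewrite ev_xi; apply: contrapT => /eqP rg.
  by apply: nog; exists g.
move=> eta etaP etar; pose eta0 (i : nat) := if insub i is Some a then eta 0 (a : 'I_m) else 0.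
have eta0E (i : 'I_m) : eta0 i = eta 0 i.
  rewrite /eta0; case: insubP => [a _ ai|]; last by rewrite ltn_ord.
  by have -> : a = i by apply: ord_inj.
have eta0P p : pev idfun eta0 p = rev eta p.
  rewrite /rev /meval -[RHS]/(mmap idfun _ p).
  apply: mpoly_rmorph_ext p => [c|i] /=; first by rewrite pevC mmapC.
  by rewrite pevX mmapX mmap1U eta0E.
have [||eta1 [e1I _ e1E]] := rP eta0.
- by move=> p Ip; rewrite eta0P; apply: etaP => g Gg; rewrite -ev_xi; apply: Ip.
- by rewrite eta0P.
pose g : 'M[K]_n := vec_mx (\row_i eta1 (m + i)%N).
have shiftE p : pev idfun eta1 (shift p) = mx_eval p g.
  rewrite mx_evalE -[LHS]/((pev idfun eta1 (k := m + N) \o shift) p).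
  apply: mpoly_rmorph_ext p => [c|i] /=; first by rewrite /shift mmapC pevC mxeC.
  by rewrite /shift mmapX mmap1U pevX mxeX vec_mxK mxE.
exists g.
  by apply/zariski_closureP => p Ip; rewrite -shiftE; apply: e1I; rewrite pev_shift.
apply/rowP => i; pose p := 'X_(lshift N i) - shift (F 0 i).
have p0 : pev phi xi p = 0.
  by rewrite [LHS](rmorphB (pev phi xi (k := (m + N)%N))) /= pevX xi_l pev_shift subrr.
have := e1I p; rewrite p0 => /(_ (ideal0 (vanish_ideal G))).
rewrite (rmorphB (pev idfun eta1 (k := (m + N)%N))) /= pevX shiftE /= e1E ?ltn_ord // eta0E mxE.
by move=> /eqP; rewrite subr_eq0 => /eqP.
Qed.

End GroupLifting.

(** * Orbits *)

Section OrbitGeometry.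
Variables (K : closedFieldType) (n : nat).
Hypothesis char0 : [pchar K] =i pred0.
Local Notation N := (n * n)%N.
Implicit Types (G H : set 'M[K]_n) (A X Y e x y g : 'M[K]_n).

Lemma evrow_mxvec g (B : 'M[{mpoly K[N]}]_n) : evrow g (mxvec B) = mxvec (evmx g B).
Proof. by rewrite /evrow map_mxvec. Qed.

Lemma evmxB g m1 m2 (B C : 'M[{mpoly K[N]}]_(m1, m2)) : evmx g (B - C) = evmx g B - evmx g C.
Proof. by apply/matrixP => i j; rewrite !mxE mx_evalB. Qed.

Lemma evmx_bracket g (B C : 'M[{mpoly K[N]}]_n) :
  evmx g (B *m C - C *m B) = lie_bracket (evmx g B) (evmx g C).
Proof. by rewrite evmxB !evmxM. Qed.

(** A nonconstant [f] is transcendental over [K] modulo the ideal of [G], so the unit field on the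
    line is tangent to its image; it lifts to a tangent vector of [G] on which the differential of
    [f] is nonzero. *)
Lemma constant_on_group G (f : {mpoly K[N]}) :
  algebraic_group G -> is_prime (vanish G) ->
  (forall g X, G g -> X \in Lie G -> mdiff f g (g *m X) = 0) ->
  forall g, G g -> mx_eval f g = mx_eval f 1%:M.
Proof.
move=> aG pG df g1 Gg1; apply: contrapT => /eqP nconst.
have [G1 _ _ _] := aG.
pose u : {mpoly K[1]} -> {poly K} := mmap polyC (fun=> 'X).
pose F : 'rV[{mpoly K[N]}]_1 := \row_i f.
have revE g p : rev (evrow g F) p = (u p).[mx_eval f g].
  rewrite -[RHS]/((horner_eval (mx_eval f g) \o u) p).
  apply: mpoly_rmorph_ext p => [c|i] /=; rewrite /horner_eval /u ?mmapC ?mevalC ?hornerC //.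
  by rewrite mevalXU mmapX mmap1U hornerX !mxE.
have u0 p : (forall g, G g -> rev (evrow g F) p = 0) -> u p = 0.
  move=> p0; apply: contrapT => /eqP up0.
  (* A relation satisfied by [f] splits into linear factors, and primality would make [f]
     constant. *)
  have [r rE] := closed_field_poly_normal (u p).
  have : vanish G (\prod_(z <- r) (f - z%:MP)).
    move=> g Gg; have := p0 g Gg; rewrite revE rE hornerZ => /eqP.
    rewrite mulf_eq0 lead_coef_eq0 (negbTE up0) horner_prod => /eqP <-.
    rewrite mx_evalE rmorph_prod; apply: eq_bigr => z _ /=.
    by rewrite -mx_evalE mx_evalB mx_evalC hornerXsubC.
  case/(prime_prod pG) => z _ fz; move/negP: nconst; apply; apply/eqP.
  have := fz g1 Gg1; have := fz _ G1; rewrite !mx_evalB !mx_evalC.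
  by move=> /eqP; rewrite subr_eq0 => /eqP -> /eqP; rewrite subr_eq0 => /eqP.
have [p p0 g Gg|g [c [w [Gg c0 tw cw]]]] := @lift_tangent K n G char0 pG 1 F (\row_i 1).
  rewrite big_ord1 mxE mx_eval1 mulr1 revE.
  have -> : u p^`M(0) = (u p)^`(); last by rewrite u0 // derivC horner0.
  have := @mpoly_derivationE K 1 _ u (fun p => (u p)^`()).
  move=> ->; rewrite ?big_ord1.
  - by rewrite /u [mmap _ _ 'X_0]mmapX mmap1U derivX mulr1.
  - by move=> a b; rewrite /u rmorphD derivD.
  - by move=> a b; rewrite /u rmorphM derivM addrC.
  - by move=> a; rewrite /u mmapC derivC.
have := cw 0; rewrite !mxE mx_eval1 mulr1 => cE.
have ug := alg_group_unit aG Gg.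
have LX : invmx g *m w \in Lie G.
  have := tangent_Lie aG Gg tw => LX; have [_ _ GV _] := aG.
  have := Lie_conj aG (GV _ Gg) LX; rewrite invmxK -mulmxA.
  by rewrite mulmxKV.
by move/eqP: c0; apply; rewrite cE -[w](mulKVmx ug) df.
Qed.

(** The field with value [h X0 h^-1, h e h^-1] at h e h^-1 is tangent to the orbit of [G], hence by
    density to that of [H]. A lift along the orbit map of [H], translated back to 1 and divided by
    [c], gives [X]. *)
Lemma dense_orbit_tangent G H e X0 :
  algebraic_group G -> algebraic_group H -> is_prime (vanish H) ->
  (forall g, G g -> \det g = 1) -> H `<=` G ->
  Ad_orbit G e `<=` zariski_closure (Ad_orbit H e) ->
  X0 \in Lie G -> exists2 X, X \in Lie H & lie_bracket X e = lie_bracket X0 e.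
Proof.
move=> aG aH pH det1 HG dense LX0.
have det1H g : H g -> \det g = 1 by move=> /HG; apply: det1.
pose B : 'M[{mpoly K[N]}]_n :=
  conj_poly X0 *m conj_poly e - conj_poly e *m conj_poly X0.
have BE g : H g -> evmx g B = lie_bracket (g *m X0 *m invmx g) (g *m e *m invmx g).
  move=> Hg; rewrite [LHS]evmx_bracket.
  by congr lie_bracket; apply: (evmx_conj aH det1H).
have bracket_conj g X : g \in unitmx ->
    lie_bracket (g *m X *m invmx g) (g *m e *m invmx g) = g *m lie_bracket X e *m invmx g.
  move=> ug; rewrite /lie_bracket mulmxBr mulmxBl.
  by rewrite !mulmxA !(mulmxKV ug).
have [p p0 g Hg|g [c [w [Hg c0 tw cw]]]] :=
  @lift_tangent K n H char0 pH N (mxvec (conj_poly e)) (mxvec B).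
  have HgF h : H h -> rev (evrow h (mxvec (conj_poly e))) p = mx_eval p (h *m e *m invmx h).
    by move=> Hh; rewrite evrow_mxvec (evmx_conj aH det1H).
  have Ip : vanish (Ad_orbit G e) p.
    move=> y /dense /zariski_closureP; apply => _ [h Hh <-].
    by rewrite -HgF // p0.
  have Oy : Ad_orbit G e (g *m e *m invmx g) by exists g => //; apply: HG.
  rewrite -[RHS](orbit_tangent aG det1 Oy (Lie_conj aG (HG _ Hg) LX0) Ip).
  apply: eq_bigr => i _; rewrite evrow_mxvec (evmx_conj aH det1H) //; congr (_ * _).
  by rewrite -BE // /evmx -map_mxvec mxE.
have ug := alg_group_unit aH Hg.
have LX : invmx g *m w \in Lie H.
  have [_ _ HV _] := aH.
  have := Lie_conj aH (HV _ Hg) (tangent_Lie aH Hg tw); rewrite invmxK -mulmxA.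
  by rewrite mulmxKV.
exists (c^-1 *: (invmx g *m w)); first exact: memvZ.
have : c *: evmx g B = dmx g (g *m (invmx g *m w)) (conj_poly e).
  apply: (can_inj mxvecK); apply/rowP => i; rewrite linearZ /= mxE.
  rewrite /evmx /dmx -!map_mxvec !mxE cw; congr mdiff.
  by rewrite mulKVmx.
rewrite BE // bracket_conj // (dmx_conj aH det1H) //.
move=> /(congr1 (fun M => invmx g *m M *m g)).
rewrite -scalemxAr -scalemxAl !mulmxA !(mulmxKV ug) (mulVmx ug) !mul1mx => cE.
have -> X : lie_bracket (c^-1 *: X) e = c^-1 *: lie_bracket X e.
  by rewrite /lie_bracket -scalemxAl -scalemxAr -scalerBr.
by rewrite -cE scalerA mulVf // scale1r.
Qed.

Lemma open_orbit G x : algebraic_group G -> is_prime (vanish G) ->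
  (forall g, G g -> \det g = 1) ->
  exists r : {mpoly K[N]}, (exists2 y, Ad_orbit G x y & mx_eval r y != 0) /\
    forall y, zariski_closure (Ad_orbit G x) y -> mx_eval r y != 0 -> Ad_orbit G x y.
Proof.
move=> aG pG det1.
have FE g p : G g -> rev (evrow g (mxvec (conj_poly x))) p = mx_eval p (g *m x *m invmx g).
  by move=> Gg; rewrite evrow_mxvec (evmx_conj aG det1).
have [r [[g Gg rg] rP]] := @lift_point K n G char0 pG N (mxvec (conj_poly x)).
exists r; split; first by exists (g *m x *m invmx g); [exists g|rewrite -FE].
move=> y /zariski_closureP cly ry; have [p p0||h clh hE] := rP (mxvec y).
- by apply: cly => _ [h Gh <-]; rewrite -FE // p0.
- exact: ry.
have Gh := closure_alg_group aG det1 clh; exists h => //.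
by apply: (can_inj mxvecK); rewrite -hE evrow_mxvec (evmx_conj aG det1).
Qed.

End OrbitGeometry.

(** * Linear algebra *)

Section RationalFunctionals.
Import Num.Theory.
Variable K : fieldType.
Hypothesis char0 : [pchar K] =i pred0.

Lemma intr_char0 (z : int) : ((z%:~R : K) == 0) = (z == 0).
Proof.
case: z => k; first by rewrite -pmulrn natr_char0.
by rewrite NegzE mulrNz oppr_eq0 -pmulrn natr_char0.
Qed.

(** Computes [ratr] from any fraction, reduced or not; additivity and multiplicativity follow. *)
Lemma ratr_frac (x : rat) (a b : int) :
  b != 0 -> x * b%:~R = a%:~R -> ratr x = a%:~R / b%:~R :> K.
Proof.
move=> b0 xb; have E : numq x * b = a * denq x.
  apply: (@intr_inj rat); rewrite !rmorphM /= -xb mulrAC; congr (_ * _).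
  by rewrite -{2}[x]divq_num_den divfK // intr_eq0 denq_neq0.
have d0 : (denq x)%:~R != 0 :> K by rewrite intr_char0 denq_neq0.
have b0' : b%:~R != 0 :> K by rewrite intr_char0.
apply: (mulIf b0'); rewrite divfK // /ratr mulrAC; apply: (mulIf d0).
by rewrite divfK // -!rmorphM E.
Qed.

Lemma ratrD_char0 (x y : rat) : ratr (x + y) = ratr x + ratr y :> K.
Proof.
have dx := denq_neq0 x; have dy := denq_neq0 y.
rewrite (@ratr_frac _ (numq x * denq y + numq y * denq x) (denq x * denq y)) ?mulf_neq0 //.
  rewrite /ratr rmorphD !rmorphM /=.
  by field; rewrite !intr_char0 dx dy.
rewrite rmorphD !rmorphM /= -{1}(divq_num_den x) -{1}(divq_num_den y).
by field; rewrite !intr_eq0 dx dy.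
Qed.

Lemma ratrM_char0 (x y : rat) : ratr (x * y) = ratr x * ratr y :> K.
Proof.
have dx := denq_neq0 x; have dy := denq_neq0 y.
rewrite (@ratr_frac _ (numq x * numq y) (denq x * denq y)) ?mulf_neq0 //.
  rewrite /ratr !rmorphM /=.
  by field; rewrite !intr_char0 dx dy.
rewrite !rmorphM /= -{1}(divq_num_den x) -{1}(divq_num_den y).
by field; rewrite !intr_eq0 dx dy.
Qed.

(* The functional takes rational values, so a vanishing sum of [m l * l * phi l]
   is a rational relation between the [l]; applying [phi] to it gives a sum of
   squares. *)
Lemma rational_functional (s : seq K) l0 : uniq s -> l0 \in s -> l0 != 0 ->
  exists phi : K -> K,
    (forall l m, l \in s -> m \in s -> l + m \in s -> phi (l + m) = phi l + phi m) /\
    forall m : K -> nat, \sum_(l <- s) (m l)%:R * (l * phi l) = 0 -> m l0 = 0%N.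
Proof.
move=> us l0s l00; pose k := size s.
have ks (l : K) : l \in s -> (index l s < k)%N by rewrite index_mem.
(* The kernel [R] of [rel] is the space of rational linear relations between the elements of [s]; a
   functional vanishing on [R] is a functional on their rational span. *)
pose rel (c : 'rV[rat]_k) : K := \sum_(i < k) ratr (c 0 i) * s`_i.
pose R := vspace_of [set c | rel c = 0].
have RP c : c \in R <-> rel c = 0.
  apply: mem_vspace_of => [|q u v] /=.
    by apply: big1 => i _; rewrite mxE /ratr mul0r mul0r.
  move=> u0 v0; have -> : rel (q *: u + v) = ratr q * rel u + rel v; last first.
    by rewrite u0 v0 mulr0 addr0.
  rewrite /rel mulr_sumr -big_split; apply: eq_bigr => i _ /=.
  by rewrite !mxE ratrD_char0 ratrM_char0 mulrDl mulrA.
pose e l : 'rV[rat]_k := \row_i (i == index l s :> nat)%:R.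
have rel_e l : l \in s -> rel (e l) = l.
  move=> ls; rewrite /rel (bigD1 (Ordinal (ks l ls))) //= big1 => [|i il].
    by rewrite mxE eqxx addr0 nth_index // (_ : ratr 1 = 1 :> K) ?mul1r // (ratr_nat K 1).
  by rewrite mxE -[_ == _]/(i == Ordinal (ks l ls)) (negbTE il) /ratr !mul0r.
have [|f fR fe] := @vspace_separation _ _ R (e l0).
  by apply/negP => /RP; rewrite rel_e // => /eqP; rewrite (negbTE l00).
have [j fj] : exists j, f (e l0) 0 j != 0.
  apply: contrapT => noj; move/eqP: fe; apply; apply/rowP => j; rewrite [RHS]mxE.
  by apply: contrapT => /eqP nz; apply: noj; exists j.
pose psi (c : 'rV[rat]_k) := f c 0 j.
have psiD c d : psi (c + d) = psi c + psi d by rewrite /psi linearD mxE.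
have psiZ q c : psi (q *: c) = q * psi c by rewrite /psi linearZ mxE.
have psiR c : rel c = 0 -> psi c = 0 by move=> /RP cR; rewrite /psi fR ?mxE.
exists (fun l => ratr (psi (e l))); split=> [l m ls ms lms|m m0].
  rewrite -ratrD_char0 -psiD; congr ratr; apply/eqP; rewrite -subr_eq0.
  rewrite -[X in psi _ - X]mul1r -mulNr -psiZ -psiD scaleN1r; apply/eqP/psiR.
  have relD c d : rel (c + d) = rel c + rel d.
    by rewrite /rel -big_split; apply: eq_bigr => i _; rewrite mxE ratrD_char0 mulrDl.
  have relN c : rel (- c) = - rel c.
    have := relD (- c) c; rewrite addNr.
    have -> : rel 0 = 0 by apply: big1 => i _; rewrite mxE /ratr !mul0r.
    by move=> /esym/eqP; rewrite addr_eq0 => /eqP.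
  by rewrite relD relN relD !rel_e // subrr.
pose c := \row_(i < k) ((m s`_i)%:R * psi (e s`_i)).
have c0 : rel c = 0.
  rewrite -[RHS]m0 (big_nth 0) big_mkord; apply: eq_bigr => i _.
  by rewrite mxE ratrM_char0 ratr_nat -mulrA [_ * s`_i]mulrC.
have : psi c = 0 by apply: psiR.
have -> : c = \sum_(i < k) c 0 i *: e s`_i.
  apply/rowP => i; rewrite summxE (bigD1 i) //= big1 => [|l li].
    by rewrite ![in RHS]mxE index_uniq // eqxx mulr1 addr0 mxE.
  by rewrite [LHS]mxE [e _ _ _]mxE index_uniq // eq_sym -[_ == _]/(l == i) (negbTE li) mulr0.
have psi_sum (F : 'I_k -> 'rV[rat]_k) : psi (\sum_i F i) = \sum_i psi (F i).
  by rewrite /psi linear_sum summxE.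
rewrite psi_sum => /eqP; rewrite psumr_eq0 => [/allP/(_ (Ordinal (ks _ l0s)))|i _].
  rewrite mem_index_enum => /(_ isT); rewrite psiZ mxE /= nth_index // -mulrA.
  rewrite mulf_eq0 mulf_eq0 orbb pnatr_eq0 -[psi (e l0)]/(f (e l0) 0 j) (negbTE fj) orbF.
  by move/eqP.
rewrite psiZ mxE -mulrA mulr_ge0 ?ler0n //.
by rewrite -expr2 sqr_ge0.
Qed.

End RationalFunctionals.

Section SpectralProjectors.
Variable K : closedFieldType.

Lemma trace_nilpotent n (A : 'M[K]_n) k : A ^+ k = 0 -> \tr A = 0.
Proof.
case: n A => [|n] A Ak; first by rewrite /mxtrace big_ord0.
have [s sE] := closed_field_poly_normal (char_poly A).
rewrite (monicP (char_poly_monic A)) scale1r in sE.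
have s0 z : z \in s -> z = 0.
  move=> zs; have : eigenvalue A z by rewrite eigenvalue_root_char sE root_prod_XsubC.
  case/eigenvalueP => v vA v0.
  have vAk j : v *m A ^+ j = z ^+ j *: v.
    elim: j => [|j IHj]; first by rewrite !expr0 mulmx1 scale1r.
    by rewrite exprSr mulmxA IHj -scalemxAl vA scalerA -exprSr.
  have := vAk k; rewrite Ak mulmx0 => /esym/eqP; rewrite scaler_eq0 (negbTE v0) orbF.
  by rewrite expf_eq0 => /andP[_ /eqP].
have szs : size s = n.+1.
  by have := size_char_poly A; rewrite sE size_prod_XsubC => -[].
have charE : char_poly A = 'X^(n.+1).
  rewrite sE -szs; elim: s s0 {sE szs} => [|z s IHs] s0; first by rewrite big_nil expr0.
  rewrite big_cons IHs => [|y ys]; last by apply: s0; rewrite in_cons ys orbT.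
  by rewrite (s0 z) ?mem_head // subr0 exprS.
have := char_poly_trace A (ltn0Sn n); rewrite charE coefXn ltn_eqF //.
by move=> /esym/eqP; rewrite oppr_eq0 => /eqP.
Qed.

(** A rank factorisation [C *m R] of an idempotent satisfies [R *m C = 1%:M], and the trace is
    cyclic. *)
Lemma trace_idempotent n (E : 'M[K]_n) : E *m E = E -> \tr E = (\rank E)%:R.
Proof.
move=> EE; have [r [C [R [<- CR [L LC] [M RM]]]]] : exists r (C : 'M_(n, r)) (R : 'M_(r, n)),
    [/\ r = \rank E, C *m R = E, exists L, L *m C = 1%:M & exists M, R *m M = 1%:M].
  exists (\rank E), (col_base E), (row_base E); split=> //; first exact: mulmx_base.
    by apply/row_fullP; apply: col_base_full.
  by apply/row_freeP; apply: row_base_free.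
have RC : R *m C = 1%:M.
  have := congr1 (fun Z => L *m Z *m M) EE; rewrite -CR !mulmxA LC !mul1mx.
  by rewrite -!mulmxA RM !mulmx1.
by rewrite -CR mxtrace_mulC RC mxtrace1.
Qed.

(** By the Chinese remainder theorem some polynomial [p l] is 1 modulo (X - l)^n and 0 modulo the
    powers at the other eigenvalues; [P l] is its value at [A], so it is 0 when [l] is not an
    eigenvalue. *)
Lemma spectral_projectors n (A : 'M[K]_n) : exists s (P : K -> 'M[K]_n), uniq s /\
  [/\ \sum_(l <- s) P l = 1%:M,
      forall l, P l *m (A - l%:M) ^+ n = 0,
      forall l k m (x : 'M_(m, n)), x *m (A - l%:M) ^+ k = 0 -> x *m P l = x,
      forall l m, l != m -> P l *m P m = 0 &
      forall l B, A *m B = B *m A -> P l *m B = B *m P l].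
Proof.
case: n A => [|d] A.
  by exists [::], (fun=> 0); split=> //; split=> *; apply/matrixP => ? [].
have [r rE] := closed_field_poly_normal (char_poly A).
rewrite (monicP (char_poly_monic A)) scale1r in rE.
have szr : size r = d.+1 by have := size_char_poly A; rewrite rE size_prod_XsubC => -[].
pose s := undup r; have us : uniq s := undup_uniq r.
pose q0 (l : K) k : {poly K} := ('X - l%:P) ^+ k.
pose q1 (l : K) : {poly K} := \prod_(m <- s | m != l) q0 m d.+1.
(* The exponent bounds every multiplicity, so [M] is a multiple of the characteristic polynomial. *)
pose M := \prod_(m <- s) q0 m d.+1.
have MA : horner_mx A M = 0.
  suff /dvdpP[u ->] : char_poly A %| M by rewrite rmorphM /= Cayley_Hamilton mulr0.
  rewrite /M /q0 prodrXl rE -szr.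
  have : {subset r <= s} by move=> z; rewrite mem_undup.
  elim: (r) => [|z r' IHr] sub; first by rewrite big_nil expr0 dvdpp.
  rewrite big_cons exprS dvdp_mul //; last by apply: IHr => y yr; rewrite sub // in_cons yr orbT.
  by rewrite (big_rem z) ?sub ?mem_head //= dvdp_mulr.
have rootq1 l : ~~ root (q1 l) l.
  rewrite /root horner_prod prodf_seq_neq0; apply/allP => m _; apply/implyP => ml.
  by rewrite /q0 horner_exp hornerXsubC expf_neq0 // subr_eq0 eq_sym.
have cop l k : coprimep (q0 l k) (q1 l).
  by apply: coprimep_expl; rewrite coprimep_sym coprimep_XsubC.
have /choice[p pP] : forall l, exists p, q1 l %| p /\ q0 l d.+1 %| 1 - p.
  move=> l; have /Bezout_eq1_coprimepP[[u v] /= uv] := cop l d.+1.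
  by exists (v * q1 l); rewrite dvdp_mull // -uv addrK dvdp_mull.
have dvdM f : (forall m, m \in s -> q0 m d.+1 %| f) -> M %| f.
  rewrite /M; elim: (s) us => [|z s' IHs] /=; first by rewrite big_nil dvd1p.
  move=> /andP[zs us'] sf; rewrite big_cons Gauss_dvdp.
    by rewrite sf ?mem_head //= IHs // => m ms; apply: sf; rewrite in_cons ms orbT.
  apply: coprimep_expl; rewrite coprimep_sym coprimep_XsubC.
  rewrite /root horner_prod prodf_seq_neq0; apply/allP => m ms /=.
  rewrite horner_exp hornerXsubC expf_neq0 // subr_eq0.
  by apply: contraNneq zs => ->.
have dvdA f : M %| f -> horner_mx A f = 0 by case/dvdpP=> u ->; rewrite rmorphM /= MA mulr0.
have q1dvd l m : m \in s -> m != l -> q0 m d.+1 %| p l.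
  move=> ms ml; apply: dvdp_trans (pP l).1.
  by rewrite /q1 (big_rem m) //= ml dvdp_mulr.
have q0A l k : horner_mx A (q0 l k) = (A - l%:M) ^+ k.
  by rewrite rmorphXn rmorphB /= horner_mx_X horner_mx_C.
have hM f g : horner_mx A (f * g) = horner_mx A f *m horner_mx A g by apply: rmorphM.
have hC f g : horner_mx A f *m horner_mx A g = horner_mx A g *m horner_mx A f.
  exact: comm_horner_mx2.
exists s, (fun l => horner_mx A (p l)); split=> //; split.
- apply/eqP; rewrite -subr_eq0; apply/eqP.
  have -> : \sum_(l <- s) horner_mx A (p l) - 1%:M = horner_mx A (\sum_(l <- s) p l - 1).
    rewrite (rmorphB (horner_mx A)) (rmorph_sum (horner_mx A)); congr (_ - _).
    by rewrite /= (rmorph1 (horner_mx A)).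
  apply/dvdA/dvdM => m ms; rewrite (bigD1_seq m) //= addrAC.
  apply: dvdp_add; first by rewrite -dvdpNr opprB (pP m).2.
  elim/big_ind: _ => [|f g|l lm]; [exact: dvdp0 | exact: dvdp_add | ].
  by rewrite q1dvd // eq_sym.
- move=> l; rewrite -q0A -hM; apply/dvdA/dvdM => m ms.
  have [->|ml] := eqVneq m l; first by rewrite dvdp_mull.
  by rewrite dvdp_mulr // q1dvd.
- move=> l k m x; rewrite -q0A => xk.
  have /Bezout_eq1_coprimepP[[u v] /= uv] := cop l k.
  pose y := x *m horner_mx A (1 - p l).
  have yq0 : y *m horner_mx A (q0 l k) = 0.
    by rewrite /y -mulmxA hC mulmxA xk mul0mx.
  have yq1 : y *m horner_mx A (q1 l) = 0.
    rewrite /y -mulmxA -hM dvdA ?mulmx0 //.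
    apply: dvdM => z zs; have [->|zl] := eqVneq z l; first by rewrite dvdp_mulr // (pP l).2.
    by rewrite dvdp_mull // /q1 (big_rem z) //= zl dvdp_mulr.
  have y0 : y = 0.
    have : y = y *m horner_mx A 1 by rewrite rmorph1 mulmx1.
    rewrite -uv rmorphD /= !hM (hC u) (hC v) mulmxDr !mulmxA.
    by rewrite yq0 yq1 !mul0mx addr0.
  by move: y0; rewrite /y rmorphB rmorph1 mulmxBr mulmx1 => /eqP; rewrite subr_eq0 => /eqP.
- move=> l m lm; rewrite -hM; apply/dvdA/dvdM => z zs.
  have [zl|zl] := eqVneq z l; last by rewrite dvdp_mulr // q1dvd.
  by rewrite dvdp_mull // q1dvd // zl.
- by move=> l B AB; apply: comm_horner_mx.
Qed.

Hypothesis char0 : [pchar K] =i pred0.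

Section ProjectorTraces.
Variables (n : nat) (A : 'M[K]_n) (s : seq K) (P : K -> 'M[K]_n).
Hypothesis P1 : \sum_(l <- s) P l = 1%:M.
Hypothesis PA : forall l, P l *m (A - l%:M) ^+ n = 0.
Hypothesis PP : forall l k m (x : 'M_(m, n)), x *m (A - l%:M) ^+ k = 0 -> x *m P l = x.
Hypothesis PB : forall l B, A *m B = B *m A -> P l *m B = B *m P l.

Lemma projector_idem l : P l *m P l = P l.
Proof. exact: PP (PA l). Qed.

(** The product of [A - l%:M] and [P l] is nilpotent, so it has trace 0. *)
Lemma projector_trace l : \tr (A *m P l) = l * (\rank (P l))%:R.
Proof.
have AP : P l *m A = A *m P l by apply: PB.
have comm : GRing.comm (A - l%:M) (P l).
  by rewrite /GRing.comm -![(_ * _)%R]/(_ *m _) mulmxBl mulmxBr AP scalar_mxC.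
have /trace_nilpotent : ((A - l%:M) *m P l) ^+ n.+1 = 0.
  rewrite -[_ *m P l]/((A - l%:M) * P l) exprMn_comm //.
  rewrite (commrX _ (commr_sym (commrX _ (commr_sym comm)))) exprSr [(A - _) ^+ _]exprSr.
  rewrite -mulrA [P l * (_ * _)]mulrA.
  have -> : P l * (A - l%:M) ^+ n = 0 by apply: PA.
  by rewrite mul0r mulr0.
rewrite mulmxBl raddfB /= mul_scalar_mx linearZ /= (trace_idempotent (projector_idem l)).
by move=> /eqP; rewrite subr_eq0 => /eqP.
Qed.

Lemma nilpotent_of_traces : (forall l, \tr (A *m P l) = 0) -> A ^+ n = 0.
Proof.
move=> tr0; have P0 l : l != 0 -> P l = 0.
  move=> l0; have /eqP := tr0 l; rewrite projector_trace mulf_eq0 (negbTE l0) /=.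
  by rewrite natr_char0 // mxrank_eq0 => /eqP.
have E : 1%:M = \sum_(l <- s | l == 0) P l.
  by rewrite -P1 [RHS]big_mkcond; apply: eq_bigr => l _; case: eqP => // /eqP /P0.
rewrite -[A ^+ n]mul1mx E mulmx_suml big1 // => l /eqP ->.
by have := PA 0; rewrite (raddf0 (@scalar_mx K n)) subr0.
Qed.

End ProjectorTraces.
End SpectralProjectors.

(** * Killing form *)

Section LieAlgebra.
Variables (K : closedFieldType) (n : nat).
Implicit Types (X Y Z : 'M[K]_n).

Lemma lieC X Y : lie_bracket X Y = - lie_bracket Y X.
Proof. by rewrite /lie_bracket opprB. Qed.

Lemma lie_is_linear X : linear (lie_bracket X).
Proof.
move=> c Y Z; rewrite /lie_bracket mulmxDr mulmxDl -scalemxAl -scalemxAr scalerBr opprD.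
by rewrite addrACA.
Qed.
HB.instance Definition _ X :=
  GRing.isLinear.Build K 'M[K]_n 'M[K]_n _ (lie_bracket X) (lie_is_linear X).

Lemma lieDl X Y Z : lie_bracket (X + Y) Z = lie_bracket X Z + lie_bracket Y Z.
Proof. by rewrite [LHS]lieC (linearD (lie_bracket Z)) opprD -[- lie_bracket Z X]lieC -[- lie_bracket Z Y]lieC. Qed.

Lemma lieZl c X Y : lie_bracket (c *: X) Y = c *: lie_bracket X Y.
Proof. by rewrite [LHS]lieC (linearZZ (lie_bracket Y)) -scalerN -lieC. Qed.

Lemma lie0l Y : lie_bracket 0 Y = 0.
Proof. by rewrite lieC (linear0 (lie_bracket Y)) oppr0. Qed.

Lemma lieNl X Y : lie_bracket (- X) Y = - lie_bracket X Y.
Proof. by rewrite -scaleN1r lieZl scaleN1r. Qed.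

Lemma lieXX X : lie_bracket X X = 0.
Proof. by rewrite /lie_bracket subrr. Qed.

Lemma lie_jacobi X Y Z : lie_bracket X (lie_bracket Y Z) =
  lie_bracket (lie_bracket X Y) Z + lie_bracket Y (lie_bracket X Z).
Proof.
rewrite /lie_bracket !mulmxBl !mulmxBr !mulmxA.
move: (X *m Y *m Z) (X *m Z *m Y) (Y *m Z *m X) (Z *m Y *m X) (Y *m X *m Z) (Z *m X *m Y).
by move=> A1 A2 A3 A4 A5 A6; apply/matrixP => i j; rewrite !mxE; ring.
Qed.

Variable L : {vspace 'M[K]_n}.
Hypothesis LB : forall X Y, X \in L -> Y \in L -> lie_bracket X Y \in L.
Local Notation d := (\dim L).

Definition crd X : 'rV[K]_d := \row_i coord (vbasis L) i X.
Definition uncrd (w : 'rV[K]_d) : 'M[K]_n := \sum_i w 0 i *: (vbasis L)`_i.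

Lemma crd_is_linear : linear crd.
Proof. by move=> c X Y; apply/rowP => i; rewrite !mxE linearP. Qed.
HB.instance Definition _ :=
  GRing.isLinear.Build K 'M[K]_n 'rV[K]_d _ crd crd_is_linear.

Lemma mem_vbasis_nth (i : 'I_d) : (vbasis L)`_i \in L.
Proof. by apply: vbasis_mem; rewrite mem_nth // size_tuple. Qed.

Lemma uncrd_mem w : uncrd w \in L.
Proof. by apply: memv_suml => i _; apply/memvZ/mem_vbasis_nth. Qed.

Lemma crdK X : X \in L -> uncrd (crd X) = X.
Proof.
move=> LX; rewrite [RHS](coord_vbasis LX); apply: eq_bigr => i _.
by rewrite mxE.
Qed.

Lemma uncrdK w : crd (uncrd w) = w.
Proof.
apply/rowP => i; rewrite mxE /uncrd.
by rewrite (coord_sum_free _ _ (basis_free (vbasisP L))).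
Qed.

Lemma crd_inj X Y : X \in L -> Y \in L -> crd X = crd Y -> X = Y.
Proof. by move=> LX LY E; rewrite -(crdK LX) E crdK. Qed.

(** Coordinates are row vectors, so [adm X] acts on the right and products are reversed, as in
    [adm_lie]. *)
Definition adm X : 'M[K]_d := \matrix_(i, j) coord (vbasis L) j (lie_bracket X (vbasis L)`_i).

Lemma crd_lie X Y : Y \in L -> crd (lie_bracket X Y) = crd Y *m adm X.
Proof.
move=> LY; apply/rowP => j; rewrite [LHS]mxE [in LHS](coord_vbasis LY) !linear_sum mxE.
by apply: eq_bigr => i _; rewrite !linearZ /= !mxE.
Qed.

Lemma adm_ext X (M : 'M[K]_d) : (forall Y, Y \in L -> crd (lie_bracket X Y) = crd Y *m M) -> adm X = M.
Proof.
move=> E; apply/row_matrixP => i; rewrite !rowE.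
by have := E (uncrd (delta_mx 0 i)) (uncrd_mem _); rewrite crd_lie ?uncrd_mem // uncrdK.
Qed.

Lemma adm_is_linear : linear adm.
Proof.
move=> c X Y; apply: adm_ext => Z LZ.
by rewrite lieDl lieZl linearP /= !crd_lie // mulmxDr -scalemxAr.
Qed.
HB.instance Definition _ :=
  GRing.isLinear.Build K 'M[K]_n 'M[K]_d _ adm adm_is_linear.

Lemma adm_lie X Y : X \in L -> Y \in L -> adm (lie_bracket X Y) = adm Y *m adm X - adm X *m adm Y.
Proof.
move=> LX LY; apply: adm_ext => Z LZ.
have -> : lie_bracket (lie_bracket X Y) Z =
    lie_bracket X (lie_bracket Y Z) - lie_bracket Y (lie_bracket X Z).
  by rewrite lie_jacobi addrK.
by rewrite linearB /= !crd_lie ?LB // mulmxBr !mulmxA.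
Qed.

Lemma killing_trace X Y : Y \in L -> killing_form L X Y = \tr (adm X *m adm Y).
Proof.
move=> LY; rewrite mxtrace_mulC; apply: eq_bigr => i _.
have LbY : lie_bracket Y (vbasis L)`_i \in L by apply: LB => //; apply: mem_vbasis_nth.
have -> : forall Z, coord (vbasis L) i Z = crd Z 0 i by move=> Z; rewrite mxE.
rewrite crd_lie // crd_lie ?mem_vbasis_nth // -mulmxA.
have -> : crd (vbasis L)`_i = delta_mx 0 i.
  apply/rowP => j; rewrite !mxE (coord_free _ _ (basis_free (vbasisP L))).
  by rewrite eqxx eq_sym.
by rewrite -rowE mxE.
Qed.

Lemma killingC X Y : X \in L -> Y \in L -> killing_form L X Y = killing_form L Y X.
Proof. by move=> LX LY; rewrite !killing_trace // mxtrace_mulC. Qed.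

Lemma killing_invariant X Y Z : X \in L -> Y \in L -> Z \in L ->
  killing_form L (lie_bracket X Y) Z = killing_form L X (lie_bracket Y Z).
Proof.
move=> LX LY LZ; rewrite !killing_trace ?LB // !adm_lie //.
rewrite mulmxBl mulmxBr !raddfB /= -!mulmxA; congr (_ - _).
by rewrite mxtrace_mulC !mulmxA.
Qed.

Lemma killingDl X Y Z : Z \in L ->
  killing_form L (X + Y) Z = killing_form L X Z + killing_form L Y Z.
Proof. by move=> LZ; rewrite !killing_trace // linearD mulmxDl raddfD. Qed.

Lemma killingZl c X Z : Z \in L -> killing_form L (c *: X) Z = c * killing_form L X Z.
Proof. by move=> LZ; rewrite !killing_trace // linearZ /= -scalemxAl linearZ. Qed.

Lemma killing_conj g X Y : g \in unitmx ->
  (forall Z, Z \in L -> g *m Z *m invmx g \in L) ->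
  (forall Z, Z \in L -> invmx g *m Z *m g \in L) ->
  X \in L -> Y \in L ->
  killing_form L (g *m X *m invmx g) (g *m Y *m invmx g) = killing_form L X Y.
Proof.
move=> ug gL gL' LX LY.
pose P h : 'M[K]_d := \matrix_(i, j) coord (vbasis L) j (h *m (vbasis L)`_i *m invmx h).
have PE h Z : Z \in L -> crd (h *m Z *m invmx h) = crd Z *m P h.
  move=> LZ; apply/rowP => j; rewrite [LHS]mxE [in LHS](coord_vbasis LZ) mulmx_sumr mulmx_suml mxE.
  rewrite linear_sum; apply: eq_bigr => i _.
  by rewrite -scalemxAr -scalemxAl linearZ /= !mxE.
have gL'' Z : Z \in L -> invmx g *m Z *m invmx (invmx g) \in L by rewrite invmxK; apply: gL'.
have admE Z : Z \in L -> adm (g *m Z *m invmx g) = P (invmx g) *m adm Z *m P g.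
  move=> LZ; apply: adm_ext => W LW; rewrite !mulmxA -PE // -crd_lie ?gL'' // -PE; last first.
    by apply: LB => //; apply: gL''.
  congr crd; rewrite invmxK /lie_bracket mulmxBr mulmxBl !mulmxA !(mulmxK ug).
  by rewrite (mulmxV ug) mul1mx.
have PP : P g *m P (invmx g) = 1%:M.
  apply/row_matrixP => i; rewrite !rowE mulmx1 -[delta_mx 0 i]uncrdK mulmxA -PE ?uncrd_mem //.
  rewrite -PE ?gL ?uncrd_mem //; congr crd.
  by rewrite invmxK !mulmxA (mulVmx ug) mul1mx mulmxKV.
rewrite !killing_trace ?gL // !admE //.
rewrite mxtrace_mulC !mulmxA -[P (invmx g) *m adm Y *m P g *m P (invmx g)]mulmxA PP mulmx1.
rewrite mxtrace_mulC !mulmxA PP mul1mx mxtrace_mulC.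
by [].
Qed.

End LieAlgebra.

(** * Generalized eigenspaces, Cartan's argument and Engel's theorem *)

Section LieStructure.
Variables (K : closedFieldType) (n : nat).
Hypothesis char0 : [pchar K] =i pred0.
Implicit Types (X Y Z x y z : 'M[K]_n).
Variable L : {vspace 'M[K]_n}.
Hypothesis LB : forall X Y, X \in L -> Y \in L -> lie_bracket X Y \in L.

Lemma ad_iter_mem x k z : x \in L -> z \in L -> iter k (lie_bracket x) z \in L.
Proof. by move=> Lx Lz; elim: k => //= k; apply: LB. Qed.

Lemma crd_ad_iter x k z : x \in L -> z \in L ->
  crd L (iter k (lie_bracket x) z) = crd L z *m adm L x ^+ k.
Proof.
move=> Lx Lz; elim: k => [|k IHk]; first by rewrite expr0 mulmx1.
by rewrite exprSr mulmxA -IHk /= crd_lie ?ad_iter_mem.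
Qed.

Definition shifted_ad x (l : K) z := lie_bracket x z - l *: z.

Definition graded x l z := z \in L /\ exists k, iter k (shifted_ad x l) z = 0.

Lemma shifted_ad_mem x l z : x \in L -> z \in L -> shifted_ad x l z \in L.
Proof. by move=> Lx Lz; rewrite memvB ?memvZ ?LB. Qed.

Lemma shifted_ad_iter_mem x l k z : x \in L -> z \in L -> iter k (shifted_ad x l) z \in L.
Proof. by move=> Lx Lz; elim: k => //= k; apply: shifted_ad_mem. Qed.

Lemma crd_shifted_ad x l k z : x \in L -> z \in L ->
  crd L (iter k (shifted_ad x l) z) = crd L z *m (adm L x - l%:M) ^+ k.
Proof.
move=> Lx Lz; elim: k => [|k IHk]; first by rewrite expr0 mulmx1.
rewrite exprSr mulmxA -IHk /= /shifted_ad linearB linearZ /= crd_lie ?shifted_ad_iter_mem //.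
by rewrite mulmxBr mul_mx_scalar.
Qed.

Lemma gradedP x l z : x \in L -> z \in L ->
  graded x l z <-> exists k, crd L z *m (adm L x - l%:M) ^+ k = 0.
Proof.
move=> Lx Lz; split=> [[_ [k zk]]|[k zk]].
  by exists k; rewrite -crd_shifted_ad // zk linear0.
split=> //; exists k; apply: (crd_inj (L := L)); rewrite ?mem0v ?shifted_ad_iter_mem //.
by rewrite crd_shifted_ad // zk linear0.
Qed.

Lemma shifted_ad0 x l k : iter k (shifted_ad x l) 0 = 0.
Proof. by elim: k => //= k ->; rewrite /shifted_ad linear0 scaler0 subr0. Qed.

Lemma shifted_adD x l k z1 z2 : iter k (shifted_ad x l) (z1 + z2) =
  iter k (shifted_ad x l) z1 + iter k (shifted_ad x l) z2.
Proof.
elim: k => //= k ->; rewrite /shifted_ad linearD scalerDr opprD.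
by rewrite addrACA.
Qed.

Lemma gradedD x l z1 z2 : graded x l z1 -> graded x l z2 -> graded x l (z1 + z2).
Proof.
move=> [L1 [k1 z1k]] [L2 [k2 z2k]]; split; first exact: memvD.
exists (k1 + k2)%N; rewrite shifted_adD {1}addnC !iterD z1k z2k !shifted_ad0 addr0.
by [].
Qed.

Lemma graded_shift x l z : x \in L -> z \in L -> graded x l (shifted_ad x l z) -> graded x l z.
Proof. by move=> Lx Lz [_ [k zk]]; split=> //; exists k.+1; rewrite iterSr. Qed.

(** [shifted_ad] obeys a Leibniz rule on brackets, so the sum of the two nilpotency orders drops. *)
Lemma graded_lie x l m y z : x \in L -> graded x l y -> graded x m z ->
  graded x (l + m) (lie_bracket y z).
Proof.
move=> Lx [Ly [k yk]] [Lz [j zj]].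
have [t kjt] := ubnP (k + j); elim: t => // t IHt in k j y z Ly yk Lz zj kjt *.
case: k yk kjt => [/= ->|k yk] kjt.
  by rewrite lie0l; split; [apply: mem0v|exists 0%N].
case: j zj kjt => [/= ->|j zj] kjt.
  by rewrite linear0; split; [apply: mem0v|exists 0%N].
apply: graded_shift; rewrite ?LB //.
have -> : shifted_ad x (l + m) (lie_bracket y z) =
    lie_bracket (shifted_ad x l y) z + lie_bracket y (shifted_ad x m z).
  rewrite /shifted_ad lie_jacobi lieDl lieNl lieZl.
  rewrite (linearB (lie_bracket y) (lie_bracket x z) (m *: z)) (linearZZ (lie_bracket y)).
  rewrite scalerDl opprD.
  by rewrite addrACA.
have yk' : iter k (shifted_ad x l) (shifted_ad x l y) = 0 by rewrite -iterSr.
have zj' : iter j (shifted_ad x m) (shifted_ad x m z) = 0 by rewrite -iterSr.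
apply: gradedD.
  exact: IHt (shifted_ad_mem _ Lx Ly) yk' Lz zj kjt.
by apply: (IHt _ _ _ _ Ly yk (shifted_ad_mem _ Lx Lz) zj'); rewrite -ltnS -addnS.
Qed.

Section Derivation.
Variables (x : 'M[K]_n) (s : seq K) (P : K -> 'M[K]_(\dim L)).
Local Notation A := (adm L x).
Hypothesis Lx : x \in L.
Hypothesis P1 : \sum_(l <- s) P l = 1%:M.
Hypothesis PA : forall l, P l *m (A - l%:M) ^+ \dim L = 0.
Hypothesis PP : forall l k m (y : 'M_(m, \dim L)), y *m (A - l%:M) ^+ k = 0 -> y *m P l = y.
Hypothesis P0 : forall l m, l != m -> P l *m P m = 0.

Definition component l z := uncrd (crd L z *m P l).

Lemma component_mem l z : component l z \in L. Proof. exact: uncrd_mem. Qed.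

Lemma component_graded l z : graded x l (component l z).
Proof.
apply/gradedP; rewrite ?component_mem //; exists (\dim L).
by rewrite uncrdK -mulmxA PA mulmx0.
Qed.

Lemma component_sum z : z \in L -> z = \sum_(l <- s) component l z.
Proof.
move=> Lz; apply: (crd_inj (L := L)) => //.
  by apply: memv_suml => l _; apply: component_mem.
rewrite linear_sum -[LHS]mulmx1 -P1 mulmx_sumr.
by apply: eq_bigr => l _; rewrite /= /component uncrdK.
Qed.

Lemma graded_component l z : graded x l z -> component l z = z.
Proof.
move=> gz; have Lz := gz.1; have [k zk] := (gradedP l Lx Lz).1 gz.
by rewrite /component (PP zk) crdK.
Qed.

Lemma graded_component_neq l m z : l != m -> graded x l z -> component m z = 0.
Proof.
move=> lm gz; have Lz := gz.1; have [k zk] := (gradedP l Lx Lz).1 gz.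
apply: (crd_inj (L := L)); rewrite ?component_mem ?mem0v //.
by rewrite uncrdK linear0 -(PP zk) -mulmxA P0 ?mulmx0.
Qed.

Lemma graded_notin l z : l \notin s -> graded x l z -> z = 0.
Proof.
move=> ls gz; rewrite (component_sum gz.1) big_seq big1 // => m ms.
by apply: graded_component_neq gz; apply: contraNneq ls => ->.
Qed.

Variable phi : K -> K.
Hypothesis phiD : forall l m, l \in s -> m \in s -> l + m \in s -> phi (l + m) = phi l + phi m.

Definition weight_derivation : 'M[K]_(\dim L) := \sum_(l <- s) phi l *: P l.
Local Notation F := weight_derivation.

Lemma weight_derivation_graded l z : uniq s -> l \in s -> graded x l z ->
  crd L z *m F = phi l *: crd L z.
Proof.
move=> us ls gz; have [k zk] := (gradedP l Lx gz.1).1 gz.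
rewrite mulmx_sumr (bigD1_seq l) //= big1 => [|m ml].
  by rewrite -scalemxAr (PP zk) addr0.
by rewrite -scalemxAr -(PP zk) -mulmxA P0 ?mulmx0 ?scaler0 // eq_sym.
Qed.

(** This is the derivation property of [F]. Where [l + m] is not an eigenvalue the bracket is 0, so
    additivity of [phi] is asked only inside [s]. *)
Lemma adm_weight_derivation z : uniq s -> z \in L ->
  adm L (uncrd (crd L z *m F)) = adm L z *m F - F *m adm L z.
Proof.
move=> us Lz; apply: adm_ext => w Lw.
rewrite {1}[w in lie_bracket _ w](component_sum Lw).
have E l m u v : l \in s -> m \in s -> graded x l u -> graded x m v ->
    crd L (lie_bracket (uncrd (crd L u *m F)) v) = crd L v *m (adm L u *m F - F *m adm L u).
  move=> ls ms gu gv; have Lu := gu.1; have Lv := gv.1.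
  rewrite (weight_derivation_graded us ls gu) mulmxBr !mulmxA (weight_derivation_graded us ms gv).
  rewrite -crd_lie // -scalemxAl -crd_lie //.
  have -> : uncrd (phi l *: crd L u) = phi l *: u.
    by rewrite -linearZ /= crdK // memvZ.
  rewrite lieZl linearZ /=; have gm := graded_lie Lx gu gv.
  have [lms|lms] := boolP (l + m \in s).
    by rewrite (weight_derivation_graded us lms gm) phiD // scalerDl addrK.
  by rewrite (graded_notin lms gm) linear0 mul0mx !scaler0 subr0.
rewrite linear_sum linear_sum /=.
have -> : crd L w = \sum_(m <- s) crd L (component m w) by rewrite {1}(component_sum Lw) linear_sum.
rewrite mulmx_suml big_seq [RHS]big_seq; apply: eq_bigr => m ms.
have gw := component_graded m w; set v := component m w in gw *.
have -> : uncrd (crd L z *m F) = \sum_(l <- s) uncrd (crd L (component l z) *m F).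
  apply: (crd_inj (L := L)); rewrite ?uncrd_mem //.
    by apply: memv_suml => l _; apply: uncrd_mem.
  have -> : crd L z = \sum_(l <- s) crd L (component l z) by rewrite {1}(component_sum Lz) linear_sum.
  rewrite uncrdK (linear_sum (crd L)) mulmx_suml.
  by apply: eq_bigr => l _; rewrite /= uncrdK.
have -> : adm L z = \sum_(l <- s) adm L (component l z) by rewrite {1}(component_sum Lz) linear_sum.
have -> : lie_bracket (\sum_(l <- s) uncrd (crd L (component l z) *m F)) v =
    \sum_(l <- s) lie_bracket (uncrd (crd L (component l z) *m F)) v.
  by apply: (big_morph (fun u => lie_bracket u v)) => [u1 u2|]; rewrite ?lieDl ?lie0l.
rewrite linear_sum /= mulmx_suml mulmx_sumr -sumrB mulmx_sumr.
rewrite big_seq [RHS]big_seq; apply: eq_bigr => l ls.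
by apply: (E l m) => //; apply: component_graded.
Qed.

End Derivation.

Definition radical := killing_orth L L.

Lemma radicalP X : X \in radical <-> X \in L /\ forall Y, Y \in L -> killing_form L X Y = 0.
Proof. exact: mem_killing_orth. Qed.

Lemma radical_sub X : X \in radical -> X \in L. Proof. by case/radicalP. Qed.

Lemma radical_ideal X Y : X \in radical -> Y \in L -> lie_bracket X Y \in radical.
Proof.
move=> /radicalP[LX rX] LY; apply/radicalP; split=> [|Z LZ]; first exact: LB.
by rewrite (killing_invariant LB) // rX // LB.
Qed.

Definition radical_bracket : {vspace 'M[K]_n} :=
  vspace_of [set x | forall U : {vspace 'M[K]_n},
    (forall y z, y \in radical -> z \in L -> lie_bracket y z \in U) -> x \in U].

Lemma radical_bracketP x : x \in radical_bracket <-> forall U : {vspace 'M[K]_n},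
    (forall y z, y \in radical -> z \in L -> lie_bracket y z \in U) -> x \in U.
Proof.
apply: mem_vspace_of => [U _|c u v Hu Hv U HU] /=; first exact: mem0v.
by rewrite memvD ?memvZ ?Hu ?Hv.
Qed.

Lemma radical_bracket_ind (S : set 'M[K]_n) : S 0 ->
  (forall c u v, S u -> S v -> S (c *: u + v)) ->
  (forall y z, y \in radical -> z \in L -> S (lie_bracket y z)) ->
  forall x, x \in radical_bracket -> S x.
Proof.
move=> S0 SD Sb x /radical_bracketP/(_ (vspace_of S)) H.
apply/(mem_vspace_of S0 SD)/H => y z ry Lz.
by apply/(mem_vspace_of S0 SD)/Sb.
Qed.

Lemma mem_radical_bracket y z : y \in radical -> z \in L -> lie_bracket y z \in radical_bracket.
Proof. by move=> ry Lz; apply/radical_bracketP => U; apply. Qed.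

Lemma radical_bracket_sub x : x \in radical_bracket -> x \in radical.
Proof. by move/radical_bracketP; apply=> y z; apply: radical_ideal. Qed.

(** Cartan's argument: the trace of [adm L x *m F] is the sum of the terms rank(P l) l phi(l). It is
    zero, and [rational_functional] then kills each nonzero eigenvalue. *)
Lemma radical_bracket_nilpotent x : x \in radical_bracket -> adm L x ^+ \dim L = 0.
Proof.
move=> ux; have Lx := radical_sub (radical_bracket_sub ux).
have [s [P [us [P1 PA PP P0 PB]]]] := spectral_projectors (adm L x).
have Pn l : l \notin s -> P l = 0.
  move=> ls; rewrite -[P l]mulmx1 -P1 mulmx_sumr big_seq big1 // => m ms.
  by apply: P0; apply: contraNneq ls => ->.
apply: (nilpotent_of_traces char0 P1 PA PP PB) => l.
rewrite (projector_trace PA PP PB).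
have [->|l0] := eqVneq l 0; first by rewrite mul0r.
have [ls|/Pn ->] := boolP (l \in s); last by rewrite mxrank0 mulr0.
have [phi [phiD phiP]] := rational_functional char0 us ls l0.
rewrite (phiP (fun l => \rank (P l))) ?mulr0 //.
pose F := weight_derivation s P phi.
(* For w = [y, z], cyclicity moves the commutator onto [z] and [F], giving a Killing product of [y]
   in the radical with an element of [L]. *)
have trF w : w \in radical_bracket -> \tr (adm L w *m F) = 0.
  move: w; apply: radical_bracket_ind => [|c u v u0 v0|y z ry Lz].
  - by rewrite linear0 mul0mx mxtrace0.
  - by rewrite linearP mulmxDl -scalemxAl mxtraceD mxtraceZ u0 v0 mulr0 addr0.
  have Ly := radical_sub ry; rewrite adm_lie //.
  have := killing_trace LB y (uncrd_mem (L := L) (crd L z *m F)).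
  have [_ ->] := (radicalP y).1 ry; last exact: uncrd_mem.
  rewrite (adm_weight_derivation Lx P1 PA PP P0 phiD us Lz) mulmxBr mulmxBl !raddfB /=.
  rewrite -!mulmxA [\tr (adm L z *m _)]mxtrace_mulC -!mulmxA => /esym/eqP.
  by rewrite subr_eq0 => /eqP ->; rewrite subrr.
rewrite -[RHS](trF x ux) mulmx_sumr raddf_sum; apply: eq_bigr => m _ /=.
rewrite -scalemxAr mxtraceZ (projector_trace PA PP PB).
by rewrite mulrCA [RHS]mulrCA [phi m * _]mulrC.
Qed.

(* Engel's theorem, in the form that survives the enlargement of [M] by an
   element [x] with [M, x] in [M]. *)
Definition engel (M : {vspace 'M[K]_n}) := forall A B : {vspace 'M[K]_n},
  (B <= L)%VS -> (A <= B)%VS -> A != B ->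
  (forall m z, m \in M -> z \in A -> lie_bracket m z \in A) ->
  (forall m z, m \in M -> z \in B -> lie_bracket m z \in B) ->
  exists z, [/\ z \in B, z \notin A & forall m, m \in M -> lie_bracket m z \in A].

Lemma proper_witness (A B : {vspace 'M[K]_n}) : (A <= B)%VS -> A != B ->
  exists2 z, z \in B & z \notin A.
Proof.
move=> AB neq; apply: contrapT => noz; move/eqP: neq; apply; apply/eqP.
rewrite eqEsubv AB; apply/subvP => z zB; apply: contrapT => /negP zA.
by apply: noz; exists z.
Qed.

(** Take a subalgebra [M] of [u] of greatest dimension with property [engel]. If it is proper,
    [engel] applied to [M] inside [u] gives [x] outside [M] with [M, x] in [M], and [M + <[x]>] is
    good again. *)
Lemma engel_theorem (u : {vspace 'M[K]_n}) : (u <= L)%VS ->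
  (forall x y, x \in u -> y \in u -> lie_bracket x y \in u) ->
  (forall x, x \in u -> exists k, forall z, z \in L -> iter k (lie_bracket x) z = 0) ->
  engel u.
Proof.
move=> uL uB nil.
pose good (M : {vspace 'M[K]_n}) := [/\ (M <= u)%VS,
  forall x y, x \in M -> y \in M -> lie_bracket x y \in M & engel M].
pose Pd k := `[< exists M, good M /\ \dim M = k >].
have exP : exists k, Pd k.
  exists 0%N; apply/asboolP; exists 0%VS; split; last exact: dimv0.
  split=> [|x y|A B _ AB neq _ _]; first exact: sub0v.
    by rewrite !memv0 => /eqP -> _; rewrite lie0l.
  have [z zB zA] := proper_witness AB neq; exists z; split=> // m.
  by rewrite memv0 => /eqP ->; rewrite lie0l mem0v.
have bP k : Pd k -> (k <= \dim u)%N by move=> /asboolP[M [[Mu _ _] <-]]; apply: dimvS.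
case: (ex_maxnP exP bP) => k /asboolP[M [[Mu MB Me] dM]] maxk.
have [-> //|neq] := eqVneq u M.
have [|x [xu xM xb]] := Me M u uL Mu _ MB (fun m z mM => uB m z (subvP Mu m mM)).
  by rewrite eq_sym.
have [j xj] := nil x xu.
pose M' := (M + <[x]>)%VS.
have MM' : (M <= M')%VS := addvSl _ _.
have xM' : x \in M' := subvP (addvSr _ _) _ (memv_line x).
have M'P m : m \in M' -> exists2 m1, m1 \in M & exists c, m = m1 + c *: x.
  by move=> /memv_addP[m1 m1M [_ /vlineP[c ->] ->]]; exists m1 => //; exists c.
suff : (\dim M' <= k)%N.
  rewrite leqNgt -dM => /negP[]; rewrite ltnNge; apply: contra xM => le.
  have /eqP -> : M == M' by rewrite eqEdim MM' le.
  exact: xM'.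
apply: maxk; apply/asboolP; exists M'; split=> //; split.
- by apply/subvP => m /M'P[m1 m1M [c ->]]; rewrite memvD ?memvZ // (subvP Mu).
- move=> y z /M'P[y1 y1M [c ->]] /M'P[z1 z1M [e ->]]; apply: (subvP MM').
  rewrite lieDl lieZl (linearD (lie_bracket y1) z1) (linearD (lie_bracket x) z1).
  rewrite (linearZZ (lie_bracket y1)) (linearZZ (lie_bracket x)) /= lieXX scaler0 addr0.
  apply: memvD; first by apply: memvD; [apply: MB|apply/memvZ/xb].
  by apply: memvZ; rewrite lieC memvN xb.
- move=> A B BL AB nAB M'A M'B.
  have MsubA m z : m \in M -> z \in A -> lie_bracket m z \in A.
    by move=> mM; apply: M'A; apply: (subvP MM').
  have MsubB m z : m \in M -> z \in B -> lie_bracket m z \in B.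
    by move=> mM; apply: M'B; apply: (subvP MM').
  have [z [zB zA zM]] := Me A B BL AB nAB MsubA MsubB.
  (* Bracketing with [x] preserves the vectors of [B] that [M] sends into [A]; the last iterate
     outside [A] is sent into [A] by [x] as well. *)
  have good_iter i : iter i (lie_bracket x) z \in B /\
      forall m, m \in M -> lie_bracket m (iter i (lie_bracket x) z) \in A.
    elim: i => [|i [IB IA]] //=; split; first exact: M'B.
    move=> m mM; rewrite lie_jacobi memvD ?IA ?xb //.
    by apply: M'A => //; apply: IA.
  have exi : exists i, iter i (lie_bracket x) z \in A.
    by exists j; rewrite xj ?mem0v // (subvP BL).
  case: (ex_minnP exi) => i iA imin.
  case: i iA imin => [/= zA'|i iA imin]; first by rewrite zA' in zA.
  have [wB wM] := good_iter i.
  exists (iter i (lie_bracket x) z); split=> //.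
    by apply/negP => /imin; rewrite ltnn.
  move=> m /M'P[m1 m1M [c ->]].
  by rewrite lieDl lieZl memvD ?wM ?memvZ.
Qed.

End LieStructure.

Section DeterminantDifferential.
Variables (K : closedFieldType) (n : nat).
Local Notation N := (n * n)%N.

Lemma mdiffB (p q : {mpoly K[N]}) A X : mdiff (p - q) A X = mdiff p A X - mdiff q A X.
Proof. by apply: (addIr (mdiff q A X)); rewrite -mdiffD !subrK. Qed.

Lemma dmxB A X m1 m2 (B C : 'M[{mpoly K[N]}]_(m1, m2)) :
  dmx A X (B - C) = dmx A X B - dmx A X C.
Proof. by apply/matrixP => i j; rewrite !mxE mdiffB. Qed.

Lemma mdiff_prod (A X : 'M[K]_n) (I : finType) (F : I -> {mpoly K[N]}) :
  mdiff (\prod_i F i) A X = \sum_i mdiff (F i) A X * \prod_(j | j != i) mx_eval (F j) A.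
Proof.
have evP (r : seq I) (Q : pred I) : mx_eval (\prod_(j <- r | Q j) F j) A =
    \prod_(j <- r | Q j) mx_eval (F j) A.
  by rewrite mx_evalE rmorph_prod.
suff H r : uniq r -> mdiff (\prod_(i <- r) F i) A X =
    \sum_(i <- r) mdiff (F i) A X * \prod_(j <- r | j != i) mx_eval (F j) A.
  by rewrite H ?index_enum_uniq.
elim: r => [|a r IHr]; first by rewrite !big_nil -mpolyC1 mdiffC.
case/andP=> ar ur; rewrite !big_cons mdiffM IHr // evP eqxx /= addrC; congr (_ + _).
  congr (_ * _); rewrite big_seq [RHS]big_seq_cond; apply: eq_bigl => j.
  by case jr: (j \in r) => //=; apply/esym; apply: contraNneq ar => <-.
rewrite mulr_sumr big_seq [RHS]big_seq; apply: eq_bigr => i ir.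
rewrite big_cons; have -> : a != i by apply: contraNneq ar => ->.
by rewrite mulrCA.
Qed.

(** Only the identity permutation contributes: any other one moves two indices, so a zero
    off-diagonal factor survives differentiation. *)
Lemma mdiff_det (A X : 'M[K]_n) (B : 'M[{mpoly K[N]}]_n) :
  evmx A B = 1%:M -> mdiff (\det B) A X = \tr (dmx A X B).
Proof.
move=> B1; have BE i j : mx_eval (B i j) A = (i == j)%:R.
  by have /matrixP/(_ i j) := B1; rewrite !mxE.
rewrite mdiff_sum (bigD1 (1%g : {perm 'I_n})) //= [X in _ + X]big1 => [|s s1].
  rewrite odd_perm1 expr0 mul1r addr0 mdiff_prod; apply: eq_bigr => i _.
  rewrite !perm1 mxE big1 ?mulr1 // => j _.
  by rewrite perm1 BE eqxx.
have -> : (-1) ^+ s = ((-1) ^+ s)%:MP :> {mpoly K[N]} by rewrite rmorphXn rmorphN1.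
rewrite mdiffM mdiffC mul0r addr0 mdiff_prod big1 ?mulr0 // => i _.
have [k sk] : exists k, s k != k.
  apply: contrapT => nok; move/eqP: s1; apply; apply/permP => k; rewrite perm1.
  by apply: contrapT => /eqP sk; apply: nok; exists k.
have [j ji sj] : exists2 j, j != i & s j != j.
  have [ki|ki] := eqVneq k i; last by exists k.
  exists (s k); first by rewrite -ki.
  by rewrite (inj_eq perm_inj).
rewrite (bigD1 j) //= BE eq_sym (negbTE sj) mul0r mulr0.
by [].
Qed.

End DeterminantDifferential.

(** * Nondegeneracy of the Killing form *)

Section SimpleLieAlgebra.
Variables (K : closedFieldType) (n : nat) (G : set 'M[K]_n).
Hypothesis char0 : [pchar K] =i pred0.
Hypothesis sG : simple_group G.
Local Notation N := (n * n)%N.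
Implicit Types (X Y Z g : 'M[K]_n).

Let aG := simple_alg sG.
Let pG := simple_prime sG.
Let det1 := simple_det sG.
Let LB := Lie_bracket aG det1.
Let uG g (Gg : G g) : g \in unitmx := alg_group_unit aG Gg.

Definition comm_poly Y : 'M[{mpoly K[N]}]_n :=
  gmx *m map_mx (@mpolyC N K) Y - map_mx (@mpolyC N K) Y *m gmx.

Lemma comm_polyE g Y i j : mx_eval (comm_poly Y i j) g = (g *m Y - Y *m g) i j.
Proof.
have <- : evmx g (comm_poly Y) = g *m Y - Y *m g.
  by rewrite evmxB !evmxM evmx_gmx evmx_const.
by rewrite [RHS]mxE.
Qed.

Definition commutant (C : set 'M[K]_n) : set 'M[K]_n := [set g | forall Y, C Y -> g *m Y = Y *m g].

Lemma commutant_alg C : algebraic_group (G `&` commutant C).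
Proof.
apply: alg_groupI aG _ _ _ _.
- exists [set p | exists Y i j, C Y /\ p = comm_poly Y i j].
  apply/seteqP; split=> [g gC _ [Y [i [j [CY ->]]]]|g gp Y CY].
    by rewrite comm_polyE gC // subrr mxE.
  apply/eqP; rewrite -subr_eq0; apply/eqP/matrixP => i j.
  by rewrite -comm_polyE [RHS]mxE; apply: gp; exists Y, i, j.
- by move=> Y _; rewrite mul1mx mulmx1.
- by move=> g h _ _ gC hC Y CY; rewrite -mulmxA hC // mulmxA gC // mulmxA.
- move=> g Gg gC Y CY; apply: (can_inj (mulKmx (uG Gg))).
  by rewrite mulmxA mulmxV ?uG // mul1mx mulmxA gC // mulmxK ?uG.
Qed.

Lemma commutant_normal C : (forall g Y, G g -> C Y -> C (g *m Y *m invmx g)) ->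
  normal_in (G `&` commutant C) G.
Proof.
have [_ GM GV _] := aG; move=> stC; split=> [g []//|g x Gg [Gx xC]].
split; first by apply: (GM) (GV _ Gg); apply: (GM).
move=> Y CY; have := xC _ (stC _ _ (GV _ Gg) CY); rewrite invmxK => E.
have := congr1 (fun M => g *m M *m invmx g) E.
rewrite !mulmxA (mulmxV (uG Gg)) mul1mx => <-.
by rewrite -!mulmxA (mulmxV (uG Gg)) mulmx1.
Qed.

(** The centralizer of [C] in [G] is normal, hence finite or all of [G]; it contains the curve
    exp(tX), which is infinite unless [X = 0]. *)
Lemma nilpotent_in_commutant C X k : (forall g Y, G g -> C Y -> C (g *m Y *m invmx g)) ->
  X \in Lie G -> X ^+ k = 0 -> commutant C X -> X = 0 \/ G `<=` commutant C.
Proof.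
move=> stC LX Xk XC; have [NG|NG] := pselect (G `&` commutant C = G).
  by right=> g Gg; move: Gg; rewrite -NG => -[].
left; have [_ _ _ fin] := sG.
have fN := fin _ (commutant_alg C) (commutant_normal stC) NG.
apply: (expmx_infinite char0 Xk (S := G `&` commutant C)) fN => t.
split; first exact: (expmx_group char0 Xk).
by move=> Y CY; apply: expmx_commute; apply: XC.
Qed.

(** The spectral projectors of [X] commute with [Y], so their products with [Z, Y] have trace 0. *)
Lemma commutator_nilpotent X Y Z : X = lie_bracket Z Y -> X *m Y = Y *m X -> X ^+ n = 0.
Proof.
move=> XE XY; have [s [P [_ [P1 PA PP _ PB]]]] := spectral_projectors X.
apply: (nilpotent_of_traces char0 P1 PA PP PB) => l.
rewrite XE mulmxBl raddfB /= -[Y *m Z *m P l]mulmxA [\tr (Y *m _)]mxtrace_mulC.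
by rewrite -!mulmxA (PB l Y XY) subrr.
Qed.

(* An abelian stable ideal [c] is central, since the nilpotent elements of
   [[g, c]] exponentiate into the centralizer of [c]; then it is centralized by
   [G], and the triviality of the characters [det (g P + 1 - P)], [P] a spectral
   projector of [Y] in [c], makes [Y] nilpotent. *)
Lemma abelian_ideal0 (c : {vspace 'M[K]_n}) :
  (forall Y, Y \in c -> Y \in Lie G) ->
  (forall g Y, G g -> Y \in c -> g *m Y *m invmx g \in c) ->
  (forall X Y, X \in c -> Y \in c -> lie_bracket X Y = 0) ->
  forall Y, Y \in c -> Y = 0.
Proof.
move=> cL stc cc; have [G1 GM GV _] := aG.
have comm0 X Y : lie_bracket X Y = 0 -> X *m Y = Y *m X.
  by move=> /eqP; rewrite subr_eq0 => /eqP.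
have central Z Y : Z \in Lie G -> Y \in c -> lie_bracket Z Y = 0.
  move=> LZ cY; set X := lie_bracket Z Y.
  have cX : X \in c by apply: (stable_bracket aG det1).
  have Xn : X ^+ n = 0 by apply: (@commutator_nilpotent X Y Z) => //; apply/comm0/cc.
  have [//|Gc] := nilpotent_in_commutant (C := [set` c]) stc (cL _ cX) Xn
    (fun Y' cY' => comm0 _ _ (cc _ _ cX cY')).
  apply/matrixP => i j; rewrite [RHS]mxE.
  have := (mem_Lie G Z).1 LZ (comm_poly Y i j).
  have -> : mdiff (comm_poly Y i j) 1%:M Z = X i j.
    have -> : X = dmx 1%:M Z (comm_poly Y).
      rewrite dmxB !dmxM !dmx_const dmx_gmx !evmx_const mulmx0 mul0mx.
      by rewrite add0r addr0.
    by rewrite [RHS]mxE.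
  by apply=> g Gg; rewrite comm_polyE (Gc g Gg) // subrr mxE.
(* The differentials of the entries of g Y g^-1 are given by brackets with [Y], which vanish. *)
have Gc g Y : G g -> Y \in c -> g *m Y = Y *m g.
  move=> Gg cY; suff E : g *m Y *m invmx g = Y by rewrite -{2}E mulmxKV ?uG.
  apply/matrixP => i j; have := constant_on_group char0 aG pG (f := conj_poly Y i j) _ Gg.
  have evE h : G h -> mx_eval (conj_poly Y i j) h = (h *m Y *m invmx h) i j.
    by move=> Gh; rewrite -(evmx_conj aG det1 Y Gh) [RHS]mxE.
  rewrite !evE // invmx1 mul1mx mulmx1; apply=> h X Gh LX.
  have := dmx_conj aG det1 Y Gh LX; rewrite central // mulmx0 mul0mx.
  by move=> /matrixP/(_ i j); rewrite !mxE.
have nilp Y : Y \in c -> Y ^+ n = 0.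
  move=> cY; have [s [P [_ [P1 PA PP _ PB]]]] := spectral_projectors Y.
  apply: (nilpotent_of_traces char0 P1 PA PP PB) => l.
  (* [B] replaces [g] by the identity on the complement of the image of [P l]; as [g] in [G]
     commutes with [P l], the determinant is a character. *)
  pose B : 'M[{mpoly K[N]}]_n :=
    gmx *m map_mx (@mpolyC N K) (P l) + map_mx (@mpolyC N K) (1%:M - P l).
  have BE g : evmx g B = g *m P l + (1%:M - P l).
    have evmxD (C D : 'M[{mpoly K[N]}]_n) : evmx g (C + D) = evmx g C + evmx g D.
      by apply/matrixP => i j; rewrite !mxE mx_evalD.
    by rewrite evmxD evmxM evmx_gmx !evmx_const.
  have Pid : P l *m P l = P l by apply: projector_idem PA PP _.
  have chi1 : mx_eval (\det B) 1%:M = 1.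
    by rewrite mx_eval_det BE mul1mx addrC subrK det1.
  have chi g : G g -> mx_eval (\det B) g = 1.
    apply: (simple_character sG) => // x y Gx Gy; rewrite !mx_eval_det -det_mulmx !BE.
    congr (\det _); have Py : P l *m y = y *m P l by apply/PB/esym/Gc.
    have PQ : P l *m (1%:M - P l) = 0 by rewrite mulmxBr mulmx1 Pid subrr.
    have QP : (1%:M - P l) *m P l = 0 by rewrite mulmxBl mul1mx Pid subrr.
    have QQ : (1%:M - P l) *m (1%:M - P l) = 1%:M - P l by rewrite mulmxBl PQ mul1mx subr0.
    move: (1%:M - P l) PQ QP QQ => Q PQ QP QQ.
    rewrite mulmxDl !mulmxDr QQ -!mulmxA PQ mulmx0 addr0 -Py [Q *m _]mulmxA QP mul0mx add0r.
    by rewrite [P l *m (P l *m y)]mulmxA Pid.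
  (* At 1 in the direction [Y], the differential of this trivial character is the trace of
     [Y *m P l]. *)
  have := (mem_Lie G Y).1 (cL _ cY) (\det B - 1%:MP) => /(_ _)/eqP.
  rewrite mdiffB mdiffC subr0 mdiff_det; last by rewrite BE mul1mx addrC subrK.
  rewrite dmxD dmxM !dmx_const mulmx0 add0r addr0 dmx_gmx evmx_const => H.
  by apply/eqP/H => g Gg; rewrite mx_evalB chi // mx_evalC subrr.
move=> Y cY; have stG g h : G g -> G h -> G (g *m h *m invmx g).
  by move=> Gg Gh; apply: (GM) (GV _ Gg); apply: (GM).
(* Now [Y] is nilpotent and centralized by [G]: the alternative with [C = G] gives [Y = 0] or a
   commutative [G]. *)
have [|//|comm] := nilpotent_in_commutant (C := G) stG (cL _ cY) (nilp _ cY).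
  by move=> g Gg; apply/esym/Gc.
have [_ _ [g1 [g2 [Gg1 Gg2 nc]]] _] := sG.
by case: nc; apply: comm.
Qed.

Lemma Lie_radical_stable g X : G g -> X \in radical (Lie G) ->
  g *m X *m invmx g \in radical (Lie G).
Proof.
have [_ _ GV _] := aG; move=> Gg /radicalP[LX rX].
apply/radicalP; split=> [|Y LY]; first exact: Lie_conj.
have LY' := Lie_conj aG (GV _ Gg) LY; rewrite invmxK in LY'.
have -> : Y = g *m (invmx g *m Y *m g) *m invmx g.
  by rewrite !mulmxA (mulmxV (uG Gg)) mul1mx mulmxK ?uG.
rewrite (killing_conj LB (uG Gg)) ?rX // => Z LZ; first exact: Lie_conj.
by have := Lie_conj aG (GV _ Gg) LZ; rewrite invmxK.
Qed.

(** If [u], the bracket of the radical with [L], were nonzero, Engel's theorem would give it a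
    nonzero centre, a stable abelian ideal. Hence [u] is 0 and the radical is itself abelian. *)
Theorem killing_nondegenerate X : X \in Lie G ->
  (forall Y, Y \in Lie G -> killing_form (Lie G) X Y = 0) -> X = 0.
Proof.
pose L := Lie G; pose u := radical_bracket L.
have uR x : x \in u -> x \in radical L by apply: radical_bracket_sub.
have uL x : x \in u -> x \in L by move=> /uR; apply: radical_sub.
have u_stable g x : G g -> x \in u -> g *m x *m invmx g \in u.
  move=> Gg; move: x; apply: radical_bracket_ind => [|a v w uv uw|y z ry Lz].
  - by rewrite mulmx0 mul0mx mem0v.
  - by rewrite mulmxDr mulmxDl -scalemxAr -scalemxAl memvD ?memvZ.
  have -> : g *m lie_bracket y z *m invmx g =
      lie_bracket (g *m y *m invmx g) (g *m z *m invmx g).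
    by rewrite /lie_bracket mulmxBr mulmxBl !mulmxA !(mulmxKV (uG Gg)).
  by apply: mem_radical_bracket; [apply: Lie_radical_stable | apply: Lie_conj].
have nil x : x \in u -> exists k, forall z, z \in L -> iter k (lie_bracket x) z = 0.
  move=> ux; exists (\dim L) => z Lz; have Lx := uL x ux.
  apply: (crd_inj (L := L)); rewrite ?mem0v ?(ad_iter_mem LB) // linear0 (crd_ad_iter LB) //.
  by rewrite (radical_bracket_nilpotent char0 LB ux) mulmx0.
have uB x y : x \in u -> y \in u -> lie_bracket x y \in u.
  by move=> ux uy; apply: mem_radical_bracket; [apply: uR|apply: uL].
have u0 : u = 0%VS.
  apply/eqP/negPn/negP => u_neq0.
  have uLs : (u <= L)%VS by apply/subvP.
  have [||||z [uz z0 zc]] := engel_theorem uLs uB nil (A := 0%VS) (B := u) uLs.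
  - exact: sub0v.
  - by rewrite eq_sym.
  - by move=> x y _; rewrite !memv0 => /eqP ->; rewrite linear0.
  - by move=> x y; apply: uB.
  pose c := vspace_of [set z | z \in u /\ forall x, x \in u -> lie_bracket x z = 0].
  have cP y : y \in c <-> y \in u /\ forall x, x \in u -> lie_bracket x y = 0.
    apply: mem_vspace_of => [|a v w [uv vc] [uw wc]] /=.
      by split=> [|x _]; rewrite ?mem0v ?linear0.
    split=> [|x ux]; first by rewrite memvD ?memvZ.
    by rewrite linearP /= vc ?wc // scaler0 addr0.
  move: z0; rewrite memv0 => /eqP; apply; apply: (@abelian_ideal0 c).
  - by move=> y /cP[/uL].
  - have [_ _ GV _] := aG; move=> g y Gg /cP[uy yc]; apply/cP; split; first exact: u_stable.
    move=> x ux; have ux' := u_stable _ _ (GV _ Gg) ux; rewrite invmxK in ux'.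
    have := congr1 (fun M => g *m M *m invmx g) (yc _ ux').
    rewrite /lie_bracket mulmxBr mulmxBl mulmx0 mul0mx !mulmxA.
    by rewrite !(mulmxV (uG Gg)) !mul1mx !(mulmxK (uG Gg)) => ->.
  - by move=> x y /cP[ux _] /cP[_ yc]; apply: yc.
  - by apply/cP; split=> // x /zc; rewrite memv0 => /eqP.
move=> LX X0; apply: (@abelian_ideal0 (radical L)).
- by move=> y; apply: radical_sub.
- by move=> g y; apply: Lie_radical_stable.
- move=> x y rx ry; have := mem_radical_bracket rx (radical_sub ry).
  by rewrite -/u u0 memv0 => /eqP.
- by apply/radicalP.
Qed.

End SimpleLieAlgebra.

(** * Taylor expansion along an orbit *)

Section Orbits.
Variables (K : closedFieldType) (n : nat) (G : set 'M[K]_n).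
Hypothesis aG : algebraic_group G.
Local Notation N := (n * n)%N.
Implicit Types (x y g X : 'M[K]_n).

Lemma invmxM g h : g \in unitmx -> h \in unitmx -> invmx (g *m h) = invmx h *m invmx g.
Proof.
move=> ug uh; apply: (can_inj (mulKmx (_ : g *m h \in unitmx))); first by rewrite unitmx_mul ug.
by rewrite mulmxV ?unitmx_mul ?ug // !mulmxA mulmxK // mulmxV.
Qed.

Lemma orbit_refl x : Ad_orbit G x x.
Proof. by have [G1 _ _ _] := aG; exists 1%:M => //; rewrite invmx1 mul1mx mulmx1. Qed.

Lemma orbit_trans x y z : Ad_orbit G x y -> Ad_orbit G y z -> Ad_orbit G x z.
Proof.
have [_ GM _ _] := aG; move=> [g Gg <-] [h Gh <-]; exists (h *m g); first exact: GM.
by rewrite invmxM ?(alg_group_unit aG) // !mulmxA.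
Qed.

Lemma orbit_sym x y : Ad_orbit G x y -> Ad_orbit G y x.
Proof.
have [_ _ GV _] := aG; move=> [g Gg <-]; exists (invmx g); first exact: GV.
have ug := alg_group_unit aG Gg.
by rewrite invmxK !mulmxA mulVmx // mul1mx mulmxKV.
Qed.

(** The ideal of an orbit is stable under conjugation, so vanishing at [y] spreads to the orbit of
    [y]. *)
Lemma orbit_closure x y : zariski_closure (Ad_orbit G x) y ->
  vanish (Ad_orbit G x) `<=` vanish (Ad_orbit G y).
Proof.
move=> /zariski_closureP cly q qx _ [g Gg <-].
pose B : 'M[{mpoly K[N]}]_n :=
  map_mx (@mpolyC N K) g *m gmx *m map_mx (@mpolyC N K) (invmx g).
have BE z : mx_eval (msubst B q) z = mx_eval q (g *m z *m invmx g).
  by rewrite mx_eval_subst !evmxM !evmx_const evmx_gmx.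
rewrite -BE; apply: cly => z xz; rewrite BE; apply: qx.
by apply: orbit_trans xz _; exists g.
Qed.

End Orbits.

Section TaylorExpansion.
Variables (K : closedFieldType) (n : nat).
Hypothesis char0 : [pchar K] =i pred0.
Local Notation N := (n * n)%N.
Local Notation T := {mpoly K[N]}.
Implicit Types (x y X v w : 'M[K]_n) (q : T).

(** A polynomial vector field as a derivation: [ddir] is the case of constant fields, [dad] that of
    the linear fields y -> [X, y]. *)
Definition vfield (B : 'M[T]_n) q : T := \sum_i q^`M(i) * mxvec B 0 i.

Lemma vfieldD B q1 q2 : vfield B (q1 + q2) = vfield B q1 + vfield B q2.
Proof. by rewrite /vfield -big_split; apply: eq_bigr => i _; rewrite mderivD mulrDl. Qed.

Lemma vfieldB B q1 q2 : vfield B (q1 - q2) = vfield B q1 - vfield B q2.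
Proof. by apply: (addIr (vfield B q2)); rewrite -vfieldD !subrK. Qed.

Lemma vfield_sum B (I : Type) (r : seq I) (F : I -> T) :
  vfield B (\sum_(i <- r) F i) = \sum_(i <- r) vfield B (F i).
Proof.
apply: (big_morph (vfield B)) => [p q|]; first exact: vfieldD.
by apply: big1 => i _; rewrite mderiv0 mul0r.
Qed.

Lemma vfieldM B q1 q2 : vfield B (q1 * q2) = q1 * vfield B q2 + vfield B q1 * q2.
Proof.
rewrite /vfield mulr_sumr mulr_suml -big_split; apply: eq_bigr => i _ /=.
by rewrite mderivM; ring.
Qed.

Lemma vfieldC B c : vfield B c%:MP = 0.
Proof. by apply: big1 => i _; rewrite mderivC mul0r. Qed.

Lemma vfield_gmx B : map_mx (vfield B) gmx = B.
Proof.
apply: (can_inj mxvecK); apply/rowP => i; rewrite -map_mxvec mxE vec_mxK mxE.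
rewrite /vfield (bigD1 i) //= big1 => [|j ji].
  by rewrite mderivXU eqxx mul1r addr0.
by rewrite mderivXU eq_sym (negbTE ji) mul0r.
Qed.

Lemma mx_eval_vfield B q y : mx_eval (vfield B q) y = mdiff q y (evmx y B).
Proof.
rewrite mx_evalE rmorph_sum; apply: eq_bigr => i _; rewrite rmorphM /= -!mx_evalE.
by rewrite /evmx -map_mxvec mxE.
Qed.

Local Notation cst := (map_mx (@mpolyC N K)).
Lemma vfield_mxMl B X (M : 'M[T]_n) : map_mx (vfield B) (cst X *m M) = cst X *m map_mx (vfield B) M.
Proof.
apply/matrixP => j k; rewrite [LHS]mxE [(_ *m M) j k]mxE [RHS]mxE vfield_sum.
apply: eq_bigr => l _.
by rewrite vfieldM [cst X j l]mxE vfieldC mul0r addr0 [map_mx _ M l k]mxE.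
Qed.

Lemma vfield_mxMr B X (M : 'M[T]_n) : map_mx (vfield B) (M *m cst X) = map_mx (vfield B) M *m cst X.
Proof.
apply/matrixP => j k; rewrite [LHS]mxE [(M *m _) j k]mxE [RHS]mxE vfield_sum.
apply: eq_bigr => l _.
by rewrite vfieldM [cst X l k]mxE vfieldC mulr0 add0r [map_mx _ M j l]mxE.
Qed.

Lemma vfield_mxB B (M1 M2 : 'M[T]_n) :
  map_mx (vfield B) (M1 - M2) = map_mx (vfield B) M1 - map_mx (vfield B) M2.
Proof. by apply/matrixP => i j; rewrite !mxE vfieldB. Qed.

Definition ddir v : T -> T := vfield (cst v).
Definition dad X : T -> T := vfield (cst X *m gmx - gmx *m cst X).

Lemma mx_eval_ddir v q y : mx_eval (ddir v q) y = mdiff q y v.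
Proof. by rewrite mx_eval_vfield evmx_const. Qed.

Lemma mx_eval_dad X q y : mx_eval (dad X q) y = mdiff q y (lie_bracket X y).
Proof. by rewrite mx_eval_vfield evmxB !evmxM !evmx_const evmx_gmx. Qed.

Lemma ddir_mderiv v q i : ddir v q^`M(i) = (ddir v q)^`M(i).
Proof.
rewrite /ddir /vfield linear_sum; apply: eq_bigr => j _ /=.
rewrite -map_mxvec mxE mulrC mul_mpolyC [RHS](congr1 (mderiv i) (mulrC _ _)) mul_mpolyC.
by rewrite mderivZ mderiv_comm.
Qed.

Lemma ddir_dad v X q : ddir v (dad X q) = dad X (ddir v q) + ddir (lie_bracket X v) q.
Proof.
pose C : 'M[T]_n := cst X *m gmx - gmx *m cst X.
transitivity (\sum_i (q^`M(i) * ddir v (mxvec C 0 i) + ddir v q^`M(i) * mxvec C 0 i)).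
  rewrite -[dad X q]/(\sum_i q^`M(i) * mxvec C 0 i) /ddir vfield_sum.
  by apply: eq_bigr => i _; rewrite vfieldM.
rewrite big_split /= addrC; congr (_ + _).
  by apply: eq_bigr => i _; rewrite ddir_mderiv.
apply: eq_bigr => i _; congr (_ * _).
have <- : map_mx (vfield (cst v)) C = cst (lie_bracket X v).
  rewrite vfield_mxB vfield_mxMl vfield_mxMr vfield_gmx /lie_bracket map_mxB.
  by rewrite !map_mxM.
by rewrite -map_mxvec mxE.
Qed.

Definition ddirs (vs : seq 'M[K]_n) q : T := foldr ddir q vs.

Lemma ddirs_cat us vs q : ddirs (us ++ vs) q = ddirs us (ddirs vs q).
Proof. exact: foldr_cat. Qed.

Lemma ddirsB vs q1 q2 : ddirs vs (q1 - q2) = ddirs vs q1 - ddirs vs q2.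
Proof. by elim: vs => //= v vs ->; rewrite /ddir vfieldB. Qed.

Lemma eval_line x v q : (forall k, mx_eval (iter k (ddir v) q) x = 0) -> mx_eval q (x + v) = 0.
Proof.
move=> q0; pose c : 'M[{poly K}]_n := map_mx polyC x + 'X *: map_mx polyC v.
have cE t : map_mx (fun f => f.[t]) c = x + t *: v.
  by apply/matrixP => i j; rewrite !mxE hornerD hornerM hornerX !hornerC.
have -> : x + v = map_mx (fun f => f.[1]) c by rewrite cE scale1r.
rewrite -horner_curve; suff -> : mxe polyC c q = 0 by rewrite horner0.
have cD p : (mxe polyC c p)^`() = mxe polyC c (ddir v p).
  rewrite mxe_curve rmorph_sum; apply: eq_bigr => i _; rewrite rmorphM /=; congr (_ * _).
  rewrite -map_mxvec mxE mxeC /c linearD linearZ /= -!map_mxvec !mxE.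
  by rewrite derivD derivC add0r derivM derivX derivC mul1r mulr0 addr0.
apply: taylor_char0 => // k.
have -> : (mxe polyC c q)^`(k) = mxe polyC c (iter k (ddir v) q).
  by elim: k => [//|k IHk]; rewrite derivnS IHk cD.
by rewrite horner_curve cE scale0r addr0.
Qed.

(* The directions [L] act on [V] and move [x] in all directions of [V]: the
   Taylor coefficients at [x] along [V] of a polynomial in a [g]-stable ideal
   vanish by induction on their order. *)
Lemma stable_ideal_vanish (J : set T) (L V : set 'M[K]_n) x :
  (forall q X, J q -> L X -> J (dad X q)) ->
  (forall q, J q -> mx_eval q x = 0) ->
  (forall X v, L X -> V v -> V (lie_bracket X v)) ->
  (forall v, V v -> exists2 X, L X & lie_bracket X x = v) ->
  forall q v, J q -> V v -> mx_eval q (x + v) = 0.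
Proof.
move=> JL Jx LV surj.
have H k : forall q vs, J q -> (forall v, v \in vs -> V v) -> size vs = k ->
    mx_eval (ddirs vs q) x = 0.
  elim: k => [|k IHk] q vs Jq vsV szvs.
    by case: vs szvs {vsV} => // _; apply: Jx.
  case: vs szvs vsV => // v vs [szvs] vsV.
  have [X LX Xv] := surj v (vsV v (mem_head _ _)).
  rewrite /= mx_eval_ddir -Xv -mx_eval_dad.
  (* [dad X] moves inwards past the constant fields; each commutator leaves [k] derivatives along
     [V], which vanish at [x] by [IHk]. *)
  have swap us ws : (forall v, v \in us ++ ws -> V v) -> size (us ++ ws) = k ->
      mx_eval (ddirs us (dad X (ddirs ws q))) x = mx_eval (ddirs (us ++ ws) (dad X q)) x.
    elim: ws us => [|w ws IHws] us uwV sz; first by rewrite cats0.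
    have -> : dad X (ddirs (w :: ws) q) =
        ddir w (dad X (ddirs ws q)) - ddir (lie_bracket X w) (ddirs ws q).
      by rewrite ddir_dad addrK.
    rewrite ddirsB mx_evalB.
    rewrite -[ddirs us (ddir w _)](ddirs_cat us [:: w]).
    rewrite -[ddirs us (ddir _ (ddirs ws q))](ddirs_cat us (lie_bracket X w :: ws)).
    rewrite IHws -?catA // [X in _ - X](IHk q) ?subr0 // => [u|].
      rewrite mem_cat in_cons => /or3P[uu|/eqP ->|uw].
      - by apply: uwV; rewrite mem_cat uu.
      - by apply: LV => //; apply: uwV; rewrite mem_cat mem_head orbT.
      - by apply: uwV; rewrite mem_cat in_cons uw !orbT.
    by rewrite -sz !size_cat.
  have := swap [::] vs; rewrite /= => -> //.
    by apply: IHk => // [|u uvs]; [apply: JL|apply: vsV; rewrite in_cons uvs orbT].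
  by move=> u uvs; apply: vsV; rewrite in_cons uvs orbT.
move=> q v Jq Vv; apply: eval_line => k.
rewrite -[iter k _ _](_ : ddirs (nseq k v) q = _); last by elim: k => //= k ->.
by apply: (H k) => // [w|]; rewrite ?size_nseq // mem_nseq => /andP[_ /eqP ->].
Qed.

Lemma orbit_closure_vanish G (L V : set 'M[K]_n) x : algebraic_group G ->
  (forall g, G g -> \det g = 1) -> L `<=` [set` Lie G] ->
  (forall X v, L X -> V v -> V (lie_bracket X v)) ->
  (forall v, V v -> exists2 X, L X & lie_bracket X x = v) ->
  V x -> (forall v w, V v -> V w -> V (v - w)) ->
  V `<=` zariski_closure (Ad_orbit G x).
Proof.
move=> aG det1 LG LV surj Vx VB y Vy; apply/zariski_closureP => q Jq.
have -> : y = x + (y - x) by rewrite addrC subrK.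
apply: (stable_ideal_vanish _ _ LV surj Jq (VB _ _ Vy Vx)) => [p X Jp LX z xz|p]; last first.
  by apply; apply: orbit_refl.
by rewrite mx_eval_dad (orbit_tangent aG det1 xz _ Jp) //; apply: LG.
Qed.

End TaylorExpansion.

(** * Weights *)

Section NilpotentElements.
Variables (K : closedFieldType) (n : nat).
Hypothesis char0 : [pchar K] =i pred0.

Lemma exprmxSr m (A : 'M[K]_m) j : A ^+ j.+1 = A ^+ j *m A. Proof. exact: exprSr. Qed.

Lemma exprmxS m (A : 'M[K]_m) j : A ^+ j.+1 = A *m A ^+ j. Proof. exact: exprS. Qed.

Lemma mulmxnl p q r (A : 'M[K]_(p, q)) (B : 'M[K]_(q, r)) k : (A *+ k) *m B = (A *m B) *+ k.
Proof. by elim: k => [|k IHk]; rewrite ?mulr0n ?mul0mx // !mulrS mulmxDl IHk. Qed.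

Lemma mulmxnr p q r (A : 'M[K]_(p, q)) (B : 'M[K]_(q, r)) k : A *m (B *+ k) = (A *m B) *+ k.
Proof. by elim: k => [|k IHk]; rewrite ?mulr0n ?mulmx0 // !mulrS mulmxDr IHk. Qed.

(** [C] is nilpotent, being a commutator that commutes with [A]. On successive quotients of the
    kernels of powers of [A], the product [Z *m A] acts through a multiple of [C], so it is
    nilpotent. *)
Lemma trace_commuting_commutator (A Z : 'M[K]_n) k : A ^+ k = 0 ->
  (Z *m A - A *m Z) *m A = A *m (Z *m A - A *m Z) -> \tr (Z *m A) = 0.
Proof.
move=> Ak; set C := Z *m A - A *m Z => CA.
have Cn : C ^+ n = 0 by apply: (commutator_nilpotent char0 (Y := A) (Z := Z)).
have ZA j : Z *m A ^+ j.+1 = A ^+ j.+1 *m Z + (A ^+ j *m C) *+ j.+1.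
  elim: j => [|j IHj]; first by rewrite expr0 mul1mx mulr1n addrC subrK.
  rewrite exprSr mulmxA IHj mulmxDl -mulmxA.
  have -> : Z *m A = A *m Z + C by rewrite addrC subrK.
  rewrite mulmxDr !mulmxA -addrA; congr (_ + _).
  have -> : A ^+ j *m C *+ j.+1 *m A = A ^+ j.+1 *m C *+ j.+1.
    by rewrite mulmxnl -mulmxA CA mulmxA -exprmxSr.
  by rewrite [RHS]mulrS.
have ker l : forall m (v : 'M_(m, n)), v *m A ^+ l = 0 -> v *m (Z *m A) ^+ (l * n) = 0.
  elim: l => [|l IHl] m v vl; first by move: vl; rewrite !expr0 !mulmx1.
  rewrite mulSn exprD mulmxA; apply: IHl.
  suff H j : v *m (Z *m A) ^+ j *m A ^+ l = (v *m A ^+ l *m C ^+ j) *+ (l.+1 ^ j) /\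
             v *m (Z *m A) ^+ j *m A ^+ l.+1 = 0.
    by rewrite (H n).1 Cn mulmx0 mul0rn.
  elim: j => [|j [IH1 IH2]]; first by rewrite !expr0 !mulmx1 expn0.
  set u := v *m (Z *m A) ^+ j in IH1 IH2.
  have uE : v *m (Z *m A) ^+ j.+1 = u *m Z *m A by rewrite exprSr !mulmxA.
  have uA : u *m Z *m A *m A ^+ l = (u *m A ^+ l *m C) *+ l.+1.
    rewrite -mulmxA -[A *m A ^+ l]exprmxS -mulmxA ZA mulmxDr mulmxA IH2 mul0mx add0r.
    by rewrite mulmxnr mulmxA.
  have CAl : C *m A = A *m C by [].
  rewrite uE; split; first by rewrite uA IH1 mulmxnl -mulmxA -exprmxSr -mulrnA expnSr.
  by rewrite exprSr mulmxA uA mulmxnl -mulmxA CAl mulmxA -[_ *m A]mulmxA -exprmxSr IH2 mul0mx mul0rn.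
by apply: (@trace_nilpotent _ _ _ (k * n)); rewrite -[LHS]mul1mx ker // mul1mx.
Qed.

(** Left and right multiplication by [e] commute; [p] and [q] bound how many of each still kill
    [z]. *)
Lemma ad_nilpotent (e z : 'M[K]_n) k : e ^+ k = 0 -> iter (k + k) (lie_bracket e) z = 0.
Proof.
move=> ek; suff H p q : forall z : 'M[K]_n, e ^+ p *m z = 0 -> z *m e ^+ q = 0 ->
    iter (p + q) (lie_bracket e) z = 0 by apply: H; rewrite ek ?mul0mx ?mulmx0.
have [t pqt] := ubnP (p + q); elim: t => // t IHt in p q pqt * => {}z pz zq.
have iter0 r : iter r (lie_bracket e) 0 = 0 by elim: r => //= r ->; rewrite linear0.
have iterB r u v : iter r (lie_bracket e) (u - v) =
    iter r (lie_bracket e) u - iter r (lie_bracket e) v.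
  by elim: r => //= r ->; rewrite linearB.
case: p pz pqt => [|p] pz pqt; first by move: pz; rewrite expr0 mul1mx => ->.
case: q zq pqt => [|q] zq pqt; first by move: zq; rewrite expr0 mulmx1 => ->.
rewrite addSn iterSr {2}/lie_bracket iterB.
have -> : iter (p + q.+1) (lie_bracket e) (e *m z) = 0.
  apply: IHt; first by rewrite -ltnS.
    by rewrite mulmxA -exprmxSr.
  by rewrite -mulmxA zq mulmx0.
rewrite sub0r -addSnnS (IHt p.+1 q) ?oppr0 //.
- by rewrite addSnnS -ltnS.
- by rewrite mulmxA pz mul0mx.
- by rewrite -mulmxA -exprmxS.
Qed.

End NilpotentElements.

(** * Duality and weights for a nondegenerate Killing form *)

Section NondegenerateKilling.
Variables (K : closedFieldType) (n : nat).
Hypothesis char0 : [pchar K] =i pred0.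
Implicit Types (X Y Z a v w x y z : 'M[K]_n).
Variable L : {vspace 'M[K]_n}.
Hypothesis LB : forall X Y, X \in L -> Y \in L -> lie_bracket X Y \in L.
Hypothesis nondeg : forall X, X \in L ->
  (forall Y, Y \in L -> killing_form L X Y = 0) -> X = 0.
Local Notation d := (\dim L).

Definition gram : 'M[K]_d :=
  \matrix_(i, j) killing_form L (uncrd (delta_mx 0 i)) (uncrd (delta_mx 0 j)).

Lemma gramE X Y : X \in L -> Y \in L ->
  killing_form L X Y = (crd L X *m gram *m (crd L Y)^T) 0 0.
Proof.
move=> LX LY; have uncrd_delta (c : 'rV[K]_d) : uncrd c = \sum_i c 0 i *: uncrd (delta_mx 0 i).
  apply: (crd_inj (L := L)); rewrite ?uncrd_mem //.
    by apply: memv_suml => i _; apply/memvZ/uncrd_mem.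
  rewrite uncrdK linear_sum {1}[c]row_sum_delta; apply: eq_bigr => i _.
  by rewrite linearZ /= uncrdK.
have killing_sum (I : Type) (r : seq I) (c : I -> K) (F : I -> 'M[K]_n) W : W \in L ->
    killing_form L (\sum_(i <- r) c i *: F i) W = \sum_(i <- r) c i * killing_form L (F i) W.
  move=> LW; rewrite killing_trace // linear_sum mulmx_suml raddf_sum.
  by apply: eq_bigr => i _; rewrite /= linearZ /= -scalemxAl mxtraceZ killing_trace.
rewrite -{1}(crdK LX) uncrd_delta killing_sum // -mulmxA mxE; apply: eq_bigr => i _.
congr (_ * _); rewrite killingC ?uncrd_mem // -{1}(crdK LY) uncrd_delta killing_sum ?uncrd_mem //.
rewrite mxE; apply: eq_bigr => j _.
by rewrite killingC ?uncrd_mem // [gram i j]mxE [(_^T) j 0]mxE mulrC.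
Qed.

Lemma gram_unit : gram \in unitmx.
Proof.
rewrite -row_free_unit; apply: inj_row_free => c c0.
have /(congr1 (crd L)) : uncrd c = 0.
  apply: nondeg => [|Y LY]; first exact: uncrd_mem.
  by rewrite gramE ?uncrd_mem // uncrdK c0 mul0mx mxE.
by rewrite uncrdK linear0.
Qed.

Lemma gram_skew x : x \in L -> adm L x *m gram = - (gram *m (adm L x)^T).
Proof.
move=> Lx; apply/matrixP => i j.
have E (M : 'M[K]_d) : M i j = ((delta_mx 0 i : 'rV[K]_d) *m M *m (delta_mx 0 j : 'rV[K]_d)^T) 0 0.
  by rewrite -rowE trmx_delta -colE !mxE.
rewrite E [RHS]E mulmxN mulNmx [RHS]mxE.
have assoc (u v : 'rV[K]_d) : u *m (gram *m (adm L x)^T) *m v^T = u *m gram *m (v *m adm L x)^T.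
  by rewrite trmx_mul !mulmxA.
rewrite assoc [delta_mx 0 i *m (_ *m gram)]mulmxA.
pose bi : 'M[K]_n := uncrd (delta_mx 0 i : 'rV[K]_d).
pose bj : 'M[K]_n := uncrd (delta_mx 0 j : 'rV[K]_d).
have Lbi : bi \in L by apply: uncrd_mem.
have Lbj : bj \in L by apply: uncrd_mem.
have -> : delta_mx 0 i *m adm L x = crd L (lie_bracket x bi) by rewrite crd_lie // uncrdK.
have -> : delta_mx 0 j *m adm L x = crd L (lie_bracket x bj) by rewrite crd_lie // uncrdK.
have <- : crd L bi = delta_mx 0 i by rewrite uncrdK.
have <- : crd L bj = delta_mx 0 j by rewrite uncrdK.
rewrite -!gramE ?LB // lieC -scaleN1r killingZl // killing_invariant //.
by rewrite mulN1r.
Qed.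

Lemma ad_image x v k : x \in L -> v \in L ->
  (forall z, z \in L -> iter k (lie_bracket x) z = 0 -> killing_form L v z = 0) ->
  exists2 y, y \in L & v = iter k (lie_bracket x) y.
Proof.
move=> Lx Lv orth; pose A := adm L x.
have skew : A ^+ k *m gram = (-1) ^+ k *: (gram *m (A ^+ k)^T).
  elim: k {orth} => [|k IHk]; first by rewrite !expr0 trmx1 mul1mx mulmx1 scale1r.
  rewrite exprSr -mulmxA gram_skew // mulmxN mulmxA IHk -scalemxAl -mulmxA.
  have -> : (A ^+ k)^T *m A^T = (A ^+ k *m A)^T *m 1%:M; last first.
    by rewrite mulmx1 exprS mulN1r scaleNr.
  rewrite mulmx1 -trmx_mul; congr (_ ^T).
  by rewrite -exprmxSr exprmxS.
have [/submxP[c cE]|] := boolP (crd L v <= A ^+ k)%MS.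
  exists (uncrd c); first exact: uncrd_mem.
  apply: (crd_inj (L := L)) => //; first by apply: (ad_iter_mem LB) => //; apply: uncrd_mem.
  by rewrite (crd_ad_iter LB) ?uncrd_mem // uncrdK cE.
rewrite submxE => nz; exfalso; move/negP: nz; apply; apply/eqP/rowP => j; rewrite [RHS]mxE.
(* If [v] is outside the image, a column of the cokernel detects it; through the form this column is
   an element [z] of the kernel of (ad x)^k. *)
pose u : 'cV[K]_d := cokermx (A ^+ k) *m delta_mx j 0.
have Au : A ^+ k *m u = 0 by rewrite /u mulmxA mulmx_coker mul0mx.
pose z := uncrd ((invmx gram *m u)^T).
have zE : gram *m (crd L z)^T = u by rewrite uncrdK trmxK mulKVmx // gram_unit.
have z0 : iter k (lie_bracket x) z = 0.
  apply: (crd_inj (L := L)); rewrite ?mem0v ?(ad_iter_mem LB) ?uncrd_mem //.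
  rewrite linear0 (crd_ad_iter LB) ?uncrd_mem //; apply: trmx_inj; rewrite trmx0 trmx_mul.
  have : gram *m ((A ^+ k)^T *m (crd L z)^T) = 0.
    have : A ^+ k *m gram *m (crd L z)^T = 0 by rewrite -mulmxA zE.
    rewrite skew -scalemxAl -mulmxA => /eqP; rewrite scaler_eq0 signr_eq0 /=.
    by move/eqP.
  by move/(congr1 (mulmx (invmx gram))); rewrite mulKmx ?gram_unit // mulmx0.
have := orth z (uncrd_mem _) z0; rewrite gramE ?uncrd_mem // -mulmxA zE.
by rewrite /u mulmxA -colE mxE.
Qed.

(** If [z] commutes with [e], the product of ad e and ad z is nilpotent, so [e] is orthogonal to the
    kernel of ad e. *)
Lemma nilpotent_mem_image e k : e \in L -> e ^+ k = 0 -> exists2 z, z \in L & e = lie_bracket z e.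
Proof.
move=> Le ek; have [|y Ly eE] := @ad_image e e 1 Le Le; last first.
  by exists (- y); rewrite ?memvN // lieNl -lieC.
move=> z Lz /= ez; rewrite killing_trace //.
have comm : GRing.comm (adm L e) (adm L z).
  have := adm_lie LB Le Lz; rewrite ez linear0 => /esym/eqP.
  by rewrite subr_eq0 => /eqP.
have An : adm L e ^+ (k + k) = 0.
  apply/row_matrixP => i; rewrite row0 rowE.
  by rewrite -[delta_mx 0 i]uncrdK -(crd_ad_iter LB) ?uncrd_mem // ad_nilpotent // linear0.
apply: (@trace_nilpotent _ _ _ (k + k)).
by rewrite -[_ *m _]/(adm L e * adm L z) exprMn_comm // An mul0r.
Qed.

(** It suffices that [a] is orthogonal to the kernel of (ad a)^2; for [z] in it, [a, z] commutes
    with [a], as [trace_commuting_commutator] requires. The equation [h0, a] = a makes [a]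
    nilpotent. *)
Lemma mem_ad_square a h0 : a \in L -> h0 \in L -> lie_bracket h0 a = a ->
  exists2 y, y \in L & a = lie_bracket a (lie_bracket a y).
Proof.
move=> La Lh ha; have an : a ^+ n = 0 by apply: (commutator_nilpotent char0 (Y := a) (Z := h0)).
apply: (@ad_image a a 2) => // z Lz /= az.
rewrite killingC // killing_trace //; apply: (@trace_commuting_commutator _ _ char0 _ _ (n + n)).
  apply/row_matrixP => i; rewrite row0 rowE.
  by rewrite -[delta_mx 0 i]uncrdK -(crd_ad_iter LB) ?uncrd_mem // ad_nilpotent // linear0.
rewrite -adm_lie //; apply/eqP; rewrite -subr_eq0 -adm_lie ?LB //.
by rewrite az linear0.
Qed.

Section Weights.
Variables (a w f : 'M[K]_n).
Hypotheses (La : a \in L) (Lw : w \in L) (Lf : f \in L).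
Hypotheses (af : lie_bracket a f = w) (wa : lie_bracket w a = 2%:R *: a).

(** The sl2 relation moving a power of ad a past ad f; writing ad w to the left of the powers
    produces the shift by [k]. *)
Lemma ad_iter_commute k y : iter k.+1 (lie_bracket a) (lie_bracket f y) =
  lie_bracket f (iter k.+1 (lie_bracket a) y) +
  k.+1%:R *: (lie_bracket w (iter k (lie_bracket a) y) - k%:R *: iter k (lie_bracket a) y).
Proof.
have aw z : lie_bracket a (lie_bracket w z) =
    lie_bracket w (lie_bracket a z) - 2%:R *: lie_bracket a z.
  by rewrite [RHS]addrC lie_jacobi [lie_bracket a w]lieC wa lieNl lieZl.
elim: k => [|k IHk] /=.
  by rewrite (lie_jacobi a f) af scale0r subr0 scale1r addrC.
rewrite [X in lie_bracket a X = _]IHk (linearD (lie_bracket a)) /= (lie_jacobi a f) af.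
rewrite (linearZZ (lie_bracket a)) (linearB (lie_bracket a) (lie_bracket w _) (_ *: _)).
rewrite (linearZZ (lie_bracket a)) /= aw.
set u := lie_bracket a _; move: (lie_bracket f _) (lie_bracket w u) => p q.
by apply/matrixP => i j; rewrite !mxE -!natr1; ring.
Qed.

Lemma killing_shifted v z c : v \in L -> z \in L ->
  killing_form L (shifted_ad w c v) z =
  - killing_form L v (lie_bracket w z) - c * killing_form L v z.
Proof.
move=> Lv Lz; rewrite /shifted_ad -scaleNr killingDl // killingZl // mulNr; congr (_ - _).
by rewrite lieC -scaleN1r killingZl // killing_invariant // mulN1r.
Qed.

(* [(ad w - k) z] lies in the image of [(ad a)^(k+1)] if [z] lies in the kernel
   of [ad a] and in the image of [(ad a)^k], so [ad w] has only eigenvalues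
   [k >= 0] on that kernel, while [v] pairs with the eigenvalue [-2]. *)
Lemma weight2_orthogonal v z : graded L w 2%:R v -> z \in L -> lie_bracket a z = 0 ->
  killing_form L v z = 0.
Proof.
move=> gv Lz az; have an : a ^+ n = 0.
  apply: (commutator_nilpotent char0 (Y := a) (Z := 2%:R^-1 *: w)) => //.
  by rewrite lieZl wa scalerA mulVf ?scale1r // natr_char0.
(* Descending induction on [k], starting at 2n, where (ad a)^k vanishes. *)
suff H j k : (k + j = n + n)%N -> forall z, z \in L -> lie_bracket a z = 0 ->
    (exists2 y, y \in L & z = iter k (lie_bracket a) y) ->
    forall v, graded L w 2%:R v -> killing_form L v z = 0.
  by apply: (H (n + n)%N 0%N) gv => //; exists z.
elim: j k => [|j IHj] k kj {}z {}Lz {}az [y Ly zE] {gv}v gv.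
  rewrite addn0 in kj; rewrite zE kj ad_nilpotent //.
  rewrite killingC ?mem0v ?gv.1 // -(scale0r 0) killingZl ?gv.1 //.
  by rewrite mul0r.
pose z' := lie_bracket w z - k%:R *: z.
have Lz' : z' \in L by rewrite memvB ?memvZ ?LB.
have az' : lie_bracket a z' = 0.
  rewrite (linearB (lie_bracket a) (lie_bracket w z) (_ *: _)) (linearZZ (lie_bracket a)) /= az.
  rewrite scaler0 subr0 (lie_jacobi a w z) az (linear0 (lie_bracket w)) addr0.
  by rewrite [lie_bracket a w]lieC wa lieNl lieZl az scaler0 oppr0.
have imz' : exists2 y, y \in L & z' = iter k.+1 (lie_bracket a) y.
  exists (k.+1%:R^-1 *: lie_bracket f y); first by rewrite memvZ ?LB.
  have iterZ r c u : iter r (lie_bracket a) (c *: u) = c *: iter r (lie_bracket a) u.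
    by elim: r => //= r ->; rewrite linearZ.
  rewrite iterZ ad_iter_commute -zE /= -zE az linear0 add0r scalerA mulVf ?scale1r //.
  by rewrite natr_char0.
(* The pairing with [z'] is zero by induction, so each shift of [u] multiplies its pairing with [z]
   by the nonzero scalar -(k + 2), while enough shifts kill [v]. *)
have rec u : graded L w 2%:R u ->
    killing_form L (shifted_ad w 2%:R u) z = - (k + 2)%:R * killing_form L u z.
  move=> gu; have := IHj k.+1 _ z' Lz' az' imz' u gu; rewrite addSnnS kj => /(_ erefl).
  rewrite killing_shifted ?gu.1 //.
  have -> : killing_form L u z' = killing_form L u (lie_bracket w z) - k%:R * killing_form L u z.
    rewrite !(killingC LB gu.1) ?LB // /z' -scaleNr killingDl ?gu.1 // killingZl ?gu.1 //.
    by rewrite mulNr.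
  by move=> /eqP; rewrite subr_eq0 => /eqP ->; rewrite natrD; ring.
have gshift r : graded L w 2%:R (iter r (shifted_ad w 2%:R) v).
  elim: r => //= r [Lr [s rs]]; split; first exact: shifted_ad_mem.
  exists s; rewrite -[LHS]iterSr iterS rs /shifted_ad linear0 scaler0.
  by rewrite subrr.
have [Lv [s vs]] := gv.
have iterE r : killing_form L (iter r (shifted_ad w 2%:R) v) z =
    (- (k + 2)%:R) ^+ r * killing_form L v z.
  elim: r => [|r IHr]; first by rewrite expr0 mul1r.
  by rewrite iterS rec // IHr exprS mulrA.
have := iterE s; rewrite vs -(scale0r 0) killingZl // mul0r => /esym/eqP.
by rewrite mulf_eq0 expf_eq0 oppr_eq0 natr_char0 // addn2 andbF => /eqP.
Qed.

(** Duality gives [y] with [a, y] = v; the component of [y] of weight 0 has the same image, as the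
    other components map to weights other than 2. *)
Lemma weight2_surjective v : graded L w 2%:R v ->
  exists2 x, graded L w 0 x & lie_bracket x a = v.
Proof.
move=> gv; have [Lv _] := gv.
have [|y Ly vE] := @ad_image a v 1 La Lv.
  by move=> z Lz az; apply: weight2_orthogonal.
have [s [P [us [P1 PA PP P0 _]]]] := spectral_projectors (adm L w).
have ga : graded L w 2%:R a.
  by split=> //; exists 1%N; rewrite /= /shifted_ad wa subrr.
have comp_sum l (I : Type) (r : seq I) (F : I -> 'M[K]_n) :
    component P l (\sum_(i <- r) F i) = \sum_(i <- r) component P l (F i).
  rewrite /component linear_sum mulmx_suml.
  apply: (crd_inj (L := L)); rewrite ?uncrd_mem //.
    by apply: memv_suml => i _; apply: uncrd_mem.
  by rewrite uncrdK linear_sum; apply: eq_bigr => i _; rewrite /= uncrdK.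
pose x := component P 0 y.
have gx : graded L w 0 x by apply: component_graded.
have g2 l : graded L w (2%:R + l) (lie_bracket a (component P l y)).
  by apply: graded_lie => //; apply: component_graded.
have vx : v = lie_bracket a x.
  rewrite -(graded_component LB Lw PP gv) vE /= {1}(component_sum P1 Ly).
  rewrite (linear_sum (lie_bracket a)) comp_sum.
  have [s0|s0] := boolP (0 \in s).
    rewrite (bigD1_seq 0) //= big1 => [|l l0].
      by have := g2 0; rewrite !addr0 => g20; rewrite (graded_component LB Lw PP g20).
    by apply: (graded_component_neq LB Lw PP P0 _ (g2 l)); rewrite -subr_eq0 addrC addKr.
  have -> : x = 0 by apply: (graded_notin LB Lw P1 PP P0 s0 gx).
  rewrite linear0 big_seq big1 // => l ls.
  apply: (graded_component_neq LB Lw PP P0 _ (g2 l)); rewrite -subr_eq0 addrC addKr.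
  by apply: contraNneq s0 => <-.
exists (- x); last by rewrite vx lieNl -lieC.
split; first by rewrite memvN; case: gx.
have [_ [k xk]] := gx; exists k.
have := shifted_adD w 0 k (- x) x.
by rewrite addNr shifted_ad0 xk addr0 => <-.
Qed.

End Weights.
End NondegenerateKilling.

(** * Proof of the theorem *)

Section DenseOrbitInPlane.
Variables (K : closedFieldType) (n : nat) (G : set 'M[K]_n).
Hypothesis char0 : [pchar K] =i pred0.
Hypothesis sG : simple_group G.
Implicit Types (a b v w x y : 'M[K]_n).
Let aG := simple_alg sG.
Let pG := simple_prime sG.
Let det1 := simple_det sG.
Let LB := Lie_bracket aG det1.
Local Notation L := (Lie G).

Section Prehomogeneous.
Variables (a w : 'M[K]_n).
Hypotheses (La : a \in L) (Lw : w \in L).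
Hypothesis surj : forall v, graded L w 2%:R v -> exists2 x, graded L w 0 x & lie_bracket x a = v.
Hypothesis ga : graded L w 2%:R a.

Lemma gradedZ l c v : graded L w l v -> graded L w l (c *: v).
Proof.
move=> [Lv [k vk]]; split; first exact: memvZ.
exists k; suff -> : iter k (shifted_ad w l) (c *: v) = c *: iter k (shifted_ad w l) v.
  by rewrite vk scaler0.
elim: k {vk} => //= k ->; rewrite /shifted_ad (linearZZ (lie_bracket w)) /= [RHS]scalerBr.
by rewrite !scalerA [l * c]mulrC.
Qed.

Lemma graded_sum l (I : Type) (r : seq I) (F : I -> 'M[K]_n) :
  (forall i, graded L w l (F i)) -> graded L w l (\sum_(i <- r) F i).
Proof.
move=> gF; elim/big_ind: _ => // [|x y]; last exact: gradedD.
by split; [apply: mem0v|exists 0%N].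
Qed.

Lemma closure_graded x : graded L w 2%:R x ->
  (forall v, graded L w 2%:R v -> exists2 X, graded L w 0 X & lie_bracket X x = v) ->
  forall y, graded L w 2%:R y -> zariski_closure (Ad_orbit G x) y.
Proof.
move=> gx sx; apply: (orbit_closure_vanish char0 aG det1 (L := graded L w 0)) => //.
- by move=> X [].
- by move=> X v gX gv; have := graded_lie LB Lw gX gv; rewrite add0r.
- by move=> u v gu gv; rewrite -scaleN1r; apply: gradedD => //; apply: gradedZ.
Qed.

(** Each orbit lies in the closure of the other; that of [a] contains a nonempty open part of this
    closure, which the orbit of [x] must meet. *)
Lemma orbit_eq x : graded L w 2%:R x ->
  (forall v, graded L w 2%:R v -> exists2 X, graded L w 0 X & lie_bracket X x = v) ->
  Ad_orbit G a x.
Proof.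
move=> gx sx; have clxa := closure_graded gx sx ga; have clax := closure_graded ga surj gx.
have [r [[y ay ry] rP]] := open_orbit char0 a aG pG det1.
have [z xz rz] : exists2 z, Ad_orbit G x z & mx_eval r z != 0.
  apply: contrapT => noz; move/negP: ry; apply; apply/eqP.
  apply: (orbit_closure aG clxa) ay => z xz; apply: contrapT => /eqP rz.
  by apply: noz; exists z.
have az : Ad_orbit G a z.
  apply: rP => //; apply/zariski_closureP => q qa.
  exact: (orbit_closure aG clax) qa _ xz.
exact: (orbit_trans aG az (orbit_sym aG xz)).
Qed.

(** Choose preimages [X i] of a basis of g_2 under X -> [X, a]. Bracketing them with the point of
    parameter t gives the matrix 1 + tC, so the point qualifies for [orbit_eq] where the determinant
    is nonzero. *)
Lemma orbit_line y : graded L w 2%:R y ->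
  exists2 delta : {poly K}, delta.[0] != 0 &
    forall t, delta.[t] != 0 -> Ad_orbit G a (a + t *: (y - a)).
Proof.
move=> gy; set u := y - a.
have gu : graded L w 2%:R u by rewrite /u -scaleN1r; apply: gradedD => //; apply: gradedZ.
have V0 : graded L w 2%:R 0 by split; [apply: mem0v|exists 0%N].
have VL c v1 v2 : graded L w 2%:R v1 -> graded L w 2%:R v2 -> graded L w 2%:R (c *: v1 + v2).
  by move=> g1 g2; apply: gradedD => //; apply: gradedZ.
pose V := vspace_of [set v | graded L w 2%:R v].
have VP v : v \in V <-> graded L w 2%:R v := mem_vspace_of V0 VL v.
pose bV (i : 'I_(\dim V)) : 'M[K]_n := (vbasis V)`_i.
have gb i : graded L w 2%:R (bV i) by apply/VP/mem_vbasis_nth.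
have /choice[X XP] : forall i, exists X, graded L w 0 X /\ lie_bracket X a = bV i.
  by move=> i; have [X gX XE] := surj (gb i); exists X.
pose C : 'M[K]_(\dim V) := \matrix_(i, j) coord (vbasis V) j (lie_bracket (X i) u).
have CE i : lie_bracket (X i) u = \sum_j C i j *: bV j.
  have /VP : graded L w 2%:R (lie_bracket (X i) u).
    by have := graded_lie LB Lw (XP i).1 gu; rewrite add0r.
  by move=> /coord_vbasis {1}->; apply: eq_bigr => j _; rewrite mxE.
pose D : 'M[{poly K}]_(\dim V) := 1%:M + 'X *: map_mx polyC C.
have Dt t : map_mx (horner_eval t) D = 1%:M + t *: C.
  rewrite /D map_mxD map_mx1 map_mxZ /= /horner_eval hornerX; congr (_ + _ *: _).
  by apply/matrixP => i j; rewrite !mxE hornerC.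
exists (\det D) => [|t].
  by rewrite -[_.[0]]/(horner_eval 0 (\det D)) -det_map_mx Dt scale0r addr0 matrix.det1 oner_eq0.
rewrite -[_.[t]]/(horner_eval t (\det D)) -det_map_mx Dt => detM.
set M := 1%:M + t *: C in detM; have uM : M \in unitmx by rewrite unitmxE unitfE.
have gat : graded L w 2%:R (a + t *: u) by apply: gradedD => //; apply: gradedZ.
apply: orbit_eq => // v gv; have /VP Vv := gv.
pose c : 'rV[K]_(\dim V) := (\row_i coord (vbasis V) i v) *m invmx M.
exists (\sum_i c 0 i *: X i).
  by apply: graded_sum => i; apply/gradedZ/(XP i).1.
have XM i : lie_bracket (X i) (a + t *: u) = \sum_j M i j *: bV j.
  rewrite (linearD (lie_bracket (X i))) (linearZZ (lie_bracket (X i))) /= (XP i).2 CE.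
  rewrite scaler_sumr (bigD1 i) //= [RHS](bigD1 i) //= addrA; congr (_ + _).
    by rewrite !mxE eqxx mulr1n scalerDl scale1r scalerA.
  by apply: eq_bigr => j ji; rewrite !mxE eq_sym (negbTE ji) mulr0n add0r scalerA.
have -> : lie_bracket (\sum_i c 0 i *: X i) (a + t *: u) =
    \sum_i c 0 i *: lie_bracket (X i) (a + t *: u).
  rewrite (big_morph (fun Z => lie_bracket Z (a + t *: u)) (id1 := 0) (op1 := +%R)).
  - by apply: eq_bigr => i _; rewrite lieZl.
  - by move=> Z1 Z2; rewrite lieDl.
  - by rewrite lie0l.
under eq_bigr => i _ do rewrite XM scaler_sumr.
rewrite exchange_big /= [RHS](coord_vbasis Vv); apply: eq_bigr => j _.
under eq_bigr => i _ do rewrite scalerA.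
rewrite -scaler_suml; congr (_ *: _).
have := mulmxKV uM (\row_i coord (vbasis V) i v); rewrite -/c => /rowP/(_ j).
by rewrite !mxE.
Qed.

End Prehomogeneous.
End DenseOrbitInPlane.

Theorem theorem3p13 (K : closedFieldType) (char0 : [pchar K] =i pred0)
  (n : nat) (G H : set 'M[K]_n)
  (G_simple : simple_group G)
  (H_reductive : reductive_group H) (H_connected : zariski_connected H)
  (HG : H `<=` G)
  (m : {vspace 'M[K]_n}) (m_def : m = killing_orth (Lie G) (Lie H))
  (g_eq : (Lie G = Lie H + m)%VS) (g_direct : directv (Lie H + m))
  (O Omega : set 'M[K]_n)
  (O_nilp : nilpotent_orbit G O)
  (Omega_orbit : exists X, Omega = Ad_orbit H X)
  (Omega_dense : dense_in Omega O)
  (e a b : 'M[K]_n) (e_Omega : Omega e)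
  (a_h : a \in Lie H) (b_m : b \in m) (e_ab : e = a + b) :
  let P : {vspace 'M[K]_n} := <<[:: a; b]>>%VS in
  zariski_closure (Ad_orbit G a) b /\
  dense_in (Ad_orbit G a `&` [set` P]) [set` P].
Proof.
have aG := simple_alg G_simple; have det1G := simple_det G_simple.
have [aH _] := H_reductive; have pH := vanish_prime aH H_connected.
have det1H g : H g -> \det g = 1 by move=> /HG; apply: det1G.
pose L := Lie G; have LB := Lie_bracket aG det1G.
have nondeg := killing_nondegenerate char0 G_simple.
have hL X : X \in Lie H -> X \in L by move=> hX; rewrite /L g_eq (subvP (addvSl _ _)).
have mL X : X \in m -> X \in L by move=> mX; rewrite /L g_eq (subvP (addvSr _ _)).
have mP X : X \in m <-> X \in L /\ forall Y, Y \in Lie H -> killing_form L X Y = 0.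
  by rewrite m_def; apply: mem_killing_orth.
have hmm X Y : X \in Lie H -> Y \in m -> lie_bracket X Y \in m.
  move=> hX mY; have LX := hL X hX; have [LY Yorth] := (mP Y).1 mY.
  apply/mP; split=> [|Z hZ]; first exact: LB.
  have LZ := hL Z hZ; rewrite lieC -scaleN1r killingZl // killing_invariant // Yorth ?mulr0 //.
  exact: (Lie_bracket aH det1H).
have hm0 X : X \in Lie H -> X \in m -> X = 0.
  by move=> hX mX; have /directv_addP := g_direct => E; apply/eqP; rewrite -memv0 -E memv_cap hX.
have split0 X Y : X \in Lie H -> Y \in m -> X + Y = 0 -> X = 0 /\ Y = 0.
  move=> hX mY /eqP; rewrite addr_eq0 => /eqP XY.
  have X0 : X = 0 by apply: hm0 => //; rewrite XY memvN.
  by split=> //; apply/eqP; rewrite -oppr_eq0 -XY X0.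
have La := hL a a_h; have Lb := mL b b_m.
have Le : e \in L by rewrite e_ab memvD.
have [k ek] : nilpotent_mx e.
  have [X0 [_ [k Xk] OE]] := O_nilp; have := Omega_dense.1 e e_Omega; rewrite OE => -[g Gg <-].
  exists k; have ug := alg_group_unit aG Gg.
  suff -> j : (g *m X0 *m invmx g) ^+ j = g *m X0 ^+ j *m invmx g by rewrite Xk mulmx0 mul0mx.
  elim: j => [|j IHj]; first by rewrite !expr0 mulmx1 mulmxV.
  by rewrite !exprmxSr IHj !mulmxA mulmxKV.
(* [Omega] and [O] both contain [e], so the density hypothesis transfers to the orbits of [e]. *)
have dense : Ad_orbit G e `<=` zariski_closure (Ad_orbit H e).
  have [X0 OmE] := Omega_orbit; have [Y0 [_ _ OE]] := O_nilp.
  move=> y ey; have Oy : O y.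
    have Oe := Omega_dense.1 e e_Omega; rewrite OE in Oe *.
    exact: (orbit_trans aG Oe ey).
  apply/zariski_closureP => q qe; move/zariski_closureP: (Omega_dense.2 y Oy); apply.
  move=> z; move: e_Omega; rewrite OmE => Xe Xz; apply: qe.
  exact: (orbit_trans aH (orbit_sym aH Xe) Xz).
have tangent X : X \in L -> exists2 Y, Y \in Lie H & lie_bracket Y e = lie_bracket X e.
  exact: (dense_orbit_tangent char0 aG aH pH det1G HG dense).
have key X : X \in L -> lie_bracket X e \in m -> lie_bracket X e = 0.
  move=> LX mXe; have [LXe orth] := (mP _).1 mXe.
  apply: nondeg => // Y LY; have [Z hZ ZE] := tangent Y LY.
  have LZ := hL Z hZ; rewrite killing_invariant // [lie_bracket e Y]lieC -ZE -lieC.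
  by rewrite -killing_invariant // orth.
(* [key] applies to [b], as [b, e] = - [a, b] lies in m. *)
have ab0 : lie_bracket a b = 0.
  have E : lie_bracket b e = - lie_bracket a b.
    by rewrite e_ab (linearD (lie_bracket b)) /= lieXX addr0 lieC.
  have := key b Lb; rewrite E memvN => /(_ (hmm _ _ a_h b_m))/eqP.
  by rewrite oppr_eq0 => /eqP.
have cent X : X \in Lie H -> lie_bracket X a = 0 -> lie_bracket X b = 0.
  move=> hX Xa; have E : lie_bracket X e = lie_bracket X b.
    by rewrite e_ab (linearD (lie_bracket X)) /= Xa add0r.
  by rewrite -E; apply: key; rewrite ?hL // E hmm.
have [h0 h0h [h0a h0b]] : exists2 h0, h0 \in Lie H & lie_bracket h0 a = a /\ lie_bracket h0 b = b.
  have [z Lz zE] := nilpotent_mem_image LB nondeg Le ek.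
  have [h0 h0h h0E] := tangent z Lz; exists h0 => //.
  have [|||/eqP ha0 /eqP hb0] := split0 (lie_bracket h0 a - a) (lie_bracket h0 b - b).
  - by rewrite memvB // (Lie_bracket aH det1H).
  - by rewrite memvB // hmm.
  - by rewrite addrACA -opprD -(linearD (lie_bracket h0)) /= -e_ab h0E -zE subrr.
  - by rewrite !subr_eq0 in ha0 hb0; split; apply/eqP.
have [y Ly aE] := mem_ad_square char0 LB nondeg La (hL _ h0h) h0a.
have : y \in (Lie H + m)%VS by rewrite -g_eq.
case/memv_addP=> y1 hy1 [y2 my2 yE].
(* ad a preserves h and m, so the component [y1] also satisfies [a, [a, y1]] = a; the factor -2 then
   yields [w, a] = 2a. *)
pose f := - 2%:R *: y1; pose w := lie_bracket a f.
have hf : f \in Lie H by apply: memvZ.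
have hw : w \in Lie H by apply: (Lie_bracket aH det1H).
have wa : lie_bracket w a = 2%:R *: a.
  have E1 : lie_bracket a (lie_bracket a y1) \in Lie H by do 2!apply: (Lie_bracket aH det1H) => //.
  have E2 : lie_bracket a (lie_bracket a y2) \in m by do 2!apply: (hmm) => //.
  have aE' : a = lie_bracket a (lie_bracket a y1) + lie_bracket a (lie_bracket a y2).
    by rewrite {1}aE yE (linearD (lie_bracket a) y1) (linearD (lie_bracket a)).
  have [||E _] := split0 (lie_bracket a (lie_bracket a y1) - a) (lie_bracket a (lie_bracket a y2)) _ E2.
  - by rewrite memvB.
  - by rewrite addrAC -aE' subrr.
  rewrite /w /f (linearZZ (lie_bracket a)) /= lieZl lieC scalerN scaleNr opprK.
  by congr (_ *: _); apply/eqP; rewrite -subr_eq0 E.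
have af : lie_bracket a f = w by [].
clearbody w; have Lw := hL w hw; have Lf := hL f hf.
have wb : lie_bracket w b = 2%:R *: b.
  have /cent : w - 2%:R *: h0 \in Lie H by rewrite memvB ?memvZ.
  rewrite !lieDl !lieNl !lieZl wa h0a h0b subrr => /(_ erefl)/eqP.
  by rewrite subr_eq0 => /eqP.
have surj := weight2_surjective char0 LB nondeg La Lw Lf af wa.
have ga : graded L w 2%:R a by split=> //; exists 1%N; rewrite /= /shifted_ad wa subrr.
have gb : graded L w 2%:R b by split=> //; exists 1%N; rewrite /= /shifted_ad wb subrr.
move=> P; split; first exact: (closure_graded char0 G_simple Lw ga surj gb).
split=> [x []//|y0 /= Py].
have PL x1 x2 c : x1 \in P -> x2 \in P -> x1 + c *: x2 \in P by move=> *; rewrite memvD ?memvZ.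
have Pa : a \in P by apply: memv_span; rewrite mem_head.
have gy : graded L w 2%:R y0.
  move: Py; rewrite /P span_cons span_seq1 => /memv_addP[_ /vlineP[c1 ->] [_ /vlineP[c2 ->] ->]].
  by apply: gradedD; apply: gradedZ.
have [delta d0 dP] := orbit_line char0 G_simple Lw surj ga gy.
apply/zariski_closureP => q qv.
pose c : 'M[{poly K}]_n := map_mx polyC a + 'X *: map_mx polyC (y0 - a).
have cE t : map_mx (fun f => f.[t]) c = a + t *: (y0 - a).
  by apply/matrixP => i j; rewrite !mxE hornerD hornerM hornerX !hornerC.
(* [q] vanishes on the line wherever [delta] does not, so the product is the zero polynomial; the
   parameter 1 gives [y0]. *)
have : mxe polyC c q * delta = 0.
  apply: (poly_char0_infinite char0) => t; rewrite hornerM horner_curve cE.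
  have [->|dt] := eqVneq delta.[t] 0; first by rewrite mulr0.
  rewrite qv ?mul0r //; split; first exact: dP.
  by apply: PL => //; rewrite memvB.
move/eqP; rewrite mulf_eq0 => /orP[/eqP q0|/eqP dz]; last by rewrite dz horner0 eqxx in d0.
have := horner_curve c q 1; rewrite q0 horner0 cE scale1r addrC subrK.
by move=> <-.
Qed.
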